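(* There exists an uncountable family of pairwise inequivalent embeddings $e:\mathbb{S}^1\to\mathbb{R}^3$ such that, for each of them, $e(\mathbb{S}^1)$ is not an attractor for any homeomorphism of $\mathbb{R}^3$, and $e(\mathbb{S}^1)$ is tame at every point except for a single point.
   Context: Two embeddings $e,e':\mathbb{S}^1\to\mathbb{R}^3$ are equivalent if there exists a homeomorphism $h$ of $\mathbb{R}^3$ with $h(e(\mathbb{S}^1))=e'(\mathbb{S}^1)$. A knot $K\subseteq\mathbb{R}^3$ (a set homeomorphic to $\mathbb{S}^1$) is tame at $p\in K$ if there exist a neighbourhood $U$ of $p$ in $\mathbb{R}^3$ and a homeomorphism $h:\mathbb{R}^3\to\mathbb{R}^3$ that carries $U\cap K$ onto a straight line (segment); otherwise it is wild at $p$. Let $f$ be a homeomorphism of $\mathbb{R}^3$. A compact set $P$ is attracted by $K$ if for each neighbourhood $V$ of $K$ there exists $n_0\in\mathbb{N}$ such that $f^n(P)\subseteq V$ for all $n\geq n_0$. A compact set $K$ with $f(K)=K$ is an attractor for $f$ if it has a neighbourhood $U$ such that every compact set $P\subseteq U$ is attracted by $K$. *)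

(* Defs.v *)
From HB Require Import structures.
From mathcomp Require Export all_boot all_order all_algebra.
From mathcomp Require Export all_classical all_reals all_analysis.
Export Order.TTheory GRing.Theory Num.Theory.
Export numFieldNormedType.Exports.

Set Implicit Arguments.
Unset Strict Implicit.
Unset Printing Implicit Defensive.

Local Open Scope classical_set_scope.
Local Open Scope ring_scope.

Definition homeomorphism (T U : topologicalType) (f : T -> U) : Prop :=
  continuous f /\
  exists g : U -> T, [/\ continuous g, cancel f g & cancel g f].

(* [set_type (range e)] carries the subspace topology, so [e] is required to
   be a homeomorphism onto its image. *)
Definition embedding (T U : topologicalType) (e : T -> U) : Prop :=
  exists2 h : T -> set_type (range e),
    homeomorphism h & forall x, set_val (h x) = e x.

(* The Euclidean unit circle: the norm of ['rV[R]_2] is the sup norm, hence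
   the explicit sum of squares. *)
Definition circle (R : realType) : set 'rV[R]_2 :=
  [set x | \sum_i x 0 i ^+ 2 = 1].

(* The circle as a space, with the subspace topology. *)
Definition S1 (R : realType) : topologicalType := set_type (@circle R).

Definition equivalent (R : realType) (e e' : S1 R -> 'rV[R]_3) : Prop :=
  exists2 h : 'rV[R]_3 -> 'rV[R]_3,
    homeomorphism h & h @` range e = range e'.

Definition segment (R : realType) (a b : 'rV[R]_3) : set 'rV[R]_3 :=
  [set a + t *: (b - a) | t in `[0, 1]].

(* Neighbourhoods need not be open, so that a closed segment can occur; as
   knots are compact, no unbounded line can. *)
Definition tame_at (R : realType) (K : set 'rV[R]_3) (p : 'rV[R]_3) : Prop :=
  exists U : set 'rV[R]_3, nbhs p U /\
  exists2 h : 'rV[R]_3 -> 'rV[R]_3, homeomorphism h &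
    exists a b : 'rV[R]_3, a != b /\ h @` (U `&` K) = segment a b.

Definition wild_at (R : realType) (K : set 'rV[R]_3) (p : 'rV[R]_3) : Prop :=
  ~ tame_at K p.

Definition attracted_by (T : topologicalType) (f : T -> T) (P K : set T) :
    Prop :=
  forall V : set T, set_nbhs K V ->
    exists n0 : nat, forall n : nat, (n0 <= n)%N -> iter n f @` P `<=` V.

Definition attractor (T : topologicalType) (f : T -> T) (K : set T) : Prop :=
  [/\ compact K, f @` K = K &
    exists2 U : set T, set_nbhs K U &
      forall P : set T, compact P -> P `<=` U -> attracted_by f P K].

(* Main.v *)
(* The knot passes through infinitely many runs of crossings that shrink to one
   point p, run n having q(n) crossings (odd) clasped by a third strand.  All
   obstructions come from local systems on the complement, that is, from
   homomorphisms of the knot group to a finite group G; such a system has a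
   nontrivial automorphism over a connected set iff the centraliser of its
   holonomy there is nontrivial.  A dihedral group of order 2m, m odd, colours
   run n nontrivially iff m and q(n) are not coprime, and one can choose freely
   in which of these runs to do so.
   - Wild at p: near a tame point every system has a nontrivial automorphism,
     whereas a system that is nontrivial on infinitely many runs has none on
     theta graphs around these runs, which converge to p.
   - Not an attractor: let v_j be nontrivial on the j-th even run only, and C_j
     the theta graph of that run.  If the knot were an attractor of f then some
     iterate of f would pull C_0, ..., C_m back out of a neighbourhood P of the
     knot.  The complement of P has a finite cover by convex sets, hence only
     finitely many isomorphism classes of systems that come from the complement
     of the knot, so that for large m the pullbacks of two of the v_j are
     isomorphic there, whereas on C_j only v_j has no nontrivial automorphism.
   - Inequivalent: the numbers q(2n + 1) are either 3 or the n-th of a list of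
     distinct primes, depending on a subset of the naturals; if that prime m
     does not occur then all systems in the dihedral group of order 2m have a
     nontrivial automorphism. *)

From HB Require Import structures.
Require Import Defs.
From mathcomp Require Import all_fingroup finmap ring lra zify.
Set Implicit Arguments.
Unset Strict Implicit.
Unset Printing Implicit Defensive.
Local Open Scope classical_set_scope.

(** * Locally constant functions and local systems *)

(** Run n with its third strand is a long torus knot of type (2, q(n)), so the knot is an infinite
    connected sum of torus knots. Since q(n) is odd, one path covers the run: it enters low, arrives
    high after the first passage, returns along the third strand and leaves low after the second
    passage. Fundamental groups would require base points and van Kampen's theorem. Systems of germs
    avoid both: the one invariant in use, a nontrivial automorphism over a set, survives
    isomorphism, pullback along homeomorphisms and restriction to subsets. In place of van Kampen's
    theorem one looks along the vertical direction. The points in front of the knot and the points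
    behind it form two sets over which every system is trivial, and together they miss only the
    vertical segments between the two strands of a crossing. A system therefore amounts to one
    transition element per region of the diagram with one relation per crossing, a Wirtinger
    presentation by regions. With reflections a beside the run and h in its loop, the bigons carry
    the powers of a h, and the right end of the run demands that the power q(n) be 1. *)

Section LocallyConstant.
Variable T : topologicalType.

Definition locally_constant (A : Type) (Y : set T) (f : T -> A) : Prop :=
  forall x, Y x -> \forall z \near x, Y z -> f z = f x.

(** Connectedness in the only form that is used: it turns the locally constant ratio of two
    trivialisations into a constant. *)
Definition connective (Y : set T) : Prop :=
  forall (A : Type) (f : T -> A), locally_constant Y f ->
    forall a b, Y a -> Y b -> f a = f b.

Lemma locally_constantW (A : Type) (Y Z : set T) (f : T -> A) :
  Z `<=` Y -> locally_constant Y f -> locally_constant Z f.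
Proof.
move=> ZY fY x Zx; apply: filterS (fY x (ZY _ Zx)) => z zP Zz.
exact: zP (ZY _ Zz).
Qed.

Lemma connectiveU (Y Z : set T) (c : T) : Y c -> Z c ->
  connective Y -> connective Z -> connective (Y `|` Z).
Proof.
move=> Yc Zc cY cZ A f fP.
have h a : (Y `|` Z) a -> f a = f c.
  case=> ha.
    by apply: cY => //; apply: locally_constantW fP => z; left.
  by apply: cZ => //; apply: locally_constantW fP => z; right.
by move=> a b /h -> /h ->.
Qed.

End LocallyConstant.

Section LocalSystems.
Local Open Scope group_scope.
Variables (T : topologicalType) (G : groupType).
Implicit Types (X Y Z : set T) (v : T -> T -> G) (u : T -> G).

(* [v x] is the germ at [x] of a (discontinuous) trivialisation of a
   [G]-torsor over [X]; germs at nearby points differ by a left factor. *)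
Definition local_system X v : Prop :=
  forall x, X x -> \forall y \near x, exists g : G,
    \forall z \near y, v y z = g * v x z.

(** A single function compatible with all germs over [Y]; two such functions differ by a locally
    constant left factor. *)
Definition trivialises v Y u : Prop :=
  forall x, Y x -> exists g : G, \forall z \near x, Y z -> u z = g * v x z.

(* On a connected set, [u] is an element [<> 1] of the centraliser of the
   holonomy group. *)
Definition nontrivial_auto v Y u : Prop :=
  (forall x, Y x -> u x <> 1) /\
  forall x, Y x -> exists g : G,
    \forall z \near x, Y z -> v x z * u z * (v x z)^-1 = g.

Definition has_auto v Y : Prop := exists u, nontrivial_auto v Y u.

Lemma trivialisesW v Y Z u : Z `<=` Y -> trivialises v Y u ->
  trivialises v Z u.
Proof.
move=> ZY h x /ZY /h [g hg]; exists g.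
by apply: filterS hg => z zP /ZY.
Qed.

Lemma has_autoW v Y Z : Z `<=` Y -> has_auto v Y -> has_auto v Z.
Proof.
move=> ZY [u [u1 h]]; exists u; split=> [x /ZY /u1//|x /ZY /h [g hg]].
by exists g; apply: filterS hg => z zP /ZY.
Qed.

Lemma trivialises_mull v Y u (h : G) :
  trivialises v Y u -> trivialises v Y (fun x => h * u x).
Proof.
move=> uP x /uP [g hg]; exists (h * g).
by apply: filterS hg => z zP /zP ->; rewrite mulgA.
Qed.

Lemma trivialises_ratio v Y Z u u' : trivialises v Y u -> trivialises v Z u' ->
  locally_constant (Y `&` Z) (fun x => u x * (u' x)^-1).
Proof.
move=> uP u'P x [Yx Zx].
have [g hg] := uP _ Yx; have [g' hg'] := u'P _ Zx.
have e z : (Y `&` Z) z -> (Y z -> u z = g * v x z) ->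
    (Z z -> u' z = g' * v x z) -> u z * (u' z)^-1 = g * g'^-1.
  by move=> [Yz Zz] /(_ Yz) -> /(_ Zz) ->; rewrite invgM mulgA mulgK.
have ex : u x * (u' x)^-1 = g * g'^-1.
  by apply: e => //; [exact: nbhs_singleton hg|exact: nbhs_singleton hg'].
by apply: filterS2 hg hg' => z h h' YZz; rewrite ex; apply: e.
Qed.

(** Substitute for van Kampen's theorem: once each trivialisation is normalised to 1 at [b], the
    ratio of two of them is constant on their overlap, which contains [b], hence 1. *)
Lemma star_gluing v (I : Type) (Y : I -> set T) (b : T) :
  (forall i, open (Y i)) -> (forall i, Y i b) ->
  (forall i j, connective (Y i `&` Y j)) ->
  (forall i, exists u, trivialises v (Y i) u) ->
  exists u, trivialises v [set x | exists i, Y i x] u.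
Proof.
move=> oY Yb cY /choice[u0 u0P].
pose u i x := (u0 i b)^-1 * u0 i x.
have uP i : trivialises v (Y i) (u i) by exact/trivialises_mull/u0P.
have ub i : u i b = 1 by rewrite /u mulVg.
have uE i j x : Y i x -> Y j x -> u i x = u j x.
  move=> Yix Yjx; apply/eqP; rewrite -divg_eq1; apply/eqP.
  have := cY i j _ _ (trivialises_ratio (uP i) (uP j)) x b.
  by rewrite /= !ub invg1 mulg1; apply; split.
have [f fP] : {f : T -> G | forall i x, Y i x -> f x = u i x}.
  apply: cid.
  have h x : exists g, forall i, Y i x -> g = u i x.
    have [[i Yix]|nY] := pselect (exists i, Y i x).
      by exists (u i x) => j Yjx; apply: uE.
    by exists 1 => i Yix; case: nY; exists i.
  by have [f fP] := choice h; exists f => i x; apply: fP.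
exists f => x [i Yix]; have [g hg] := uP i x Yix; exists g.
have Yin : nbhs x (Y i) by exact: open_nbhs_nbhs.
by apply: filterS2 hg Yin => z zP Yiz _; rewrite (fP i) // zP.
Qed.

Lemma gluing2 v Y Z (b : T) : open Y -> open Z -> Y b -> Z b ->
  connective Y -> connective Z -> connective (Y `&` Z) ->
  (exists u, trivialises v Y u) -> (exists u, trivialises v Z u) ->
  exists u, trivialises v (Y `|` Z) u.
Proof.
move=> oY oZ Yb Zb cY cZ cYZ tY tZ.
have [||||u uP] := @star_gluing v bool (fun i => if i then Y else Z) b.
- by case.
- by case.
- by case; case; rewrite ?setIid // setIC.
- by case.
exists u; apply: trivialisesW uP => x [?|?]; by [exists true|exists false].
Qed.

End LocalSystems.

(** Cousin's lemma, compactness of the unit interval in inductive form: the supremum of the right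
    ends reachable from 0 is itself reachable, and the local hypothesis would carry it further if it
    were below 1. *)
Lemma cousin (R : realType) (P : R -> R -> Prop) :
  (forall r s t : R, (0 <= r -> r <= s -> s <= t -> t <= 1 ->
     P r s -> P s t -> P r t)%R) ->
  (forall t : R, 0 <= t -> t <= 1 -> exists2 e : R, 0 < e &
     forall r s, 0 <= r -> t - e < r -> r <= t -> t <= s -> s < t + e ->
       s <= 1 -> P r s)%R ->
  P 0%R 1%R.
Proof.
move=> Padd Ploc; pose A := [set t : R | (0 <= t <= 1)%R /\ P 0%R t].
have A0 : A 0%R.
  split; first by rewrite lexx ler01.
  by have [e e0 eP] := Ploc 0%R (lexx _) ler01; apply: eP => //; lra.
have supA : has_sup A.
  by split; [exists 0%R|exists 1%R => t [/andP[]]].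
pose c := sup A.
have c0 : (0 <= c)%R by apply: ub_le_sup A0; case: supA.
have c1 : (c <= 1)%R by apply: ge_sup; [case: supA|move=> t [/andP[]]].
have [e e0 eP] := Ploc c c0 c1.
have [t [/andP[t0 t1] Pt] ct] := sup_adherent e0 supA.
have tc : (t <= c)%R by apply: ub_le_sup; [case: supA|split; rewrite ?t0].
have P0c : P 0%R c.
  apply: (Padd _ t) => //; apply: eP => //; rewrite -/c in ct; lra.
have [<-//|cn1] := eqVneq c 1%R.
have c1' : (c < 1)%R by rewrite lt_neqAle cn1.
pose s := Num.min (c + e / 2)%R 1%R.
have cs : (c < s)%R by rewrite lt_min c1' andbT; lra.
have s1 : (s <= 1)%R by rewrite ge_min lexx orbT.
have se : (s < c + e)%R by rewrite gt_min; apply/orP; left; lra.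
suff : (s <= c)%R by lra.
apply: ub_le_sup; [by case: supA|split; first by apply/andP; split => //; lra].
by apply: (Padd _ c) => //; [lra|apply: eP => //; lra].
Qed.

(** * Convex sets and tubes around segments *)

Section Convex.
Local Open Scope ring_scope.
Variables (R : realType).
Notation E := 'rV[R]_3.
Implicit Types (Y Z : set E).

Definition convex_set Y := forall a b t, Y a -> Y b -> 0 <= t <= 1 ->
  Y (a + t *: (b - a)).

Lemma convex_setI Y Z : convex_set Y -> convex_set Z -> convex_set (Y `&` Z).
Proof. by move=> cY cZ a b t [? ?] [? ?] t01; split; [exact: cY|exact: cZ]. Qed.

Lemma locally_constant_path (A : Type) Y (f : E -> A) (g : R -> E) :
  locally_constant Y f -> continuous g ->
  (forall t, 0 <= t <= 1 -> Y (g t)) -> f (g 0) = f (g 1).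
Proof.
move=> fP gc gY.
apply: (@cousin R (fun r s => f (g r) = f (g s))) => [r s t _ _ _ _ ->//|t t0 t1].
have Yt : Y (g t) by apply: gY; rewrite t0.
have /gc/nbhs_ballP[e /= e0 eP] := fP _ Yt.
have eP' x : 0 <= x <= 1 -> t - e < x < t + e -> f (g x) = f (g t).
  move=> x01 /andP[x1 x2]; apply: eP; last exact: gY.
  by rewrite -ball_normE /= ltr_norml; apply/andP; split; lra.
exists e => // r s r0 er rt ts se s1.
by rewrite !eP' //; apply/andP; split; lra.
Qed.

Lemma segment_continuous_map (a b : E) : continuous (fun t : R => a + t *: (b - a)).
Proof.
move=> t; apply: cvgD; first exact: cvg_cst.
by apply: cvgZr_tmp; exact: cvg_id.
Qed.

Lemma convex_ball (x : E) (e : R) : convex_set (ball x e).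
Proof.
move=> a b t; rewrite -ball_normE /= => ha hb /andP[t0 t1].
have -> : x - (a + t *: (b - a)) = (1 - t) *: (x - a) + t *: (x - b).
  by apply/rowP => i; rewrite !mxE; ring.
apply: le_lt_trans (ler_normD _ _) _.
rewrite !normrZ (ger0_norm t0) ger0_norm ?subr_ge0 //.
have [->|t0'] := eqVneq t 0; first by rewrite subr0 mul1r mul0r addr0.
have tp : 0 < t by rewrite lt_neqAle eq_sym t0'.
have := ltr_pM2l tp `|x - b| e.
have := ler_wpM2l (_ : 0 <= 1 - t) (ltW ha).
nra.
Qed.

Lemma convex_connective Y : convex_set Y -> connective Y.
Proof.
move=> cY A f fP a b Ya Yb.
have := @locally_constant_path A Y f _ fP (@segment_continuous_map a b).
by rewrite scale0r scale1r addr0 [a + _]addrC subrK; apply=> t; exact: cY.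
Qed.

Variable G : groupType.
Implicit Types v : E -> E -> G.

Lemma ball_trivialises (X : set E) v x : local_system X v -> X x ->
  exists2 e : R, 0 < e & trivialises v (ball x e) (v x).
Proof.
move=> vP /vP/nbhs_ballP[e /= e0 eP]; exists e => // y /eP[g hg].
exists g^-1%g; apply: filterS hg => z -> _; by rewrite mulKg.
Qed.

(** The union of balls along a subsegment is open and convex, so any two tubes meet in a connective
    set. *)
Definition tube (a b : E) (s t d : R) : set E :=
  [set y | exists2 r, s <= r <= t & ball (a + r *: (b - a)) d y].

Lemma open_tube a b s t d : open (tube a b s t d).
Proof.
rewrite (_ : tube a b s t d =
  \bigcup_(r in `[s, t]) ball (a + r *: (b - a)) d); last first.
  by apply/seteqP; split => y [r /= rst ry]; exists r => //=; rewrite in_itv in rst *.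
by apply: bigcup_open => r _; exact: ball_open.
Qed.

Lemma convex_tube a b s t d : convex_set (tube a b s t d).
Proof.
move=> y z u [r /andP[sr rt] ry] [r' /andP[sr' rt'] rz] /andP[u0 u1].
exists (r + u * (r' - r)); first by apply/andP; split; nra.
move: ry rz; rewrite -!ball_normE /= => ry rz.
have -> : a + (r + u * (r' - r)) *: (b - a) - (y + u *: (z - y)) =
  (a + r *: (b - a) - y) +
    u *: ((a + r' *: (b - a) - z) - (a + r *: (b - a) - y)).
  by apply/rowP => i; rewrite !mxE; ring.
set p := _ - y in ry *; set q := _ - z in rz *.
have := @convex_ball 0 d (- p) (- q) u.
rewrite -!ball_normE /= !sub0r !opprK => /(_ ry rz); rewrite u0 u1 => /(_ isT).
by rewrite (_ : - (- p + _) = p + u *: (q - p)) //; apply/rowP => i; rewrite !mxE; ring.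
Qed.

End Convex.

(** * Blocks of consecutive integers *)

Section Blocks.
Variable sz : nat -> nat.
Hypothesis sz0 : forall n, (0 < sz n)%N.

Fixpoint block_start (n : nat) : nat :=
  if n is n'.+1 then (block_start n' + sz n')%N else 0%N.

(** Division with remainder for blocks of varying size: a position as block and offset. *)
Fixpoint block_of (m : nat) : nat * nat :=
  if m is m'.+1 then
    let nr := block_of m' in
    if (nr.2.+1 < sz nr.1)%N then (nr.1, nr.2.+1) else (nr.1.+1, 0%N)
  else (0%N, 0%N).

Lemma block_ofP m : m = (block_start (block_of m).1 + (block_of m).2)%N /\
  ((block_of m).2 < sz (block_of m).1)%N.
Proof.
elim: m => [//|m [IH1 IH2]] /=; case: ifP => h /=; first by split => //; lia.
by split; [lia|exact: sz0].
Qed.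

Lemma block_start_mono n n' : (n < n')%N ->
  (block_start n + sz n <= block_start n')%N.
Proof.
elim: n' => // n' IH; rewrite ltnS leq_eqVlt => /orP[/eqP -> //|/IH /= h].
by apply: leq_trans h _; rewrite leq_addr.
Qed.

Lemma block_start_of n r : (r < sz n)%N -> block_of (block_start n + r) = (n, r).
Proof.
move=> rn; have [] := block_ofP (block_start n + r).
case: (block_of _) => n' r' /= e r'n'.
have [nn|nn|nn] := ltngtP n n'.
- by have := block_start_mono nn; lia.
- by have := block_start_mono nn; lia.
- by subst n'; congr pair; lia.
Qed.

Lemma block_ind (P : nat -> Prop) :
  (forall n r, (r < sz n)%N -> P (block_start n + r)%N) -> forall m, P m.
Proof. by move=> h m; have [e /h] := block_ofP m; rewrite -e. Qed.

Lemma leq_block_start n : (n <= block_start n)%N.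
Proof. by elim: n => // n IH /=; have := sz0 n; lia. Qed.

End Blocks.

(** * Trivialisations on convex sets *)

Local Open Scope ring_scope.

Section ConvexTrivial.
Variables (R : realType) (G : groupType).
Notation E := 'rV[R]_3.
Implicit Types (X Y Z : set E) (v : E -> E -> G).

Lemma tubeW (a b : E) s t d s' t' d' : s' <= s -> t <= t' -> d <= d' ->
  tube a b s t d `<=` tube a b s' t' d'.
Proof.
move=> ss tt dd y [r /andP[sr rt] ry]; exists r.
  by rewrite (le_trans ss sr) (le_trans rt tt).
exact: le_ball ry.
Qed.

(** Cousin's lemma in the parameter of the segment: tubes over adjacent intervals, shrunk to the
    smaller radius, share the centre of a ball and glue there. *)
Lemma tube_trivialises X v a b : local_system X v -> open X -> convex_set X ->
  X a -> X b ->
  exists2 d : R, 0 < d & tube a b 0 1 d `<=` X /\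
    exists u, trivialises v (tube a b 0 1 d) u.
Proof.
move=> vP oX cX Xa Xb.
pose P s t := exists2 d : R, 0 < d & tube a b s t d `<=` X /\
    exists u, trivialises v (tube a b s t d) u.
apply: (@cousin R P) => [r s t r0 rs st t1 [d1 d10 [X1 [u1 u1P]]]
  [d2 d20 [X2 [u2 u2P]]]|t t0 t1].
  pose d := Num.min d1 d2.
  have d0 : 0 < d by rewrite lt_min d10 d20.
  have d1' : d <= d1 by rewrite ge_min lexx.
  have d2' : d <= d2 by rewrite ge_min lexx orbT.
  have subU : tube a b r t d `<=` tube a b r s d `|` tube a b s t d.
    move=> y [w /andP[rw wt] wy]; have [ws|sw] := leP w s.
      by left; exists w => //; rewrite rw.
    by right; exists w => //; rewrite (ltW sw).
  have sub1 := @tubeW a b r s d r s d1 (lexx _) (lexx _) d1'.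
  have sub2 := @tubeW a b s t d s t d2 (lexx _) (lexx _) d2'.
  exists d => //; split.
    by apply: (subset_trans subU) => y [/sub1/X1|/sub2/X2].
  have [|||||||||u uP] := @gluing2 _ G v (tube a b r s d) (tube a b s t d)
     (a + s *: (b - a)).
  - exact: open_tube.
  - exact: open_tube.
  - by exists s; [rewrite rs lexx|exact: ballxx].
  - by exists s; [rewrite st lexx|exact: ballxx].
  - exact/convex_connective/convex_tube.
  - exact/convex_connective/convex_tube.
  - by apply: convex_connective; apply: convex_setI; exact: convex_tube.
  - by exists u1; exact: trivialisesW u1P.
  - by exists u2; exact: trivialisesW u2P.
  by exists u; exact: trivialisesW uP.
set x := a + t *: (b - a).
have Xx : X x by apply: cX => //; rewrite t0.
have [e1 e10 te1] := ball_trivialises vP Xx.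
have : nbhs x X by exact: open_nbhs_nbhs.
move=> /nbhs_ballP[e2 /= e20 e2X].
pose e := Num.min e1 e2.
have e0 : 0 < e by rewrite lt_min e10 e20.
have e1' : e <= e1 by rewrite ge_min lexx.
have e2' : e <= e2 by rewrite ge_min lexx orbT.
pose N := `|b - a| + 1.
have N0 : 0 < N by rewrite ltr_wpDl.
(* Parameters this close to [t] move the centre by at most [e / 2], and the radius adds another
   [e / 2], so the tube stays in the ball around [x]. *)
exists (e / 2 / N) => [|r s r0 tr rt ts st s1]; first by rewrite !divr_gt0.
have sub : tube a b r s (e / 2) `<=` ball x e.
  move=> y [w /andP[rw ws]]; rewrite -!ball_normE /= => wy.
  have -> : x - y = (t - w) *: (b - a) + (a + w *: (b - a) - y).
    by apply/rowP => i; rewrite !mxE; ring.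
  apply: le_lt_trans (ler_normD _ _) _; rewrite normrZ.
  suff : `|t - w| * `|b - a| <= e / 2 by lra.
  apply: (@le_trans _ _ (`|t - w| * N)).
    by rewrite ler_wpM2l // lerDl.
  rewrite -ler_pdivlMr // ler_norml; apply/andP; split; lra.
exists (e / 2); first by rewrite divr_gt0.
split; first by apply: (subset_trans sub) => y /(le_ball e2')/e2X.
exists (v x); apply: trivialisesW te1.
by apply: (subset_trans sub); exact: le_ball.
Qed.

(** Tubes from one base point to all points of [X] are convex and contain the base point, so
    [star_gluing] applies. This is the simple connectedness of convex sets. *)
Lemma convex_trivialises X v : local_system X v -> open X -> convex_set X ->
  exists u, trivialises v X u.
Proof.
move=> vP oX cX.
have [[a Xa]|X0] := pselect (exists a, X a); last first.
  by exists (fun=> 1%g) => x Xx; case: X0; exists x.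
pose I := {b : E | X b}.
have /choice[d dP] : forall i : I, exists d : R, [/\ 0 < d,
    tube a (sval i) 0 1 d `<=` X &
    exists u, trivialises v (tube a (sval i) 0 1 d) u].
  by move=> [b Xb]; have [d d0 [? ?]] := tube_trivialises vP oX cX Xa Xb; exists d.
have [||||u uP] := @star_gluing _ G v I (fun i => tube a (sval i) 0 1 (d i)) a.
- by move=> i; exact: open_tube.
- move=> i; exists 0; first by rewrite lexx ler01.
  by rewrite scale0r addr0; apply: ballxx; case: (dP i).
- by move=> i j; apply: convex_connective; apply: convex_setI; exact: convex_tube.
- by move=> i; case: (dP i).
exists u; apply: trivialisesW uP => x Xx; exists (exist _ x Xx).
exists 1; first by rewrite lexx ler01.
rewrite /= scale1r [a + _]addrC subrK; apply: ballxx; by case: (dP (exist _ x Xx)).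
Qed.

End ConvexTrivial.

Lemma local_systemW (T : topologicalType) (G : groupType) (X Y : set T)
  (v : T -> T -> G) : Y `<=` X -> local_system X v -> local_system Y v.
Proof. by move=> YX h x /YX /h. Qed.

Lemma local_system_comp (T U : topologicalType) (G : groupType) (X : set U)
  (v : U -> U -> G) (f : T -> U) : continuous f -> local_system X v ->
  local_system (f @^-1` X) (fun x z => v (f x) (f z)).
Proof.
move=> fc vP x /vP h; have h' : \forall y \near x, exists g : G, \forall z \near f y,
  v (f y) z = (g * v (f x) z)%g := fc x _ h.
by apply: filterS h' => y [g hg]; exists g; exact: (fc y _ hg).
Qed.

Lemma has_auto_comp (T U : topologicalType) (G : groupType) (X : set U)
  (v : U -> U -> G) (f : T -> U) : continuous f -> has_auto v X ->
  has_auto (fun x z => v (f x) (f z)) (f @^-1` X).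
Proof.
move=> fc [u [u1 uP]]; exists (u \o f); split=> [x /u1//|x /uP[g hg]].
by exists g; exact: (fc x _ hg).
Qed.

(* Two systems with the same transition elements on a cover by connected sets
   are isomorphic, hence have the same automorphisms. *)
Lemma cover_transfer_auto (T : topologicalType) (G : groupType) (I : Type)
  (Q : I -> set T) (v w : T -> T -> G) (a b : I -> T -> G) (Y : set T) :
  (forall i, open (Q i)) ->
  (forall i, trivialises v (Q i) (a i)) ->
  (forall i, trivialises w (Q i) (b i)) ->
  (forall i j x, Q i x -> Q j x ->
     a i x * (a j x)^-1 = b i x * (b j x)^-1)%g ->
  Y `<=` [set x | exists i, Q i x] ->
  has_auto v Y -> has_auto w Y.
Proof.
move=> oQ aP bP ab YQ [u [u1 uP]].
(* Equality of the transition elements makes this ratio independent of the chart; it is the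
   isomorphism by which [u] is conjugated. *)
have [s sP] : {s : T -> G | forall i x, Q i x -> s x = ((a i x)^-1 * b i x)%g}.
  apply: cid.
  have h x : exists g : G, forall i, Q i x -> g = ((a i x)^-1 * b i x)%g.
    have [[i Qix]|nQ] := pselect (exists i, Q i x); last first.
      by exists 1%g => i Qix; case: nQ; exists i.
    exists ((a i x)^-1 * b i x)%g => j Qjx; have /(congr1 (fun g => (a i x)^-1 * g * b j x)%g) := ab i j x Qix Qjx.
    by rewrite !mulgA mulVg mul1g mulgVK => <-.
  by have [f fP] := choice h; exists f => i x; apply: fP.
exists (fun x => (s x)^-1 * u x * s x)%g; split=> [x Yx|x Yx].
  move=> /(congr1 (fun g => s x * g * (s x)^-1)%g).
  by rewrite mulg1 mulgV !mulgA mulgV mul1g mulgK; exact: u1.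
have [i Qix] := YQ _ Yx; have [g hg] := uP _ Yx.
have [ga hga] := aP i _ Qix; have [gb hgb] := bP i _ Qix.
have nQ : nbhs x (Q i) by exact: open_nbhs_nbhs.
exists (gb^-1 * ga * g * ga^-1 * gb)%g.
near=> z; move=> Yz.
have Qz : Q i z by near: z.
have e1 : a i z = (ga * v x z)%g by move: Qz; near: z.
have e2 : b i z = (gb * w x z)%g by move: Qz; near: z.
have e3 : (v x z * u z * (v x z)^-1 = g)%g by move: Yz; near: z.
rewrite (sP i _ Qz) -e3 e1 e2 !invgM !invgK.
by rewrite !mulgA ?(mulgK, mulgVK, mulgV, mul1g, mulVg).
Unshelve. all: by end_near.
Qed.

(** * Trivialisations above a compact set *)

Section Coordinates.
Variable R : realType.
Notation E := 'rV[R]_3.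

Definition cx (w : E) : R := w 0 (@Ordinal 3 0 isT).
Definition cy (w : E) : R := w 0 (@Ordinal 3 1 isT).
Definition cz (w : E) : R := w 0 (@Ordinal 3 2 isT).
Definition vec3 (x y z : R) : E := \row_i nth 0 [:: x; y; z] i.

Lemma cxE x y z : cx (vec3 x y z) = x. Proof. by rewrite /cx mxE. Qed.
Lemma cyE x y z : cy (vec3 x y z) = y. Proof. by rewrite /cy mxE. Qed.
Lemma czE x y z : cz (vec3 x y z) = z. Proof. by rewrite /cz mxE. Qed.

Lemma ord3_ind (P : 'I_3 -> Prop) : P (@Ordinal 3 0 isT) ->
  P (@Ordinal 3 1 isT) -> P (@Ordinal 3 2 isT) -> forall i, P i.
Proof.
by move=> P0 P1 P2 [[|[|[|//]]] h]; rewrite (bool_irrelevance h isT).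
Qed.

Lemma vec3_eq (u v : E) : cx u = cx v -> cy u = cy v -> cz u = cz v -> u = v.
Proof. by move=> *; apply/rowP; exact: ord3_ind. Qed.

Lemma vec3K w : vec3 (cx w) (cy w) (cz w) = w.
Proof. by apply: vec3_eq; rewrite ?cxE ?cyE ?czE. Qed.

Lemma cx_continuous : continuous cx. Proof. exact: coord_continuous. Qed.
Lemma cy_continuous : continuous cy. Proof. exact: coord_continuous. Qed.
Lemma cz_continuous : continuous cz. Proof. exact: coord_continuous. Qed.

Lemma vec3_cvg (T : Type) (F : set_system T) (FF : Filter F) (f g h : T -> R)
  (x y z : R) : f @ F --> x -> g @ F --> y -> h @ F --> z ->
  (fun t => vec3 (f t) (g t) (h t)) @ F --> vec3 x y z.
Proof.
move=> fx gy hz; apply/cvg_ballP => e e0.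
move/cvg_ballP: fx => /(_ e e0) fx; move/cvg_ballP: gy => /(_ e e0) gy.
move/cvg_ballP: hz => /(_ e e0) hz.
apply: filterS3 fx gy hz => t bx by_ bz; split=> // i j.
by rewrite !mxE; elim/ord3_ind: j.
Qed.

Lemma nbhs3P (w : E) (P : set E) : nbhs w P <-> exists2 e : R, 0 < e &
  forall z, `|cx z - cx w| < e -> `|cy z - cy w| < e -> `|cz z - cz w| < e ->
    P z.
Proof.
split=> [/nbhs_ballP[e /= e0 eP]|[e e0 eP]].
  exists e => // z hx hy hz; apply: eP; split=> // i j; rewrite ord1.
  by elim/ord3_ind: j; rewrite -ball_normE /ball_ /= distrC.
apply/nbhs_ballP; exists e => //= z [_ zw].
have {}zw i : `|z 0 i - w 0 i| < e.
  by rewrite distrC; move: (zw 0 i); rewrite -ball_normE.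
by apply: eP; exact: zw.
Qed.

Section RealContinuity.
Variable T : topologicalType.
Implicit Types f g : T -> R.

Lemma contC (c : R) : continuous (fun _ : T => c).
Proof. by move=> x; exact: cvg_cst. Qed.

Lemma contD f g : continuous f -> continuous g ->
  continuous (fun x => f x + g x).
Proof. by move=> fc gc x; apply: cvgD; [exact: fc|exact: gc]. Qed.

Lemma contN f : continuous f -> continuous (fun x => - f x).
Proof. by move=> fc x; apply: cvgN; exact: fc. Qed.

Lemma contB f g : continuous f -> continuous g ->
  continuous (fun x => f x - g x).
Proof. by move=> fc gc; apply: contD => //; exact: contN. Qed.

Lemma contM f g : continuous f -> continuous g ->
  continuous (fun x => f x * g x).
Proof. by move=> fc gc x; apply: cvgM; [exact: fc|exact: gc]. Qed.

Lemma cont_norm f : continuous f -> continuous (fun x => `|f x|).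
Proof. by move=> fc x; apply: cvg_norm; exact: fc. Qed.

Lemma cont_max f g : continuous f -> continuous g ->
  continuous (fun x => Num.max (f x) (g x)).
Proof.
move=> fc gc; under eq_fun do rewrite maxr_absE.
apply: contM; last exact: contC.
by apply: contD; [exact: contD|exact/cont_norm/contB].
Qed.

Lemma cont_min f g : continuous f -> continuous g ->
  continuous (fun x => Num.min (f x) (g x)).
Proof.
move=> fc gc; under eq_fun do rewrite minr_absE.
apply: contM; last exact: contC.
by apply: contB; [exact: contD|exact/cont_norm/contB].
Qed.

End RealContinuity.

Lemma cxD a b : cx (a + b) = cx a + cx b. Proof. by rewrite /cx mxE. Qed.
Lemma cyD a b : cy (a + b) = cy a + cy b. Proof. by rewrite /cy mxE. Qed.
Lemma czD a b : cz (a + b) = cz a + cz b. Proof. by rewrite /cz mxE. Qed.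
Lemma cxN a : cx (- a) = - cx a. Proof. by rewrite /cx mxE. Qed.
Lemma cyN a : cy (- a) = - cy a. Proof. by rewrite /cy mxE. Qed.
Lemma czN a : cz (- a) = - cz a. Proof. by rewrite /cz mxE. Qed.
Lemma cxZ (t : R) a : cx (t *: a) = t * cx a. Proof. by rewrite /cx mxE. Qed.
Lemma cyZ (t : R) a : cy (t *: a) = t * cy a. Proof. by rewrite /cy mxE. Qed.
Lemma czZ (t : R) a : cz (t *: a) = t * cz a. Proof. by rewrite /cz mxE. Qed.
Definition coordE := (cxD, cyD, czD, cxN, cyN, czN, cxZ, cyZ, czZ, cxE, cyE, czE).

Definition half_space (a b c d : R) : set E :=
  [set w | 0 < a * cx w + b * cy w + c * cz w + d].

Lemma open_pos (T : topologicalType) (f : T -> R) : continuous f ->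
  open [set w | 0 < f w].
Proof.
move=> fc; apply: (@open_comp _ _ f [set r | 0 < r]) => [x _|].
  exact: fc.
exact: open_gt.
Qed.

Lemma open_half_space a b c d : open (half_space a b c d).
Proof.
apply: (@open_pos _ (fun w => a * cx w + b * cy w + c * cz w + d)).
apply: contD; last exact: contC.
apply: contD; first apply: contD.
- by apply: contM; [exact: contC|exact: cx_continuous].
- by apply: contM; [exact: contC|exact: cy_continuous].
- by apply: contM; [exact: contC|exact: cz_continuous].
Qed.

Lemma convex_half_space a b c d : convex_set (half_space a b c d).
Proof.
move=> u v t; rewrite /half_space /= => u0 v0 /andP[t0 t1]; rewrite !coordE.
set U := (X in 0 < X) in u0; set V := (X in 0 < X) in v0.
have -> : a * (cx u + t * (cx v - cx u)) + b * (cy u + t * (cy v - cy u)) +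
   c * (cz u + t * (cz v - cz u)) + d = (1 - t) * U + t * V.
  by rewrite /U /V; ring.
have [->|tn0] := eqVneq t 0; first by rewrite subr0 mul1r mul0r addr0.
have tp : 0 < t by rewrite lt_neqAle eq_sym tn0.
by rewrite ltr_wpDl ?mulr_ge0 ?mulr_gt0 ?subr_ge0 // ltW.
Qed.

End Coordinates.

Section Above.
Variables (R : realType) (G : groupType).
Notation E := 'rV[R]_3.
Variable K : set E.
Hypothesis cK : compact K.
Variable v : E -> E -> G.
Hypothesis vP : local_system (~` K) v.

(* The points lying on the side [s] (above for [s = 1], below for [s = -1]) of
   all points of [K] on the same vertical line. *)
Definition above (s : R) : set E := [set w | forall k, K k ->
  cx k = cx w -> cy k = cy w -> s * cz k < s * cz w].

(** A box around the vertical ray from [w] towards the side [s], written with half-spaces so that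
    openness and convexity are immediate. *)
Definition column (s : R) (w : E) (d : R) : set E :=
  half_space 1 0 0 (d - cx w) `&` half_space (-1) 0 0 (d + cx w) `&`
  half_space 0 1 0 (d - cy w) `&` half_space 0 (-1) 0 (d + cy w) `&`
  half_space 0 0 s (d - s * cz w).

Lemma columnP s w d z : column s w d z <-> [/\ `|cx z - cx w| < d,
  `|cy z - cy w| < d & s * cz w - d < s * cz z].
Proof.
rewrite /column /half_space /= !ltr_norml; split.
  by move=> [[[[? ?] ?] ?] ?]; split; try (apply/andP; split); lra.
by move=> [/andP[? ?] /andP[? ?] ?]; do ![split]; lra.
Qed.

Lemma open_column s w d : open (column s w d).
Proof. by do ![apply: openI]; exact: open_half_space. Qed.

Lemma convex_column s w d : convex_set (column s w d).
Proof. by do ![apply: convex_setI]; exact: convex_half_space. Qed.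

Lemma compact_lower_bound (f : E -> R) : continuous f ->
  (forall k, K k -> 0 < f k) -> exists2 d : R, 0 < d & forall k, K k -> d <= f k.
Proof.
move=> fc f0; have [K0|nK] := pselect (K !=set0); last first.
  by exists 1 => // k Kk; case: nK; exists k.
have [c Kc cP] := compact_EVT_min K0 cK (continuous_subspaceT fc).
have {}Kc : K c := set_mem Kc.
by exists (f c); [exact: f0|move=> k Kk; apply: cP; exact: mem_set].
Qed.

(** The function [f] measures how far a point of [K] stays outside the columns at [w]. It is
    positive on the compact set [K], and half of its minimum [d] leaves room for moving [w]. *)
Lemma above_column s w : above s w ->
  exists2 d : R, 0 < d & column s w d `<=` above s `&` ~` K.
Proof.
move=> wP; pose f (k : E) := Num.max `|cx k - cx w|
  (Num.max `|cy k - cy w| (s * cz w - s * cz k)).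
have fc : continuous f.
  apply: cont_max.
    by apply: cont_norm; apply: contB; [exact: cx_continuous|exact: contC].
  apply: cont_max.
    by apply: cont_norm; apply: contB; [exact: cy_continuous|exact: contC].
  apply: contB; first exact: contC.
  by apply: contM; [exact: contC|exact: cz_continuous].
have [d d0 dP] : exists2 d : R, 0 < d & forall k, K k -> d <= f k.
  apply: compact_lower_bound => // k Kk; rewrite !lt_max !normr_gt0 !subr_eq0 subr_gt0.
  have [ex|//] := eqVneq (cx k) (cx w); have [ey|//] := eqVneq (cy k) (cy w).
  by rewrite wP // orbT.
exists (d / 2); first by rewrite divr_gt0.
have Kz z k : column s w (d / 2) z -> K k -> cx k = cx z -> cy k = cy z ->
   s * cz k < s * cz z.
  move=> /columnP[zx zy zz] /dP; rewrite !le_max => /or3P[kz|kz|kz] kx ky.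
  - by rewrite kx in kz; lra.
  - by rewrite ky in kz; lra.
  - by lra.
move=> z zP; split; first by move=> k Kk kx ky; exact: Kz.
by move=> /(Kz _ _ zP) /(_ erefl erefl); rewrite ltxx.
Qed.

(** With each point the set contains the vertical ray beyond it, which reaches the half-space [H]
    past all of [K]. The columns, each joined to [H], form a cover to which [star_gluing]
    applies. *)
Lemma above_trivialises s : s != 0 -> exists u, trivialises v (above s) u.
Proof.
move=> s0.
have [M M0 MP] : exists2 M : R, 0 < M & forall k, K k -> s * cz k < M.
  have [N [Nr NP]] := compact_bounded cK.
  pose N1 := `|N| + 1.
  have /NP{}NP : N < N1 by rewrite /N1; have := ler_norm N; lra.
  exists (`|s| * N1 + 1) => [|k /NP /= kN].
    by rewrite ltr_wpDl // mulr_ge0 // addr_ge0.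
  apply: le_lt_trans (ler_norm _) _; rewrite normrM.
  have : `|cz k| <= N1.
    apply: le_trans kN; rewrite /Num.norm /= mx_normrE.
    apply/bigmax_geP; right; exists (0, Ordinal (isT : 2 < 3)%N) => //.
  move=> h; have := ler_wpM2l (normr_ge0 s) h; lra.
have [d dP] : {d : E -> R | forall w, above s w -> 0 < d w /\
    column s w (d w) `<=` above s `&` ~` K}.
  have h w : exists d, above s w -> 0 < d /\ column s w d `<=` above s `&` ~` K.
    have [/above_column[d d0 dP]|nw] := pselect (above s w); last by exists 0.
    by exists d.
  by apply: cid; have [d dP] := choice h; exists d.
pose H := half_space 0 0 s (- M).
have HP z : H z <-> M < s * cz z by rewrite /H /half_space /=; split; lra.
have HK : H `<=` above s `&` ~` K.
  move=> z /HP Mz; split; last by move=> /MP; lra.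
  by move=> k /MP kM _ _; lra.
pose I := {w | above s w}.
pose Y (i : I) := column s (sval i) (d (sval i)) `|` H.
pose b := vec3 0 0 ((M + 1) / s).
have Hb : H b by apply/HP; rewrite czE mulrCA mulfV // mulr1; lra.
have cH : connective H by exact/convex_connective/convex_half_space.
have oH : open H by exact: open_half_space.
have colH w : above s w -> exists2 z, column s w (d w) z & H z.
  move=> wP; exists (vec3 (cx w) (cy w) ((`|s * cz w| + M + 1) / s)).
    apply/columnP; rewrite cxE cyE czE !subrr normr0 mulrCA mulfV // mulr1.
    by have [d0 _] := dP _ wP; split=> //; have := ler_norm (s * cz w); lra.
  by apply/HP; rewrite czE mulrCA mulfV // mulr1; have := normr_ge0 (s * cz w); lra.
have colHH w w' : above s w -> above s w' -> connective
   ((column s w (d w) `|` H) `&` (column s w' (d w') `|` H)).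
  move=> wP w'P; rewrite -setUIl.
  have cc : connective (column s w (d w) `&` column s w' (d w')).
    by apply: convex_connective; apply: convex_setI; exact: convex_column.
  have [[z [/columnP[z1 z2 z3] /columnP[z4 z5 z6]]]|n0] :=
    pselect (exists z, (column s w (d w) `&` column s w' (d w')) z); last first.
    rewrite (_ : _ `&` _ = set0) ?set0U // -subset0 => z zP.
    by apply: n0; exists z.
  (* A height that lies in both columns and in [H], so the overlap of the columns is linked to
     [H]. *)
  pose m := (`|s * cz w| + `|s * cz w'| + M + 1) / s.
  have mE : s * m = `|s * cz w| + `|s * cz w'| + M + 1.
    by rewrite mulrCA mulfV // mulr1.
  have := (ler_norm (s * cz w), ler_norm (s * cz w'), normr_ge0 (s * cz w),
    normr_ge0 (s * cz w')).
  move=> [[[l1 l2] l3] l4].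
  have [d0 _] := dP _ wP; have [d0' _] := dP _ w'P.
  apply: (@connectiveU _ _ _ (vec3 (cx z) (cy z) m)) => //.
    by split; apply/columnP; rewrite cxE cyE czE mE; split => //; lra.
  by apply/HP; rewrite czE mE; lra.
have [||||u uP] := @star_gluing _ G v I Y b.
- by move=> i; apply: openU => //; exact: open_column.
- by move=> i; right.
- by move=> [w wP] [w' w'P]; exact: colHH.
- move=> [w wP]; rewrite /Y /=.
  have [z zc zH] := colH _ wP; have [d0 colK] := dP _ wP.
  have vY Z : Z `<=` above s `&` ~` K -> open Z -> convex_set Z ->
     exists u, trivialises v Z u.
    by move=> ZK; apply: convex_trivialises; apply: local_systemW vP => x /ZK[].
  apply: (@gluing2 _ _ _ _ _ z) => //.
  + exact: open_column.
  + exact/convex_connective/convex_column.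
  + apply: convex_connective; apply: convex_setI; [exact: convex_column|exact: convex_half_space].
  + by apply: vY => //; [exact: open_column|exact: convex_column].
  + by apply: vY => //; exact: convex_half_space.
exists u; apply: trivialisesW uP => w wP; exists (exist _ w wP); left.
by apply/columnP; rewrite /= !subrr normr0; have [d0 _] := dP _ wP; split => //; lra.
Qed.

Lemma open_above s : open (above s).
Proof.
rewrite openE => w /above_column[d d0 dP].
have : nbhs w (column s w d).
  apply: open_nbhs_nbhs; split; first exact: open_column.
  by apply/columnP; rewrite !subrr normr0; split => //; lra.
by apply: filterS => z /dP[].
Qed.

End Above.

(** * A criterion against attractors *)

Section Attractor.
Variables (R : realType) (G : finGroupType).
Notation E := 'rV[R]_3.
Implicit Types K P : set E.

Lemma dist_continuous (V : normedModType R) (x : V) :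
  continuous (fun w : V => `|x - w|).
Proof.
by move=> w; apply: cvg_norm; apply: cvgB; [exact: cvg_cst|exact: cvg_id].
Qed.

Lemma coord_le_norm (w : E) i : `|w 0 i| <= `|w|.
Proof.
rewrite [leRHS]/Num.norm /= mx_normrE.
by apply/bigmax_geP; right; exists (0, i).
Qed.

Lemma norm3_le (w : E) M : 0 <= M -> `|cx w| <= M -> `|cy w| <= M ->
  `|cz w| <= M -> `|w| <= M.
Proof.
move=> M0 hx hy hz; rewrite [leLHS]/Num.norm /= mx_normrE.
by apply/bigmax_leP; split => // -[i j] _ /=; rewrite ord1; elim/ord3_ind: j.
Qed.

(* Finitely many balls cover the bounded part, six half-spaces the rest. *)
Lemma finite_convex_cover K P : compact K -> closed P -> P `<=` ~` K ->
  exists n (Q : 'I_n -> set E),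
    (forall i, [/\ open (Q i), convex_set (Q i) & Q i `<=` ~` K]) /\
    P `<=` [set x | exists i, Q i x].
Proof.
move=> cK oP PK.
have [M M0 MK] : exists2 M : R, 0 < M & forall k, K k -> `|k| < M.
  have [N [Nr NP]] := compact_bounded cK.
  exists (`|N| + 2) => [|k Kk]; first by rewrite ltr_wpDl.
  have /NP : N < `|N| + 1 by have := ler_norm N; lra.
  by move=> /(_ _ Kk) /=; lra.
have clK : closed K by apply: compact_closed => //; exact: norm_hausdorff.
have [e eP] : {e : E -> R | forall x, ~ K x -> 0 < e x /\ ball x (e x) `<=` ~` K}.
  have h x : exists d : R, ~ K x -> 0 < d /\ ball x d `<=` ~` K.
    have [Kx|nK] := pselect (K x); first by exists 0.
    have : nbhs x (~` K) by apply: open_nbhs_nbhs; split => //; exact: closed_openC.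
    by move=> /nbhs_ballP[d /= d0 dP]; exists d.
  by apply: cid; have [d dP] := choice h; exists d.
have cP : compact (P `&` [set w | `|w| <= M]).
  apply: bounded_closed_compact.
    exists M; split; first exact: num_real.
    by move=> x Mx w [_ /= wM]; apply: le_trans wM (ltW Mx).
  apply: closedI => //; apply: (@closed_comp _ _ (fun w : E => `|w|) [set r | r <= M]).
    by move=> w _; exact: norm_continuous.
  exact: closed_le.
move: cP; rewrite compact_cover.
move=> /(_ E P (fun x => ball x (e x)))[||D DP cov].
- by move=> x _; exact: ball_open.
- move=> x [Px _]; exists x => //; apply: ballxx; by case: (eP x (PK _ Px)).
pose l := [:: half_space 1 0 0 (- M); half_space (-1) 0 0 (- M);
  half_space 0 1 0 (- M); half_space 0 (-1) 0 (- M); half_space 0 0 1 (- M);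
  half_space 0 0 (-1) (- M)] ++ [seq ball x (e x) | x <- enum_fset D] : seq (set E).
have lP i : (i < size l)%N -> [/\ open (nth set0 l i), convex_set (nth set0 l i)
   & nth set0 l i `<=` ~` K].
  have hs a b c : (forall w, a * cx w + b * cy w + c * cz w <= `|w|) ->
      [/\ open (half_space a b c (- M)), convex_set (half_space a b c (- M))
        & half_space a b c (- M) `<=` ~` K].
    move=> abc; split; [exact: open_half_space|exact: convex_half_space|].
    by move=> w; rewrite /half_space /= => h /MK wM; have := abc w; lra.
  have lw (w : E) j : w 0 j <= `|w| /\ - w 0 j <= `|w|.
    have := coord_le_norm w j; have := ler_norm (w 0 j).
    by have := ler_norm (- w 0 j); rewrite normrN; split; lra.
  move: i => [|[|[|[|[|[|i]]]]]] /=; last first.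
    rewrite !ltnS size_map => iD.
    have xD : nth 0 (enum_fset D) i \in D by rewrite mem_nth.
    rewrite (nth_map 0) //.
    have /PK/eP[e0 eK] : P (nth 0 (enum_fset D) i) := set_mem (DP _ xD).
    by split => //; [exact: ball_open|exact: convex_ball].
  1-6: move=> _; apply: hs => w;
    have := (lw w (@Ordinal 3 0 isT), lw w (@Ordinal 3 1 isT), lw w (@Ordinal 3 2 isT));
    rewrite -/(cx w) -/(cy w) -/(cz w) => -[[[? ?] [? ?]] [? ?]]; lra.
exists (size l), (fun i => nth set0 l i); split; first by move=> i; apply: lP.
move=> w Pw; rewrite /=.
suff [i il wi] : exists2 i, (i < size l)%N & nth set0 l i w.
  by exists (Ordinal il).
have h i : (i < 6)%N -> nth set0 l i w -> exists2 i, (i < size l)%N & nth set0 l i w.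
  by move=> i6; exists i => //; apply: leq_trans i6 _.
have [w1|w1] := ltP M (cx w).
  by apply: (h 0%N) => //=; rewrite /half_space /=; lra.
have [w2|w2] := ltP M (- cx w).
  by apply: (h 1%N) => //=; rewrite /half_space /=; lra.
have [w3|w3] := ltP M (cy w).
  by apply: (h 2%N) => //=; rewrite /half_space /=; lra.
have [w4|w4] := ltP M (- cy w).
  by apply: (h 3%N) => //=; rewrite /half_space /=; lra.
have [w5|w5] := ltP M (cz w).
  by apply: (h 4%N) => //=; rewrite /half_space /=; lra.
have [w6|w6] := ltP M (- cz w).
  by apply: (h 5%N) => //=; rewrite /half_space /=; lra.
have wM : `|w| <= M.
  by apply: norm3_le; [exact: ltW| | |]; rewrite ler_norml; apply/andP; split; lra.
have [x xD xw] := cov _ (conj Pw wM).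
exists (index x (enum_fset D)).+4.+2.
  by rewrite /= size_map !ltnS index_mem.
by rewrite /= (nth_map 0) ?index_mem // nth_index.
Qed.

Lemma iter_cancel (T : Type) (f g : T -> T) n : cancel f g ->
  cancel (iter n f) (iter n g).
Proof. by move=> fg; elim: n => // n IH x; rewrite iterSr /= fg IH. Qed.

Lemma iter_continuous (T : topologicalType) (f : T -> T) n : continuous f ->
  continuous (iter n f).
Proof.
move=> fc; elim: n => [|n IH] x; first exact: cvg_id.
by apply: (@continuous_comp _ _ _ (iter n f) f); [exact: IH|exact: fc].
Qed.

Lemma compact_neighbourhood K U : compact K -> set_nbhs K U ->
  exists P : set E, [/\ compact P, K `<=` P° & P `<=` U].
Proof.
move=> cK UK.
have [e eP] : {e : E -> R | forall x, K x -> 0 < e x /\ ball x (e x) `<=` U}.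
  have h x : exists d : R, K x -> 0 < d /\ ball x d `<=` U.
    have [Kx|nK] := pselect (K x); last by exists 0.
    by have /nbhs_ballP[d /= d0 dP] := UK x Kx; exists d.
  by apply: cid; have [d dP] := choice h; exists d.
move: (cK); rewrite {1}compact_cover.
(* Half radii, so that the closed balls, whose finite union is compact, still lie in [U]. *)
move=> /(_ E K (fun x => ball x (e x / 2)))[||D DP cov].
- by move=> x _; exact: ball_open.
- move=> x Kx; exists x => //; apply: ballxx; by have [e0 _] := eP x Kx; rewrite divr_gt0.
have cU (s : seq E) : compact [set w : E | exists2 x, x \in s & `|x - w| <= e x / 2].
  elim: s => [|x s IH].
    rewrite (_ : mkset _ = set0); first exact: compact0.
    by rewrite -subset0 => w [].
  rewrite (_ : mkset _ = [set w | `|x - w| <= e x / 2] `|`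
     [set w : E | exists2 x, x \in s & `|x - w| <= e x / 2]).
    apply: compactU => //; apply: bounded_closed_compact.
      exists (`|x| + e x / 2); split; first exact: num_real.
      move=> M hM w /= xw; apply: le_trans (ltW hM).
      rewrite -[w](subKr x); apply: le_trans (ler_normB _ _) _; by rewrite lerD2l.
    apply: (@closed_comp _ _ (fun w : E => `|x - w|) [set r | r <= e x / 2]).
      by move=> w _; exact: dist_continuous.
    exact: closed_le.
  apply/seteqP; split=> w.
    by move=> [y]; rewrite inE => /orP[/eqP ->|ys] yw; [left|right; exists y].
  by move=> [xw|[y ys yw]]; [exists x|exists y]; rewrite ?inE ?eqxx ?ys ?orbT.
exists [set w : E | exists2 x, x \in enum_fset D & `|x - w| <= e x / 2]; split=> //.
  move=> k /cov[x xD xk].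
  have : nbhs k (ball x (e x / 2)) by apply: open_nbhs_nbhs; split => //; exact: ball_open.
  by apply: filterS => w; rewrite -ball_normE /= => /ltW xw; exists x.
move=> w [x xD xw]; have /eP[e0 eU] : K x := set_mem (DP x xD).
by apply: eU; rewrite -ball_normE /=; lra.
Qed.

Theorem not_attractor K (v : nat -> E -> E -> G) (C : nat -> set E) :
  compact K -> (forall j, local_system (~` K) (v j)) ->
  (forall j, closed (C j)) -> (forall j, C j `<=` ~` K) ->
  (forall j, ~ has_auto (v j) (C j)) ->
  (forall i j, i != j -> has_auto (v i) (C j)) ->
  forall f : E -> E, homeomorphism f -> ~ attractor f K.
Proof.
move=> cK vP clC CK nC aC f [fc [g [gc fg gf]]] [_ fK [U UK att]].
have [P [cP KP PU]] := compact_neighbourhood cK UK.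
have KPo := KP.
have clPo : closed (~` P°) by apply: open_closedC; exact: open_interior.
have [n [Q [QP PQ]]] := finite_convex_cover cK clPo (subsetC KP).
(* The number of possible families of transition elements over the cover [Q], finite because [G] is;
   among [m.+1] systems two have the same family. *)
pose m := #|{: {ffun 'I_n * 'I_n -> G}}|.
have [N NP] : exists N, iter N f @` P `<=` ~` (\bigcup_(j < m.+1) C j).
  have clU : closed (\bigcup_(j < m.+1) C j).
    by apply: closed_bigcup => //; exact: finite_II.
  have /(att P cP PU)[N NP] : set_nbhs K (~` (\bigcup_(j < m.+1) C j)).
    apply/set_nbhsP; exists (~` (\bigcup_(j < m.+1) C j)); split=> //.
      exact: closed_openC.
    by move=> k Kk [j _ /CK].
  by exists N; apply: NP.
pose F := iter N f.
have Fc : continuous F by exact: iter_continuous.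
have Fg : cancel F (iter N g) by exact: iter_cancel.
have gF : cancel (iter N g) F by exact: iter_cancel.
have FK x : K (F x) -> K x.
  have {}fK y : K (f y) -> K y.
    by rewrite -{1}fK => -[z Kz /(can_inj fg) <-].
  by rewrite /F; elim: (N) => // k IH /= /fK /IH.
pose w j x z := v j (F x) (F z).
have wP j : local_system (~` K) (w j).
  apply: (@local_systemW _ _ (F @^-1` (~` K))) => [x nKx /FK//|].
  exact: local_system_comp.
have /choice[a aP] : forall ji : nat * 'I_n, exists u, trivialises (w ji.1) (Q ji.2) u.
  move=> [j i]; have [oQ cQ QK] := QP i; apply: convex_trivialises => //.
  exact: local_systemW (wP j).
(* Overlaps of convex sets are connective, so the transition element is constant there and can be
   read off at one point. On an empty overlap [xget] returns 0 and the entry is arbitrary. *)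
pose tr (j : 'I_m.+1) : {ffun 'I_n * 'I_n -> G} :=
  [ffun ik => let x := xget 0 (Q ik.1 `&` Q ik.2) in
     (a (val j, ik.1) x * (a (val j, ik.2) x)^-1)%g].
have trE (j : 'I_m.+1) i k x : Q i x -> Q k x ->
    (a (val j, i) x * (a (val j, k) x)^-1 = tr j (i, k))%g.
  move=> Qi Qk; rewrite ffunE /=.
  have : (Q i `&` Q k) (xget 0 (Q i `&` Q k)) by apply: (@xgetPex _ 0); exists x.
  move=> [Qi' Qk'].
  have := @convex_connective _ _ (convex_setI (_ : convex_set (Q i)) (_ : convex_set (Q k))) _ _
    (trivialises_ratio (aP (val j, i)) (aP (val j, k))) x (xget 0 (Q i `&` Q k)).
  by apply; rewrite //; case: (QP i); case: (QP k).
have [j1 [j2 [j12 tr12]]] : exists j1 j2, j1 != j2 /\ tr j1 = tr j2.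
  apply: contrapT => no.
  have inj : injective tr.
    by move=> j1 j2 e; apply: contrapT => /eqP ne; apply: no; exists j1, j2.
  have := leq_card tr inj; by rewrite card_ord -/m ltnn.
apply: (nC j2).
have h : has_auto (w j2) (F @^-1` C j2).
  apply: (@cover_transfer_auto _ _ 'I_n Q (w j1) (w j2) (fun i => a (val j1, i))
    (fun i => a (val j2, i))).
  - by move=> i; case: (QP i).
  - by move=> i; exact: (aP (val j1, i)).
  - by move=> i; exact: (aP (val j2, i)).
  - by move=> i k x Qi Qk; rewrite !trE // tr12.
  (* [F] maps [P] off [C j2], so the preimage of [C j2] avoids [P] and is covered by the sets
     [Q i]. *)
  - move=> x Cx; apply: PQ => Px.
    have : (iter N f @` P) (F x) by exists x => //; exact: interior_subset.
    by move=> /NP; apply; exists j2 => //=.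
  - exact: has_auto_comp (aC _ _ _).
have := @has_auto_comp _ _ _ _ _ _ (@iter_continuous _ g N gc) h.
rewrite /w; under eq_fun do under eq_fun do rewrite !gF.
by apply: has_autoW => x Cx; rewrite /= gF.
Qed.

End Attractor.

(** * Automorphisms near a tame point *)

Section TwoCharts.
Variables (T : topologicalType) (G : groupType).
Implicit Types (X Y : set T) (v : T -> T -> G).

Lemma trivialises_auto v Y u (e : G) : trivialises v Y u -> e != 1%g ->
  nontrivial_auto v Y (fun x => (u x)^-1 * e * u x)%g.
Proof.
move=> uP e1; split=> [x Yx /(congr1 (fun g => u x * g * (u x)^-1)%g)|x Yx].
  rewrite !mulgA mulgK mulgV mul1g mulg1 mulgV => eE.
  by rewrite eE eqxx in e1.
have [g hg] := uP _ Yx; exists (g^-1 * e * g)%g.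
by apply: filterS hg => z /[apply] ->; rewrite invgM !mulgA mulgV mul1g mulgK.
Qed.

Lemma nontrivial_autoU v X Y (a : T -> G) : open X -> open Y ->
  nontrivial_auto v X a -> nontrivial_auto v Y a ->
  nontrivial_auto v (X `|` Y) a.
Proof.
move=> oX oY [aX1 aX] [aY1 aY]; split=> [x [/aX1|/aY1]//|x [xX|xY]].
- have [g hg] := aX x xX; exists g.
  have nX : nbhs x X by exact: open_nbhs_nbhs.
  by apply: filterS2 hg nX => z h Xz _; exact: h.
- have [g hg] := aY x xY; exists g.
  have nY : nbhs x Y by exact: open_nbhs_nbhs.
  by apply: filterS2 hg nY => z h Yz _; exact: h.
Qed.

Lemma eq_nontrivial_auto v Y (a b : T -> G) : (forall x, Y x -> a x = b x) ->
  nontrivial_auto v Y a -> nontrivial_auto v Y b.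
Proof.
move=> ab [a1 aP]; split=> [x Yx|x Yx]; first by rewrite -ab //; exact: a1.
have [g hg] := aP x Yx; exists g.
by apply: filterS hg => z h Yz; rewrite -ab //; exact: h.
Qed.

(** In a trivialised chart a constant, conjugated back, is an automorphism; the relation between [e]
    and [f] says that the two constants define the same one on the overlap. *)
Lemma two_charts_auto v X Y (a b : T -> G) (e f : G) : open X -> open Y ->
  trivialises v X a -> trivialises v Y b -> e != 1%g -> f != 1%g ->
  (forall x, X x -> Y x ->
     a x * (b x)^-1 * f = e * (a x * (b x)^-1))%g ->
  has_auto v (X `|` Y).
Proof.
move=> oX oY aP bP e1 f1 ef.
pose al x := if `[< X x >] then ((a x)^-1 * e * a x)%g
   else ((b x)^-1 * f * b x)%g.
exists al; apply: nontrivial_autoU => //.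
  apply: eq_nontrivial_auto (trivialises_auto aP e1) => x Xx.
  by rewrite /al; case: asboolP.
apply: eq_nontrivial_auto (trivialises_auto bP f1) => x Yx.
rewrite /al; case: asboolP => // Xx.
have /(congr1 (fun g => (a x)^-1 * g * b x)%g) := ef x Xx Yx.
by rewrite !mulgA mulVg mul1g mulgVK.
Qed.

End TwoCharts.

Section Frame.
Variable R : realType.
Notation E := 'rV[R]_3.

Definition lin (l : R * R * R) (w : E) : R :=
  l.1.1 * cx w + l.1.2 * cy w + l.2 * cz w.

Lemma lin_add l u w : lin l (u + w) = lin l u + lin l w.
Proof. by rewrite /lin !coordE; ring. Qed.

Lemma lin_scale l (t : R) w : lin l (t *: w) = t * lin l w.
Proof. by rewrite /lin !coordE; ring. Qed.

Lemma lin_continuous l : continuous (lin l).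
Proof.
apply: contD; first apply: contD.
- by apply: contM; [exact: contC|exact: cx_continuous].
- by apply: contM; [exact: contC|exact: cy_continuous].
- by apply: contM; [exact: contC|exact: cz_continuous].
Qed.

(** Completes [d] to a basis with dual functionals: [l1] and [l2] measure the deviation from a line
    of direction [d], and [l3] the position along it. A nonzero coordinate of [d] serves as
    pivot. *)
Lemma frame (d : E) : d != 0 -> exists (l1 l2 l3 : R * R * R) (e1 e2 : E),
  [/\ forall u, u = lin l1 u *: e1 + lin l2 u *: e2 + lin l3 u *: d,
   [/\ lin l1 e1 = 1, lin l1 e2 = 0 & lin l1 d = 0],
   [/\ lin l2 e1 = 0, lin l2 e2 = 1 & lin l2 d = 0] &
   [/\ lin l3 e1 = 0, lin l3 e2 = 0 & lin l3 d = 1]].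
Proof.
move=> d0.
have [dx|dx] := eqVneq (cx d) 0; last first.
  exists (- cy d / cx d, 1, 0), (- cz d / cx d, 0, 1), (1 / cx d, 0, 0),
    (vec3 0 1 0), (vec3 0 0 1).
  split; [move=> u; apply: vec3_eq|split|split|split]; rewrite /lin ?coordE /=; by field.
have [dy|dy] := eqVneq (cy d) 0; last first.
  exists (1, - cx d / cy d, 0), (0, - cz d / cy d, 1), (0, 1 / cy d, 0),
    (vec3 1 0 0), (vec3 0 0 1).
  split; [move=> u; apply: vec3_eq|split|split|split]; rewrite /lin ?coordE /=; by field.
have [dz|dz] := eqVneq (cz d) 0; last first.
  exists (1, 0, - cx d / cz d), (0, 1, - cy d / cz d), (0, 0, 1 / cz d),
    (vec3 1 0 0), (vec3 0 1 0).
  split; [move=> u; apply: vec3_eq|split|split|split]; rewrite /lin ?coordE /=; by field.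
by case/eqP: d0; apply: vec3_eq; rewrite ?dx ?dy ?dz /cx /cy /cz mxE.
Qed.

End Frame.

Section Tame.
Variables (R : realType) (G : groupType).
Notation E := 'rV[R]_3.
Implicit Types K : set E.

Section Punctured.
Variables (c d : E) (eps : R) (w : E -> E -> G) (g0 : G).
Variables (l1 l2 l3 : R * R * R) (e1 e2 : E).
Hypothesis eps0 : 0 < eps.
Hypothesis l1P : [/\ lin l1 e1 = 1, lin l1 e2 = 0 & lin l1 d = 0].
Hypothesis l2P : [/\ lin l2 e1 = 0, lin l2 e2 = 1 & lin l2 d = 0].
Hypothesis l3P : [/\ lin l3 e1 = 0, lin l3 e2 = 0 & lin l3 d = 1].
Hypothesis g01 : g0 != 1%g.
Let B := ball c eps.

Let side (l : R * R * R) (s : R) : set E := B `&`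
  half_space (s * l.1.1) (s * l.1.2) (s * l.2) (- s * lin l c).

Let sideP l s x : side l s x <-> B x /\ 0 < s * lin l (x - c).
Proof.
rewrite /side /half_space /=.
rewrite (_ : _ + - s * lin l c = s * lin l (x - c)) //.
by rewrite /lin !coordE; ring.
Qed.

Let off_line : set E :=
  B `&` [set x | lin l1 (x - c) != 0 \/ lin l2 (x - c) != 0].

Let open_side l s : open (side l s).
Proof. by apply: openI; [exact: ball_open|exact: open_half_space]. Qed.

Let convex_side l s : convex_set (side l s).
Proof. by apply: convex_setI; [exact: convex_ball|exact: convex_half_space]. Qed.

Let corner (p q r : R) : exists x, B x /\
  exists2 t : R, 0 < t & [/\ lin l1 (x - c) = t * p, lin l2 (x - c) = t * q &
    lin l3 (x - c) = t * r].
Proof.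
pose u : E := p *: e1 + q *: e2 + r *: d.
pose t := eps / (`|u| + 1) / 2.
have u1 : 0 < `|u| + 1 by rewrite ltr_wpDl.
have t0 : 0 < t by rewrite !divr_gt0.
exists (c + t *: u); split.
  rewrite /B -ball_normE /= opprD addrA subrr sub0r normrN normrZ gtr0_norm //.
  rewrite /t mulrAC ltr_pdivrMr // mulrAC ltr_pdivrMr //.
  have := mulr_ge0 (ltW eps0) (normr_ge0 u).
  move=> h; rewrite (_ : _ * (_ + 1) = eps * `|u| + (eps * `|u| + eps * 2)); last by ring.
  by rewrite ltrDl ltr_wpDl // mulr_gt0.
exists t => //; rewrite [c + _]addrC addrK !lin_scale !lin_add !lin_scale.
case: l1P => -> -> ->; case: l2P => -> -> ->; case: l3P => -> -> ->.
by split; ring.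
Qed.

Let side_meet (s s' : R) : s != 0 -> s' != 0 ->
  exists x, (side l1 s `&` side l2 s') x.
Proof.
move=> s0 s0'; have [x [Bx [t t0 [x1 x2 _]]]] := corner s s' 0.
exists x; split; apply/sideP; split=> //; rewrite ?x1 ?x2.
  by rewrite mulrCA mulr_gt0 // -expr2 exprn_even_gt0 ?s0 // s0 orbT.
by rewrite mulrCA mulr_gt0 // -expr2 exprn_even_gt0 ?s0' // s0' orbT.
Qed.

Let triv_side l s : local_system (side l s) w -> exists u, trivialises w (side l s) u.
Proof. by move=> h; apply: convex_trivialises. Qed.

(** The complement of a diameter has infinite cyclic fundamental group, and the generator of the
    holonomy commutes with itself. Two charts, each a chain of three half-balls, overlap in the two
    disjoint half-balls of [l1], where their ratios are [g1] and [g3]. *)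
Lemma line_complement_auto : local_system off_line w -> has_auto w off_line.
Proof.
move=> wP.
have s1 s : side l1 s `<=` off_line.
  move=> x /sideP[Bx sx]; split => //; left; apply: contraTneq sx => ->.
  by rewrite mulr0 ltxx.
have s2 s : side l2 s `<=` off_line.
  move=> x /sideP[Bx sx]; split => //; right; apply: contraTneq sx => ->.
  by rewrite mulr0 ltxx.
have t1 s := triv_side (local_systemW (s1 s) wP).
have t2 s := triv_side (local_systemW (s2 s) wP).
have n1 : (1 : R) != 0 by exact: oner_neq0.
have nN1 : (-1 : R) != 0 by rewrite oppr_eq0.
have cside l s := convex_connective (@convex_side l s).
have cI l s l' s' := convex_connective (convex_setI (@convex_side l s) (@convex_side l' s')).
have side1N : side l1 1 `&` side l1 (-1) = set0.
  rewrite -subset0 => x [/sideP[_ h] /sideP[_ h']].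
  by move: h h'; rewrite mul1r mulN1r oppr_gt0 => /lt_trans /[apply]; rewrite ltxx.
have half s : s != 0 -> exists u,
    trivialises w (side l1 1 `|` side l2 s `|` side l1 (-1)) u.
  move=> s0; have [x [x1 x2]] := side_meet n1 s0; have [y [y1 y2]] := side_meet nN1 s0.
  apply: (@gluing2 _ _ _ _ _ y) => //.
  - by apply: openU; exact: open_side.
  - by right.
  - exact: (connectiveU x1 x2).
  - by rewrite setIUl side1N set0U; exact: cI.
  - apply: (@gluing2 _ _ _ _ _ x) => //; by [exact: t1|exact: t2].
have [a aP] := half 1 n1; have [b bP] := half (-1) nN1.
set X := side l1 1 `|` _ `|` _ in aP; set Y := side l1 1 `|` _ `|` _ in bP.
have oX : open X by do ![apply: openU]; exact: open_side.
have oY : open Y by do ![apply: openU]; exact: open_side.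
have lc := trivialises_ratio aP bP.
have [p [p1 p2]] := side_meet n1 n1; have [q [q1 q2]] := side_meet nN1 n1.
pose g1 := (a p * (b p)^-1)%g; pose g3 := (a q * (b q)^-1)%g.
have E1 x : side l1 1 x -> (a x * (b x)^-1 = g1)%g.
  move=> x1; have lc1 : locally_constant (side l1 1) (fun x => a x * (b x)^-1)%g.
    by apply: locally_constantW lc => z z1; split; left; left.
  exact: (cside _ _ _ _ lc1 x p).
have E3 x : side l1 (-1) x -> (a x * (b x)^-1 = g3)%g.
  move=> x1; have lc1 : locally_constant (side l1 (-1)) (fun x => a x * (b x)^-1)%g.
    by apply: locally_constantW lc => z z1; split; right.
  exact: (cside _ _ _ _ lc1 x q).
have side2N x : side l2 1 x -> side l2 (-1) x -> False.
  move=> /sideP[_ h] /sideP[_ h'].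
  by move: h h'; rewrite mul1r mulN1r oppr_gt0 => /lt_trans /[apply]; rewrite ltxx.
(* The holonomy around the line is [g3 * g1^-1] up to conjugation; it is used as the automorphism
   itself, and [g0] takes its place when it is 1. *)
have [e [e1' ge]] : exists e : G, e != 1%g /\ (g3 * g1^-1 * e = e * (g3 * g1^-1))%g.
  have [->|k1] := eqVneq (g3 * g1^-1)%g 1%g; first by exists g0; rewrite mul1g mulg1.
  by exists (g3 * g1^-1)%g.
apply: (@has_autoW _ _ _ (X `|` Y)).
  move=> x [Bx]; rewrite /X /Y; have [x1|x1|x1] := ltrgtP (lin l1 (x - c)) 0.
  - by move=> _; left; right; apply/sideP; split => //; rewrite mulN1r oppr_gt0.
  - by move=> _; left; left; left; apply/sideP; split => //; rewrite mul1r.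
  case=> [|x2]; first by rewrite x1 eqxx.
  have [x3|x3|x3] := ltrgtP (lin l2 (x - c)) 0.
  - by right; left; right; apply/sideP; split => //; rewrite mulN1r oppr_gt0.
  - by left; left; right; apply/sideP; split => //; rewrite mul1r.
  - by rewrite x3 eqxx in x2.
apply: (@two_charts_auto _ _ _ _ _ a b e (g1^-1 * e * g1)%g) => //.
  by rewrite -mulgA -conjgE conjg_eq1.
have D1 x : side l1 1 x ->
   (a x * (b x)^-1 * (g1^-1 * e * g1) = e * (a x * (b x)^-1))%g.
  by move=> /E1 ->; rewrite !mulgA mulgV mul1g.
have D3 x : side l1 (-1) x ->
   (a x * (b x)^-1 * (g1^-1 * e * g1) = e * (a x * (b x)^-1))%g.
  by move=> /E3 ->; rewrite !mulgA ge -!mulgA mulVg mulg1.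
move=> x [[x1|x1]|x1] [[y1|y1]|y1]; do ?[exact: D1|exact: D3].
by case: (side2N x).
Qed.

(** The complement of a radius is simply connected: the half-ball [side l3 s] beyond the end of the
    ray meets each of the four half-balls around the line, and all are glued around a point of
    it. *)
Lemma ray_complement_auto (s : R) : s != 0 ->
  local_system (off_line `|` side l3 s) w -> has_auto w (off_line `|` side l3 s).
Proof.
move=> s0 wP.
pose l (i : bool) := if i then l1 else l2.
pose sg (j : bool) : R := if j then 1 else -1.
pose Y (ij : bool * bool) := side (l ij.1) (sg ij.2) `|` side l3 s.
have oY ij : open (Y ij) by apply: openU; exact: open_side.
have sub ij : side (l ij.1) (sg ij.2) `<=` off_line.
  case: ij => i j x /sideP[Bx sx]; split => //.
  have : lin (l i) (x - c) != 0 by apply: contraTneq sx => /= ->; rewrite mulr0 ltxx.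
  by rewrite /l; case: (i); [left|right].
have cI l s l' s' := convex_connective (convex_setI (@convex_side l s) (@convex_side l' s')).
have ss (r : R) : r != 0 -> 0 < r * r by move=> r0; rewrite -expr2 exprn_even_gt0 ?r0 // r0 orbT.
have sg0 j : sg j != 0 by rewrite /sg; case: j; rewrite ?oppr_eq0 oner_neq0.
have meet ij kh : (ij.1 != kh.1) || (ij.2 == kh.2) ->
    exists x, [/\ side (l ij.1) (sg ij.2) x, side (l kh.1) (sg kh.2) x & side l3 s x].
  case: ij kh => [i j] [k h] /= ne.
  have [p [q [pq1 pq2]]] : exists p q : R, 0 < sg j * (if i then p else q) /\
      0 < sg h * (if k then p else q).
    case: i k ne => [] [] /= => [/eqP <-|_|_|/eqP <-].
    - by exists (sg j), 0; split; exact: ss.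
    - by exists (sg j), (sg h); split; exact: ss.
    - by exists (sg h), (sg j); split; exact: ss.
    - by exists 0, (sg j); split; exact: ss.
  have [x [Bx [t t0 [x1 x2 x3]]]] := corner p q s.
  have lE i0 : lin (l i0) (x - c) = t * (if i0 then p else q) by case: i0.
  exists x; split; apply/sideP; split => //; rewrite ?lE ?x3 mulrCA mulr_gt0 //.
  exact: ss.
have [b bN] : exists x, side l3 s x.
  by have [x [_ _ ?]] := meet (true, true) (true, true) isT; exists x.
have [||||u uP] := @star_gluing _ G w _ Y b.
- exact: oY.
- by move=> ij; right.
- move=> [i j] [k h]; rewrite /Y -setUIl.
  have [/meet[x [x1 x2 x3]]|] := boolP (((i, j).1 != (k, h).1) || ((i, j).2 == (k, h).2)).
    by apply: (@connectiveU _ _ _ x); [split|by []|exact: cI|exact/convex_connective/convex_side].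
  rewrite negb_or negbK /= => /andP[/eqP <- jh].
  rewrite (_ : _ `&` _ = set0) ?set0U; first exact/convex_connective/convex_side.
  rewrite -subset0 => x [/sideP[_ h1] /sideP[_ h2]].
  move: h1 h2; rewrite /sg; case: (j) (h) jh => [] [] //= _; rewrite ?mul1r ?mulN1r => *; lra.
- move=> ij; have [x [x1 _ x3]] := meet ij ij (introT orP (or_intror (eqxx _))).
  apply: (@gluing2 _ _ _ _ _ x) => //.
  + exact/convex_connective/convex_side.
  + exact/convex_connective/convex_side.
  + apply: triv_side; apply: local_systemW wP => y /sub; by left.
  + by apply: triv_side; apply: local_systemW wP => y; right.
exists (fun x => (u x)^-1 * g0 * u x)%g.
apply: trivialises_auto => //; apply: trivialisesW uP => x.
case=> [[Bx x12]|xN]; last by exists (true, true); right.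
have h i : lin (l i) (x - c) != 0 -> exists ij, Y ij x.
  rewrite neq_lt => /orP[xi|xi].
    by exists (i, false); left; apply/sideP; split => //; rewrite mulN1r oppr_gt0.
  by exists (i, true); left; apply/sideP; split => //; rewrite mul1r.
by case: x12 => [/(h true)|/(h false)].
Qed.

End Punctured.

Theorem tame_has_auto K (p : E) (v : E -> E -> G) (g0 : G) : g0 != 1%g ->
  K p -> tame_at K p -> local_system (~` K) v ->
  exists V, nbhs p V /\ has_auto v (V `&` ~` K).
Proof.
move=> g01 Kp [U [Up [h [hc [hi [hic hK hiK]]] [a [b [ab hU]]]]]] vP.
pose w x z := v (hi x) (hi z).
have wP : local_system (hi @^-1` (~` K)) w by exact: local_system_comp.
suff [eps eps0 wa] : exists2 eps : R, 0 < eps &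
    has_auto w (ball (h p) eps `&` hi @^-1` (~` K)).
  exists (h @^-1` ball (h p) eps); split; first exact: hc (nbhsx_ballx _ _ eps0).
  have := @has_auto_comp _ _ _ _ _ h hc wa.
  rewrite /w; under eq_fun do under eq_fun do rewrite !hK.
  by apply: has_autoW => x [xB nK]; split => //=; rewrite hK.
have segK x : segment a b x -> K (hi x).
  by rewrite -hU => -[y [_ Ky] <-]; rewrite hK.
have : segment a b (h p).
  by rewrite -hU; exists p => //; split => //; exact: nbhs_singleton.
move=> [t0 /= t01 cE]; rewrite in_itv /= in t01.
pose d := b - a; have d0 : d != 0 by rewrite subr_eq0 eq_sym.
have [l1 [l2 [l3 [e1 [e2 [dec l1P l2P l3P]]]]]] := frame d0.
pose c := h p.
have hUn : nbhs c (hi @^-1` U) by apply: hic; rewrite /c hK.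
have subseg x : U (hi x) -> K (hi x) -> segment a b x.
  by move=> Ux Kx; rewrite -hU; exists (hi x).
have l3c : continuous (fun x : E => lin l3 (x - c)).
  under eq_fun do rewrite lin_add; apply: contD; [exact: lin_continuous|exact: contC].
have onl x : lin l1 (x - c) = 0 -> lin l2 (x - c) = 0 ->
    x = a + (t0 + lin l3 (x - c)) *: d.
  move=> h1 h2; have := dec (x - c); rewrite h1 h2 !scale0r !add0r => h3.
  by rewrite scalerDl -h3 addrA -/d in cE *; rewrite cE addrC subrK.
have segc t : lin l1 (a + t *: d - c) = 0 /\ lin l2 (a + t *: d - c) = 0 /\
    lin l3 (a + t *: d - c) = t - t0.
  have -> : a + t *: d - c = (t - t0) *: d.
    by rewrite /c -cE; apply/rowP => i; rewrite !mxE; ring.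
  by case: l1P l2P l3P => _ _ p1 [_ _ p2] [_ _ p3]; rewrite !lin_scale p1 p2 p3 !mulr0 mulr1.
pose off eps : set E := ball c eps `&`
   [set x | lin l1 (x - c) != 0 \/ lin l2 (x - c) != 0].
pose sd eps (s : R) : set E := ball c eps `&` half_space (s * l3.1.1) (s * l3.1.2)
   (s * l3.2) (- s * lin l3 c).
have offK eps x : ball c eps `<=` hi @^-1` U -> off eps x -> ~ K (hi x).
  move=> BU [/BU Ux nl] Kx; have [t _ xt] := subseg x Ux Kx.
  by have [z1 [z2 _]] := segc t; move: nl; rewrite -xt /= -/d z1 z2 eqxx; case.
have near_r (r : R) : 0 < r -> exists2 eps : R, 0 < eps & ball c eps `<=` hi @^-1` U /\
    forall x, ball c eps x -> `|lin l3 (x - c)| < r.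
  move=> r0.
  have : nbhs c [set x | `|lin l3 (x - c)| < r].
    have l30 : lin l3 (c - c) = 0 by rewrite subrr /lin /cx /cy /cz !mxE; ring.
    have hr : \forall x \near c, ball (lin l3 (c - c)) r (lin l3 (x - c)) :=
      l3c c _ (nbhsx_ballx _ _ r0).
    by apply: filterS hr => x; rewrite l30 -ball_normE /= sub0r normrN.
  move=> /(filterI hUn) /nbhs_ballP[eps /= eps0 epsP].
  by exists eps => //; split=> x /epsP[].
(* Here [p] goes to an end of the segment, so a small ball meets the image of the knot in a radius;
   the sign [s] points away from the segment, and the bound 1 is the length of the parameter
   interval. *)
have endpoint s : s != 0 -> (forall t, 0 <= t <= 1 -> s * (t - t0) <= 0) ->
   (forall r, s * r <= 0 -> `|r| < 1 -> 0 <= t0 + r <= 1) ->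
   exists2 eps : R, 0 < eps & has_auto w (ball (h p) eps `&` hi @^-1` (~` K)).
  move=> s0 hs1 hs2; have [eps eps0 [BU B1]] := near_r 1 ltr01.
  exists eps => //; have := @ray_complement_auto c d eps w g0 l1 l2 l3 e1 e2 eps0 l1P l2P l3P g01 s s0.
  rewrite -/(off eps) -/(sd eps s).
  have sdP x : sd eps s x <-> ball c eps x /\ 0 < s * lin l3 (x - c).
    rewrite /sd /half_space /= (_ : _ + - s * lin l3 c = s * lin l3 (x - c)) //.
    by rewrite /lin !coordE; ring.
  have -> : off eps `|` sd eps s = ball (h p) eps `&` hi @^-1` (~` K).
    apply/seteqP; split=> x.
      case=> [xo|/sdP[Bx sx]]; first by split; [case: xo|exact: offK xo].
      split => // Kx; have [t t01' xt] := subseg x (BU _ Bx) Kx.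
      rewrite /= in_itv /= in t01'.
      have [_ [_ z3]] := segc t; have := hs1 t t01'.
      by rewrite -z3 /d xt; lra.
    move=> [Bx nKx]; have [|nl] := pselect (lin l1 (x - c) != 0 \/ lin l2 (x - c) != 0).
      by left.
    right; apply/sdP; split => //; rewrite ltNge; apply/negP => sle.
    have z1 : lin l1 (x - c) = 0 by apply/eqP/negP => /negP z; apply: nl; left.
    have z2 : lin l2 (x - c) = 0 by apply/eqP/negP => /negP z; apply: nl; right.
    apply: nKx; apply: segK; exists (t0 + lin l3 (x - c)); last by rewrite -/d -onl.
    by rewrite /= in_itv /=; apply: hs2 => //; exact: B1.
  by apply; apply: local_systemW wP => x [].
have [t00|t0n0] := eqVneq t0 0.
  apply: (endpoint (-1)); first by rewrite oppr_eq0.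
    by rewrite t00 => t /andP[? ?]; lra.
  by rewrite t00 => r r0; rewrite ltr_norml => /andP[_ rb]; apply/andP; split; clear -r0 rb; lra.
have [t10|t0n1] := eqVneq t0 1.
  apply: (endpoint 1) => //; first by rewrite t10 => t /andP[? ?]; lra.
  by rewrite t10 => r r0; rewrite ltr_norml => /andP[rb _]; apply/andP; split; clear -r0 rb; lra.
have t0gt : 0 < t0 by rewrite lt_neqAle eq_sym t0n0; case/andP: t01.
have t0lt : t0 < 1 by rewrite lt_neqAle t0n1; case/andP: t01.
(* Within this distance neither end of the segment is reached, so the image of the knot is a
   diameter. *)
have [eps eps0 [BU B1]] := near_r (Num.min t0 (1 - t0)) ltac:(by rewrite lt_min t0gt subr_gt0).
exists eps => //; have := @line_complement_auto c d eps w g0 l1 l2 l3 e1 e2 eps0 l1P l2P l3P g01.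
rewrite -/(off eps).
have -> : off eps = ball (h p) eps `&` hi @^-1` (~` K).
  apply/seteqP; split=> x; first by move=> xo; split; [case: xo|exact: offK xo].
  move=> [Bx nKx]; split => //; apply: contrapT => nl; apply: nKx.
  have z1 : lin l1 (x - c) = 0 by apply/eqP/negP => /negP z; apply: nl; left.
  have z2 : lin l2 (x - c) = 0 by apply/eqP/negP => /negP z; apply: nl; right.
  apply: segK; exists (t0 + lin l3 (x - c)); last by rewrite -/d -onl.
  have := B1 _ Bx; rewrite lt_min !ltr_norml => /andP[/andP[b1 b2] /andP[b3 b4]].
  by rewrite /= in_itv /=; apply/andP; split; clear -b1 b2 b3 b4; lra.
by apply; apply: local_systemW wP => x [].
Qed.

End Tame.

(** * The knot *)

Section Columns.
Variables (R : realType) (q : nat -> nat).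
Hypothesis qodd : forall n, odd (q n).

(** One column for the gap and [(q n).+1] for the run, whose [q n] crossings sit at the inner column
    ends. The path, counted by [psize], passes the gap once and every column of the run three
    times. *)
Definition csize n := (q n).+2.
Definition psize n := (3 * q n + 4)%N.
Definition cstart := block_start csize.
Definition pstart := block_start psize.

Lemma csize_gt0 n : (0 < csize n)%N. Proof. by []. Qed.
Lemma psize_gt0 n : (0 < psize n)%N. Proof. by rewrite /psize addn_gt0 orbT. Qed.

(* The unit interval [i, i + 1] of the X-axis is the gap before run [n] if
   [col_idx i = 0] and meets run [n] otherwise, where [n = col_blk i];
   [lcross] and [rcross] tell whether its ends are crossings. *)
Definition col_blk i := (block_of csize i).1.
Definition col_idx i := (block_of csize i).2.
Definition lcross i := (2 <= col_idx i)%N.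
Definition rcross i := (1 <= col_idx i <= q (col_blk i))%N.
Definition in_run i := (0 < col_idx i)%N.

Lemma col_blkE n j : (j < csize n)%N -> col_blk (cstart n + j) = n.
Proof. by move=> h; rewrite /col_blk block_start_of. Qed.

Lemma col_idxE n j : (j < csize n)%N -> col_idx (cstart n + j) = j.
Proof. by move=> h; rewrite /col_idx block_start_of. Qed.

Lemma lcrossE n j : (j < csize n)%N -> lcross (cstart n + j) = (2 <= j)%N.
Proof. by move=> h; rewrite /lcross col_idxE. Qed.

Lemma rcrossE n j : (j < csize n)%N ->
  rcross (cstart n + j) = (1 <= j <= q n)%N.
Proof. by move=> h; rewrite /rcross col_idxE // col_blkE. Qed.

Lemma col_ind (P : nat -> Prop) :
  (forall n j, (j < csize n)%N -> P (cstart n + j)%N) -> forall i, P i.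
Proof. exact: (block_ind csize_gt0). Qed.

Lemma rcross_lcrossS i : rcross i = lcross i.+1.
Proof.
elim/col_ind: i => n j jn; rewrite rcrossE //.
have [h|h] := ltnP j.+1 (csize n).
  by rewrite -addnS lcrossE //; move: h; rewrite /csize; lia.
have -> : ((cstart n + j).+1 = cstart n.+1 + 0)%N.
  by rewrite /cstart /= -/(cstart n); move: jn h; rewrite /csize; lia.
by rewrite lcrossE //; move: jn h; rewrite /csize; lia.
Qed.

Lemma run_cross i : in_run i -> lcross i || rcross i.
Proof.
rewrite /in_run /lcross /rcross => h; have := qodd (col_blk i).
by case: (q _) => // k _; lia.
Qed.

Lemma cross_run i : lcross i || rcross i -> in_run i.
Proof. by rewrite /in_run /lcross /rcross; lia. Qed.

(** Tent profile of a column: 0 at an end that is a crossing, 1 at an end that is not. *)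
Definition phi i (t : R) : R :=
  Num.min (if lcross i then t else 1) (if rcross i then 1 - t else 1).

(** Depth of a strand, one half at a crossing on the left and minus one half at a crossing on the
    right. A strand changes its sign at a crossing, so its depth is continuous, and the strand of
    slope 1 passes in front every time, as in a torus braid. *)
Definition theta i (t : R) : R :=
  (if lcross i then Num.max 0 (1 / 2 - t) else 0) -
  (if rcross i then Num.max 0 (t - 1 / 2) else 0).

Lemma phi_continuous i : continuous (phi i).
Proof.
apply: cont_min.
  by case: (lcross i); [move=> x; exact: cvg_id|exact: contC].
case: (rcross i); last exact: contC.
by apply: contB; [exact: contC|move=> x; exact: cvg_id].
Qed.

Lemma theta_continuous i : continuous (theta i).
Proof.
apply: contB; [case: (lcross i)|case: (rcross i)]; try exact: contC.
  apply: cont_max; first exact: contC.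
  by apply: contB; [exact: contC|move=> x; exact: cvg_id].
apply: cont_max; first exact: contC.
by apply: contB; [move=> x; exact: cvg_id|exact: contC].
Qed.

Lemma phi0 i : phi i 0 = if lcross i then 0 else 1.
Proof. rewrite /phi subr0; case: (lcross i); case: (rcross i); rewrite ?minxx //.
  by rewrite min_l // ler01.
by rewrite min_l // ler01. Qed.

Lemma phi1 i : phi i 1 = if rcross i then 0 else 1.
Proof.
by rewrite /phi subrr; do 2?case: ifP => _; rewrite ?minxx // min_r // ler01.
Qed.

Lemma theta0 i : theta i 0 = if lcross i then 1 / 2 else 0.
Proof.
rewrite /theta subr0 sub0r (max_l (_ : - (1 / 2) <= 0)); last by lra.
by rewrite if_same subr0 max_r //; lra.
Qed.

Lemma theta1 i : theta i 1 = if rcross i then - (1 / 2) else 0.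
Proof.
rewrite /theta (max_l (_ : 1 / 2 - 1 <= 0)); last by lra.
by rewrite if_same sub0r max_r; [case: ifP; lra|lra].
Qed.

Lemma phi_bounds i t : 0 <= t <= 1 -> 0 <= phi i t <= 1.
Proof.
move=> /andP[t0 t1]; rewrite /phi; apply/andP; split.
  by rewrite le_min; apply/andP; split; case: ifP => _; lra.
by rewrite ge_min; apply/orP; left; case: ifP => _; lra.
Qed.

Lemma phi_eq0 i t : 0 <= t <= 1 -> phi i t = 0 ->
  (t = 0 /\ lcross i) \/ (t = 1 /\ rcross i).
Proof.
move=> /andP[t0 t1]; rewrite /phi; case: (leP (if lcross i then t else 1)) => _.
  by case: ifP => _ h; [left|lra].
by case: ifP => _ h; [right; split => //; lra|lra].
Qed.

Lemma phi_eq1 i t : in_run i -> 0 <= t <= 1 -> phi i t = 1 ->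
  (t = 0 /\ ~~ lcross i) \/ (t = 1 /\ ~~ rcross i).
Proof.
move=> /run_cross h /andP[t0 t1] p1.
have : 1 <= phi i t by rewrite p1.
rewrite /phi le_min => /andP[]; case: ifP h => /= l; case: ifP => //= r _ h1 h2; lra.
Qed.

Lemma theta_bounds i t : 0 <= t <= 1 -> `|theta i t| <= 1 / 2.
Proof.
move=> /andP[t0 t1]; rewrite /theta ler_norml.
case: ifP => _; case: ifP => _; case: (leP 0 (1 / 2 - t)) => ?;
  case: (leP 0 (t - 1 / 2)) => ?; apply/andP; split; lra.
Qed.

Lemma phi_gap i t : ~~ in_run i -> phi i t = 1 /\ theta i t = 0.
Proof.
move=> h; have : ~~ lcross i /\ ~~ rcross i.
  by split; apply: contra h => h; apply: cross_run; rewrite h ?orbT.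
by move=> [/negPf l /negPf r]; rewrite /phi /theta l r minxx subrr.
Qed.

(* Each block of the path runs through its gap, then three times through the
   columns of its run, the second time backwards along the third strand. *)
Definition pback m := let: (n, r) := block_of psize m in
  ((q n).+2 <= r <= (q n).*2.+2)%N.
Definition pcol m := let: (n, r) := block_of psize m in
  (cstart n + (if r <= (q n).+1 then r else
     if r <= (q n).*2.+2 then (q n).*2.+3 - r else r - (q n).*2.+2))%N.
Definition pneg m := let: (n, r) := block_of psize m in
  if (r <= (q n).+1)%N then (r == 0%N) || odd r else ~~ odd r.

Definition psgn m : R := if pneg m then -1 else 1.

Definition pX m (t : R) : R := (pcol m)%:R + (if pback m then 1 - t else t).
Definition pY m (t : R) : R :=
  if pback m then 2 - phi (pcol m) (1 - t) else psgn m * phi (pcol m) t.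
Definition pZ m (t : R) : R :=
  if pback m then 0 else psgn m * theta (pcol m) t.

Lemma path_ind (P : nat -> Prop) :
  (forall n r, (r < psize n)%N -> P (pstart n + r)%N) -> forall m, P m.
Proof. exact: (block_ind psize_gt0). Qed.

Lemma path_block n r : (r < psize n)%N ->
  block_of psize (pstart n + r) = (n, r).
Proof. exact: (block_start_of psize_gt0). Qed.

(** The four kinds of pieces in the order of travel: the gap, the first passage [PieceP], the return
    [PieceR] along the third strand, the second passage [PieceQ]. The sign is irrelevant to a
    backward piece, hence the free [b]. *)
Inductive piece_spec : nat -> bool -> nat -> bool -> Prop :=
| PieceGap n : piece_spec (pstart n) false (cstart n) true
| PieceP n j : (0 < j <= (q n).+1)%N ->
    piece_spec (pstart n + j) false (cstart n + j) (odd j)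
| PieceR n j b : (0 < j <= (q n).+1)%N ->
    piece_spec (pstart n + ((q n).*2.+3 - j)) true (cstart n + j) b
| PieceQ n j : (0 < j <= (q n).+1)%N ->
    piece_spec (pstart n + ((q n).*2.+2 + j)) false (cstart n + j) (~~ odd j).

Lemma pieceP m : piece_spec m (pback m) (pcol m) (pneg m).
Proof.
elim/path_ind: m => n r rn; rewrite /pback /pcol /pneg path_block //.
have [->|r0] := eqVneq r 0%N; first by rewrite !addn0; exact: PieceGap.
have [r1|r1] := leqP r (q n).+1.
  by apply: PieceP; lia.
have [r2|r2] /= := leqP r (q n).*2.+2.
  have e : r = ((q n).*2.+3 - ((q n).*2.+3 - r))%N by lia.
  by rewrite {1}e; apply: PieceR; lia.
have e : r = ((q n).*2.+2 + (r - (q n).*2.+2))%N by lia.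
rewrite {1}e (_ : odd r = odd (r - (q n).*2.+2)); first by apply: PieceQ; move: rn; rewrite /psize; lia.
by rewrite {1}e oddD /= odd_double.
Qed.

Lemma piece_gap n : [/\ pback (pstart n) = false, pcol (pstart n) = cstart n &
  pneg (pstart n)].
Proof.
have h : block_of psize (pstart n) = (n, 0%N).
  by rewrite -{1}[pstart n]addn0 path_block // psize_gt0.
by rewrite /pback /pcol /pneg h /= addn0.
Qed.

Lemma piece_P n j : (0 < j <= (q n).+1)%N ->
  [/\ pback (pstart n + j) = false, pcol (pstart n + j) = (cstart n + j)%N &
  pneg (pstart n + j) = odd j].
Proof.
move=> jn; rewrite /pback /pcol /pneg path_block; last by rewrite /psize; lia.
by split; do ?case: ifP; lia.
Qed.

Lemma piece_R n j : (0 < j <= (q n).+1)%N ->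
  let m := (pstart n + ((q n).*2.+3 - j))%N in
  pback m /\ pcol m = (cstart n + j)%N.
Proof.
move=> jn; rewrite /pback /pcol path_block; last by rewrite /psize; lia.
split; first lia.
by rewrite ifF ?ifT; lia.
Qed.

Lemma piece_Q n j : (0 < j <= (q n).+1)%N ->
  let m := (pstart n + ((q n).*2.+2 + j))%N in
  [/\ pback m = false, pcol m = (cstart n + j)%N & pneg m = ~~ odd j].
Proof.
move=> jn; rewrite /pback /pcol /pneg path_block; last by rewrite /psize; lia.
split; [lia|rewrite !ifF; lia|].
by rewrite ifF; [rewrite oddD /= odd_double|lia].
Qed.

Lemma pX_bounds m t : 0 <= t <= 1 ->
  (pcol m)%:R <= pX m t <= (pcol m)%:R + 1.
Proof. by move=> /andP[? ?]; rewrite /pX; case: ifP => _; apply/andP; split; lra. Qed.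

Lemma cstartS n : cstart n.+1 = (cstart n + (q n).+1).+1.
Proof. by rewrite /cstart /= /csize addnS. Qed.

Lemma pstartS n : pstart n.+1 = (pstart n + ((q n).*2.+2 + (q n).+1)).+1.
Proof. by rewrite /pstart /= /psize; lia. Qed.

Lemma col_match i : phi i 1 = phi i.+1 0 /\ theta i 1 = - theta i.+1 0.
Proof.
rewrite phi0 phi1 theta0 theta1 rcross_lcrossS; split=> //.
by case: ifP; rewrite ?oppr0.
Qed.

Lemma run_end n : ~~ rcross (cstart n + (q n).+1) /\ ~~ rcross (cstart n) /\
  ~~ lcross (cstart n + 1) /\ ~~ lcross (cstart n).
Proof.
by rewrite -{2 4}[cstart n]addn0 !rcrossE ?lcrossE /csize //; split => //; lia.
Qed.

(** At a crossing [phi] vanishes and [theta] changes its sign together with the piece; at a turn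
    [phi] is 1 and equals [2 - phi]. The right turn starts from the strand [y = phi], where an odd
    number of crossings has led. *)
Lemma piece_match m : [/\ pX m 1 = pX m.+1 0, pY m 1 = pY m.+1 0 &
  pZ m 1 = pZ m.+1 0].
Proof.
have fwd m' c b c' b' : pback m' = false -> pcol m' = c -> pneg m' = b ->
   pback m'.+1 = false -> pcol m'.+1 = c' -> pneg m'.+1 = b' -> c' = c.+1 ->
   (rcross c -> b' = ~~ b) -> (~~ rcross c -> b' = b) ->
   [/\ pX m' 1 = pX m'.+1 0, pY m' 1 = pY m'.+1 0 & pZ m' 1 = pZ m'.+1 0].
  move=> h1 h2 h3 h4 h5 h6 ec hc hn; rewrite /pX /pY /pZ /psgn h1 h2 h3 h4 h5 h6 ec.
  have [e1 e2] := col_match c; rewrite -e1 -[theta c.+1 0]opprK -e2 phi1 theta1 -natr1.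
  split; first by rewrite addr0.
    by have [/hc ->|/hn ->] := boolP (rcross c); rewrite ?mulr0 //.
  by have [/hc ->|/hn ->] := boolP (rcross c); rewrite ?oppr0 ?mulr0 //; case: b {h3 hc hn} => /=; lra.
have bwd m' c c' : pback m' -> pcol m' = c -> pback m'.+1 -> pcol m'.+1 = c' ->
   c = c'.+1 ->
   [/\ pX m' 1 = pX m'.+1 0, pY m' 1 = pY m'.+1 0 & pZ m' 1 = pZ m'.+1 0].
  move=> h1 h2 h3 h4 ec; rewrite /pX /pY /pZ h1 h2 h3 h4 ec subrr subr0.
  by have [e1 e2] := col_match c'; rewrite -e1 -natr1 addr0.
have [n|n j|n j b|n j] := pieceP m => [|jn|jn|jn].
- have [h1 h2 h3] := piece_gap n; have [|h4 h5 h6] := @piece_P n 1%N; first by [].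
  rewrite addn1 in h4 h5 h6.
  apply: (fwd _ _ _ _ _ h1 h2 h3 h4 h5 h6); rewrite ?addn1 //.
  by have [_ [/negPf -> _]] := run_end n.
- have [h1 h2 h3] := piece_P jn; have [jq|jq] := leqP j (q n).
    have [|h4 h5 h6] := @piece_P n j.+1; first lia.
    rewrite addnS in h4 h5 h6.
    apply: (fwd _ _ _ _ _ h1 h2 h3 h4 h5 h6); rewrite ?addnS //.
    by rewrite rcrossE; [lia|rewrite /csize; lia].
  have -> : j = (q n).+1 by lia.
  move: h1 h2 h3; have {jn jq} -> : j = (q n).+1 by lia.
  have [|h4 h5] := @piece_R n (q n).+1; first lia.
  rewrite (_ : (pstart n + ((q n).*2.+3 - (q n).+1) = (pstart n + (q n).+1).+1)%N) in h4 h5; last lia.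
  move=> h1 h2 h3; rewrite /pX /pY /pZ /psgn h1 h2 h3 h4 h5 subr0 /= qodd /= phi1 theta1.
  have [/negPf -> _] := run_end n; by split; lra.
- have [h1 h2] := piece_R jn; have [j1|j1] := ltnP 1 j.
    have [|h4 h5] := @piece_R n j.-1; first lia.
    rewrite (_ : (pstart n + ((q n).*2.+3 - j.-1) = (pstart n + ((q n).*2.+3 - j)).+1)%N) in h4 h5; last lia.
    by apply: (bwd _ _ _ h1 h2 h4 h5); lia.
  move: h1 h2; have {jn j1} -> : j = 1%N by lia.
  have [|h4 h5 h6] := @piece_Q n 1; first lia.
  rewrite (_ : (pstart n + ((q n).*2.+2 + 1) = (pstart n + ((q n).*2.+3 - 1)).+1)%N) in h4 h5 h6; last lia.
  move=> h1 h2; rewrite /pX /pY /pZ /psgn h1 h2 h4 h5 h6 subrr /= phi0 theta0.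
  have [_ [_ [/negPf -> _]]] := run_end n; by split; lra.
have [h1 h2 h3] := piece_Q jn; have [jq|jq] := leqP j (q n).
  have [|h4 h5 h6] := @piece_Q n j.+1; first lia.
  rewrite (_ : (pstart n + ((q n).*2.+2 + j.+1) = (pstart n + ((q n).*2.+2 + j)).+1)%N) in h4 h5 h6; last lia.
  rewrite (addnS (cstart n)) in h5.
  apply: (fwd _ _ _ _ _ h1 h2 h3 h4 h5 h6); rewrite ?addnS //.
  by rewrite rcrossE; [lia|rewrite /csize; lia].
move: h1 h2 h3; have {jn jq} -> : j = (q n).+1 by lia.
have [h4 h5 h6] := piece_gap n.+1; rewrite pstartS in h4 h5 h6.
move=> h1 h2 h3; apply: (fwd _ _ _ _ _ h1 h2 h3 h4 h5 h6); rewrite ?cstartS //.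
  by have [/negPf -> _] := run_end n.
by move=> _; rewrite /= qodd.
Qed.

End Columns.

Lemma paste_continuous (R : realType) (U : topologicalType) (f g h : R -> U)
  (a : R) : {for a, continuous g} -> {for a, continuous h} ->
  g a = h a ->
  (\forall s \near a, (s <= a -> f s = g s) /\ (a <= s -> f s = h s)) ->
  {for a, continuous f}.
Proof.
move=> gc hc gh fP; have fa : f a = g a.
  by have [h1 _] := nbhs_singleton fP; apply: h1.
move=> V; rewrite fa => Va.
have Vg : \forall s \near a, V (g s) by exact: gc.
have Vh : \forall s \near a, V (h s) by apply: hc; rewrite -gh.
apply: filterS3 fP Vg Vh => s [fg fh] Vgs Vhs.
by rewrite /=; have [/fg ->|/ltW/fh ->] := leP s a.
Qed.

Lemma near_itvoo (R : realType) (a b s : R) : a < s -> s < b ->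
  \forall t \near s, a < t < b.
Proof.
move=> as_ sb; have h : \forall t \near s, t \in `]a, b[.
  by apply: near_in_itvoo; rewrite in_itv /= as_.
by apply: filterS h => t; rewrite in_itv.
Qed.

Section Path.
Variables (R : realType) (q : nat -> nat).
Hypothesis qodd : forall n, odd (q n).
Notation E := 'rV[R]_3.
Notation pX := (@pX R q).
Notation pY := (@pY R q).
Notation pZ := (@pZ R q).
Notation phi := (@phi R q).
Notation theta := (@theta R q).

(* Projective coordinates: the columns [i <= X <= i + 1] shrink to [limit_pt]. *)
Definition pt (X y z : R) : E := vec3 (X / (1 + X)) (y / (1 + X)) (z / (1 + X)).

(** Height of the return arc, which closes the knot from below. It is -1 where the first gap starts
    and below -1 elsewhere; the bound -3 makes the arc converge to the limit point. The coefficient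
    3 exceeds the 2 that the division by [1 + X] costs, so that the projected height is still
    monotone near the start. *)
Definition ret (X : R) : R := - (1 + 3 * X) / (1 + X).

Definition limit_pt : E := vec3 1 0 0.

Lemma div_inj (X X' : R) : -1 < X -> -1 < X' ->
  X / (1 + X) = X' / (1 + X') -> X = X'.
Proof.
move=> X0 X0' /eqP.
rewrite eqr_div; [|by rewrite gt_eqF //; lra|by rewrite gt_eqF //; lra].
by move=> /eqP h; lra.
Qed.

Lemma pt_inj X y z X' y' z' : -1 < X -> -1 < X' -> pt X y z = pt X' y' z' ->
  [/\ X = X', y = y' & z = z'].
Proof.
move=> X0 X0' h; have := congr1 (@cx R) h; have := congr1 (@cy R) h.
have := congr1 (@cz R) h; rewrite /pt !coordE => hz hy /(div_inj X0 X0') e.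
subst X'; have n0 : (1 + X)^-1 != 0 by rewrite invr_eq0 gt_eqF //; lra.
by split=> //; [exact: (mulIf n0 hy)|exact: (mulIf n0 hz)].
Qed.

Lemma pt_cvg (T : topologicalType) (f g h : T -> R) x : -1 < f x ->
  {for x, continuous f} -> {for x, continuous g} -> {for x, continuous h} ->
  {for x, continuous (fun t => pt (f t) (g t) (h t))}.
Proof.
move=> fx fc gc hc.
have ic : {for x, continuous (fun t => (1 + f t)^-1)}.
  apply: cvgV; first by rewrite gt_eqF //; lra.
  by apply: cvgD; [exact: cvg_cst|exact: fc].
by apply: vec3_cvg; apply: cvgM.
Qed.

Lemma pX_continuous m : continuous (pX m).
Proof.
apply: contD; first exact: contC.
case: (pback q m); last by move=> x; exact: cvg_id.
by apply: contB; [exact: contC|move=> x; exact: cvg_id].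
Qed.

Let rev_continuous (f : R -> R) : continuous f ->
  continuous (fun t : R => f (1 - t)).
Proof.
move=> fc t; apply: (@continuous_comp _ _ _ (fun t : R => 1 - t) f); last exact: fc.
by apply: contB; [exact: contC|move=> x; exact: cvg_id].
Qed.

Lemma pY_continuous m : continuous (pY m).
Proof.
rewrite /pY; case: (pback q m).
  by apply: contB; [exact: contC|exact/rev_continuous/phi_continuous].
by apply: contM; [exact: contC|exact: phi_continuous].
Qed.

Lemma pZ_continuous m : continuous (pZ m).
Proof.
rewrite /pZ; case: (pback q m); first exact: contC.
by apply: contM; [exact: contC|exact: theta_continuous].
Qed.

Definition piece m t : E := pt (pX m t) (pY m t) (pZ m t).

Lemma pX_ge0 m t : 0 <= t <= 1 -> 0 <= pX m t.
Proof.
by move=> /(pX_bounds q m) /andP[h _]; apply: le_trans h; rewrite ler0n.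
Qed.

Lemma piece_continuous m t : 0 <= t <= 1 -> {for t, continuous (piece m)}.
Proof.
move=> t01; apply: pt_cvg.
- by have := pX_ge0 m t01; lra.
- exact: pX_continuous.
- exact: pY_continuous.
- exact: pZ_continuous.
Qed.

Lemma piece_end m : piece m 1 = piece m.+1 0.
Proof. by rewrite /piece; have [-> -> ->] := @piece_match R q qodd m. Qed.

Definition return_pt (X : R) : E := pt X (ret X) 0.

(* A parametrisation by the line of the knot minus the limit point. *)
Definition Gam (s : R) : E :=
  if s < 0 then return_pt (- s)
  else piece (Num.truncn s) (s - (Num.truncn s)%:R).

Lemma Gam_neg s : s <= 0 -> Gam s = return_pt (- s).
Proof.
rewrite le_eqVlt => /orP[/eqP ->|s0]; last by rewrite /Gam s0.
rewrite /Gam ltxx truncn0 subrr oppr0 /return_pt /piece.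
have [h1 h2 h3] := piece_gap q 0.
rewrite /pX /pY /pZ /psgn h1 h2 h3 phi0 theta0 /ret /=.
by rewrite !mulr0 !addr0 divr1 mulr1.
Qed.

Lemma Gam_piece m t : 0 <= t <= 1 -> Gam (m%:R + t) = piece m t.
Proof.
move=> /andP[t0]; rewrite le_eqVlt => /orP[/eqP ->|t1].
  rewrite natr1 /Gam ltNge ler0n /= natrK subrr; exact/esym/piece_end.
have h : Num.truncn (m%:R + t : R) = m.
  by apply/truncn_def; rewrite -natr1 lerDl t0 ltrD2l.
rewrite /Gam ltNge addr_ge0 //= h; congr piece; ring.
Qed.

Lemma Gam_itv m s : m%:R <= s <= m.+1%:R -> Gam s = piece m (s - m%:R).
Proof.
move=> /andP[s0 s1]; rewrite -Gam_piece; first by congr Gam; ring.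
by rewrite -natr1 in s1; apply/andP; split; lra.
Qed.

Lemma Gam_cases (s : R) : 0 < s -> exists m, m%:R < s <= m.+1%:R.
Proof.
move=> s0; have /andP[h1 h2] := truncn_itv (ltW s0).
have [e|ne] := eqVneq (Num.truncn s)%:R s; last first.
  by exists (Num.truncn s); rewrite lt_neqAle ne h1 ltW.
move: e; case: (Num.truncn s) h1 h2 => [|m] _ _ e; first by rewrite -e ltxx in s0.
by exists m; rewrite -e ltr_nat ltnS leqnn lexx.
Qed.

Lemma return_continuous (X : R) : -1 < X -> {for X, continuous return_pt}.
Proof.
move=> X1; apply: (@pt_cvg _ (fun X => X) ret (fun=> 0)) => //.
- apply: cvgM; last first.
    apply: cvgV; first by rewrite gt_eqF //; lra.
    by apply: cvgD; [exact: cvg_cst|exact: cvg_id].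
  apply: cvgN; apply: cvgD; first exact: cvg_cst.
  by apply: cvgM; [exact: cvg_cst|exact: cvg_id].
- exact: cvg_cst.
Qed.

Let shift_continuous m t : m%:R <= t <= m.+1%:R ->
  {for t, continuous (fun s : R => piece m (s - m%:R))}.
Proof.
rewrite -natr1 => /andP[h1 h2].
apply: (@continuous_comp _ _ _ (fun s : R => s - m%:R) (piece m)).
  by apply: cvgB; [exact: cvg_id|exact: cvg_cst].
by apply: piece_continuous; apply/andP; split; lra.
Qed.

Lemma Gam_continuous : continuous Gam.
Proof.
have retc s : s <= 0 -> {for s, continuous (fun s : R => return_pt (- s))}.
  move=> s0; apply: (@continuous_comp _ _ _ (fun s : R => - s) return_pt).
    by apply: cvgN; exact: cvg_id.
  by apply: return_continuous; lra.
move=> s; have [s0|s0|->] := ltgtP s 0.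
- apply: (@paste_continuous _ _ _ (fun s => return_pt (- s)) (fun s => return_pt (- s))).
  + by apply: retc; exact: ltW.
  + by apply: retc; exact: ltW.
  + by [].
  have h : \forall t \near s, s - 1 < t < 0 by apply: near_itvoo => //; lra.
  by apply: filterS h => t /andP[_ /ltW t0]; split=> _; exact: Gam_neg.
- have [m /andP[m1 m2]] := Gam_cases s0.
  have [sm|sm] := ltP s m.+1%:R.
    apply: (@paste_continuous _ _ _ (fun s => piece m (s - m%:R)) (fun s => piece m (s - m%:R))).
    + by apply: shift_continuous; rewrite (ltW m1).
    + by apply: shift_continuous; rewrite (ltW m1).
    + by [].
    have h := near_itvoo m1 sm.
    by apply: filterS h => t /andP[/ltW h1 /ltW h2]; split=> _; apply: Gam_itv; rewrite h1.
  have {m2 sm} es : s = m.+1%:R by apply/le_anti; rewrite m2.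
  subst s; apply: (@paste_continuous _ _ _ (fun s => piece m (s - m%:R)) (fun s => piece m.+1 (s - m.+1%:R))).
  + by apply: shift_continuous; rewrite (ltW m1) lexx.
  + by apply: shift_continuous; rewrite lexx ler_nat leqnSn.
  + by rewrite subrr -piece_end -natr1; congr piece; ring.
  have h : \forall t \near (m.+1%:R : R), m%:R < t < m.+2%:R.
    by apply: near_itvoo; rewrite ltr_nat.
  apply: filterS h => t /andP[/ltW h1 /ltW h2].
  by split=> ht; apply: Gam_itv; rewrite ?h1 ?h2 ?ht.
- apply: (@paste_continuous _ _ _ (fun s => return_pt (- s)) (fun s => piece 0 (s - 0%:R))).
  + exact: retc.
  + by apply: shift_continuous; rewrite lexx ler01.
  + by rewrite -Gam_neg // -Gam_itv // lexx ler01.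
  have h : \forall t \near (0 : R), -1 < t < 1 by apply: near_itvoo; lra.
  apply: filterS h => t /andP[/ltW h1 /ltW h2].
  by split=> ht; [exact: Gam_neg|apply: Gam_itv; rewrite ht].
Qed.

(* In a gap there is one strand; in a run two strands [y = - phi] and [y = phi]
   cross each other and the third one, [y = 2 - phi], turns round at both ends. *)
Definition strand i (t y z : R) : Prop :=
  (y = - phi i t /\ z = - theta i t) \/
  (in_run q i /\ ((y = phi i t /\ z = theta i t) \/ (y = 2 - phi i t /\ z = 0))).

(* The knot in the coordinates of [pt]. *)
Definition knot (X y z : R) : Prop := 0 <= X /\
  ((y = ret X /\ z = 0) \/
   exists i t, [/\ 0 <= t <= 1, X = i%:R + t & strand i t y z]).

Lemma in_runE n j : (j < csize q n)%N -> in_run q (cstart q n + j) = (0 < j)%N.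
Proof. by move=> h; rewrite /in_run col_idxE. Qed.

Lemma piece_strand m t : 0 <= t <= 1 -> exists t', [/\ 0 <= t' <= 1,
  pX m t = (pcol q m)%:R + t' & strand (pcol q m) t' (pY m t) (pZ m t)].
Proof.
move=> /andP[t0 t1]; rewrite /pX /pY /pZ /psgn.
have [n|n j|n j b|n j] := pieceP q m => [|jn|jn|jn].
- exists t; split; [by rewrite t0|by []|left]; by rewrite !mulN1r.
- exists t; split; [by rewrite t0|by []|].
  case: ifP => _; [left|right]; rewrite ?mulN1r ?mul1r //.
  split; last by left.
  by rewrite in_runE //; [|rewrite /csize]; lia.
- exists (1 - t); split; [by apply/andP; split; lra|by []|right; split; last by right].
  by rewrite in_runE //; [|rewrite /csize]; lia.
- exists t; split; [by rewrite t0|by []|].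
  case: ifP => _; [left|right]; rewrite ?mulN1r ?mul1r //.
  split; last by left.
  by rewrite in_runE //; [|rewrite /csize]; lia.
Qed.

Lemma strand_piece i t y z : 0 <= t <= 1 -> strand i t y z ->
  exists m t', [/\ 0 <= t' <= 1, pX m t' = i%:R + t, pY m t' = y & pZ m t' = z].
Proof.
move=> t01; elim/(@col_ind q): i => n j jn.
rewrite /strand in_runE //.
have [->|j0] := posnP j.
  rewrite ?ltnn addn0 => -[[-> ->]|[//]].
  have [h1 h2 h3] := piece_gap q n; exists (pstart q n), t.
  by rewrite /pX /pY /pZ /psgn h1 h2 h3 !mulN1r.
have jn' : (0 < j <= (q n).+1)%N by move: jn; rewrite /csize; lia.
have [p1 p2 p3] := piece_P jn'; have [r1 r2] := piece_R jn'.
have [s1 s2 s3] := piece_Q jn'.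
case=> [[-> ->]|[_ [[-> ->]|[-> ->]]]].
- have [oj|oj] := boolP (odd j).
    exists (pstart q n + j)%N, t.
    by rewrite /pX /pY /pZ /psgn p1 p2 p3 oj !mulN1r.
  exists (pstart q n + ((q n).*2.+2 + j))%N, t.
  by rewrite /pX /pY /pZ /psgn s1 s2 s3 oj !mulN1r.
- have [oj|oj] := boolP (odd j).
    exists (pstart q n + ((q n).*2.+2 + j))%N, t.
    by rewrite /pX /pY /pZ /psgn s1 s2 s3 oj !mul1r.
  exists (pstart q n + j)%N, t.
  by rewrite /pX /pY /pZ /psgn p1 p2 p3 (negPf oj) !mul1r.
- exists (pstart q n + ((q n).*2.+3 - j))%N, (1 - t).
  rewrite /pX /pY /pZ /psgn r1 r2 (_ : 1 - (1 - t) = t); last by ring.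
  by split => //; move/andP: t01 => [? ?]; apply/andP; split; lra.
Qed.

Lemma knot_Gam X y z : knot X y z -> exists s, Gam s = pt X y z.
Proof.
case=> X0 [[-> ->]|[i [t [t01 -> /(strand_piece t01)[m [t' [t01' <- <- <-]]]]]]].
  by exists (- X); rewrite Gam_neg ?oppr_le0 // opprK.
by exists (m%:R + t'); rewrite Gam_piece.
Qed.

Lemma Gam_knot s : exists X y z, knot X y z /\ Gam s = pt X y z.
Proof.
have [s0|s0] := leP s 0.
  by exists (- s), (ret (- s)), 0; rewrite Gam_neg //; split => //; split; [lra|left].
have [m /andP[m1 m2]] := Gam_cases s0.
have t01 : 0 <= s - m%:R <= 1 by rewrite -natr1 in m2; apply/andP; split; lra.
exists (pX m (s - m%:R)), (pY m (s - m%:R)), (pZ m (s - m%:R)).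
rewrite (@Gam_itv m) ?(ltW m1) //; split => //; split; first exact: pX_ge0.
right; exists (pcol q m); have [t' [h1 h2 h3]] := piece_strand m t01.
by exists t'.
Qed.

End Path.

(** * The diagram, its double points and the injectivity of the parametrisation *)

Section Knot.
Variables (R : realType) (q : nat -> nat).
Hypothesis qodd : forall n, odd (q n).
Notation E := 'rV[R]_3.
Notation pX := (@pX R q).
Notation pY := (@pY R q).
Notation pZ := (@pZ R q).
Notation phi := (@phi R q).
Notation theta := (@theta R q).
Notation strand := (@strand R q).
Notation knot := (@knot R q).
Notation Gam := (@Gam R q).
Notation piece := (@piece R q).

Lemma nat_frac (i i' : nat) (t t' : R) : 0 <= t <= 1 -> 0 <= t' <= 1 ->
  i%:R + t = i'%:R + t' ->
  [\/ i = i' /\ t = t', i' = i.+1 /\ t = 1 /\ t' = 0 |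
     i = i'.+1 /\ t = 0 /\ t' = 1].
Proof.
move=> /andP[t0 t1] /andP[t0' t1'] e.
have [ii|ii|ii] := ltngtP i i'.
- have h : (i.+1%:R <= i'%:R :> R) by rewrite ler_nat.
  rewrite -natr1 in h; have t1E : t = 1 by lra.
  have e' : i'%:R = i.+1%:R :> R by rewrite -natr1; lra.
  by apply: Or32; split; [exact: (mulrIn (@oner_neq0 R))|split => //; lra].
- have h : (i'.+1%:R <= i%:R :> R) by rewrite ler_nat.
  rewrite -natr1 in h; have t1E : t' = 1 by lra.
  have e' : i%:R = i'.+1%:R :> R by rewrite -natr1; lra.
  by apply: Or33; split; [exact: (mulrIn (@oner_neq0 R))|split => //; lra].
- by apply: Or31; split => //; subst i'; lra.
Qed.

Lemma nat_frac_inj (i i' : nat) (t t' : R) : 0 <= t < 1 -> 0 <= t' < 1 ->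
  i%:R + t = i'%:R + t' -> i = i' /\ t = t'.
Proof.
move=> /andP[t0 t1] /andP[t0' t1'] e.
have [||//|[_ [? ?]]|[_ [? ?]]] := nat_frac _ _ e; try (apply/andP; split); lra.
Qed.

Lemma phi_theta i t : 0 <= t <= 1 -> phi i t = 1 -> theta i t = 0.
Proof.
move=> /andP[t0 t1] p; have : 1 <= phi i t by rewrite p.
rewrite /phi /theta le_min => /andP[].
case: (lcross q i) => h1; case: (rcross q i) => h2; rewrite ?subr0 ?sub0r //; try lra.
- by rewrite max_l //; lra.
- by rewrite max_l ?oppr0 //; lra.
Qed.

Lemma phi_bd i t : 0 <= t <= 1 -> 0 <= phi i t /\ phi i t <= 1.
Proof. by move=> /(phi_bounds q i)/andP. Qed.

Lemma ret_eq (X : R) : 0 <= X -> ret X = -1 - 2 * X / (1 + X).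
Proof. by move=> X0; rewrite /ret; field; rewrite gt_eqF //; lra. Qed.

Lemma ret_bounds (X : R) : 0 <= X -> -3 <= ret X /\ ret X <= -1.
Proof.
move=> X0; rewrite ret_eq //; have X1 : 0 < 1 + X by lra.
have h1 : 0 <= 2 * X / (1 + X) by rewrite divr_ge0 //; lra.
have h2 : 2 * X / (1 + X) <= 2 by rewrite ler_pdivrMr //; lra.
by split; lra.
Qed.

Lemma ret_lt (X : R) : 0 < X -> ret X < -1.
Proof.
move=> X0; rewrite ret_eq; last exact: ltW.
have : 0 < 2 * X / (1 + X) by rewrite divr_gt0 //; lra.
lra.
Qed.

Lemma strand_bounds i t y z : 0 <= t <= 1 -> strand i t y z ->
  [/\ -1 <= y, y <= 2 & `|z| <= 1 / 2].
Proof.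
move=> t01; have [p0 p1] := phi_bd i t01; have tb := theta_bounds q i t01.
by case=> [[-> ->]|[_ [[-> ->]|[-> ->]]]]; rewrite ?normrN ?normr0; split => //; lra.
Qed.

Lemma knot_bounds X y z : knot X y z -> [/\ 0 <= X, ret X <= y, y <= 2 & `|z| <= 1 / 2].
Proof.
case=> X0 h; have [r1 r2] := ret_bounds X0; split => //.
- by case: h => [[-> _]//|[i [t [t01 _ /(strand_bounds t01)[? ? ?]]]]]; lra.
- by case: h => [[-> _]|[i [t [t01 _ /(strand_bounds t01)[? ? ?]]]]]; lra.
- by case: h => [[_ ->]|[i [t [t01 _ /(strand_bounds t01)[? ? ?]]]]] //; rewrite normr0; lra.
Qed.

(** The right turning point of a run. With half-open columns it falls to the following gap, whose
    only strand does not contain it. *)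
Definition tip i (t y z : R) := [/\ t = 0, y = 1, z = 0 & ~~ in_run q i].

Lemma run_last i : in_run q i -> ~~ rcross q i -> ~~ in_run q i.+1.
Proof.
elim/(@col_ind q): i => n j jn; rewrite in_runE // rcrossE // => j0 jq.
have -> : (cstart q n + j).+1 = cstart q n.+1.
  by rewrite cstartS; move: jn; rewrite /csize; lia.
by rewrite -[cstart q n.+1]addn0 in_runE.
Qed.

Lemma cross_runS i : lcross q i.+1 -> in_run q i /\ in_run q i.+1.
Proof.
move=> h; split; apply: cross_run; rewrite ?h // rcross_lcrossS h orbT //.
Qed.

Lemma strand_end i y z : strand i 1 y z -> strand i.+1 0 y z \/ tip i.+1 0 y z.
Proof.
have [e1 e2] := col_match R q i; rewrite /strand e1 e2 opprK phi0 theta0.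
have [/cross_runS[r1 r2]|nl] := boolP (lcross q i.+1).
  rewrite r1 r2 oppr0 => -[[-> ->]|[_ [[-> ->]|[-> ->]]]]; left.
  - by right; split => //; left.
  - by left.
  - by right; split => //; right.
rewrite oppr0; case=> [[-> ->]|[ri h]]; first by left; left.
right; split => //.
- by case: h => [[-> _]//|[-> _]]; lra.
- by case: h => [[_ ->]|[_ ->]].
- by apply: run_last => //; rewrite rcross_lcrossS.
Qed.

Lemma knot_normal X y z : knot X y z -> exists i t, [/\ 0 <= t < 1, X = i%:R + t &
  [\/ y = ret X /\ z = 0, strand i t y z | tip i t y z]].
Proof.
case=> X0 [[yX z0]|[i [t [/andP[t0 t1] Xit st]]]].
  have /andP[h1 h2] := truncn_itv X0; exists (Num.truncn X), (X - (Num.truncn X)%:R).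
  split; [|by ring|by apply: Or31].
  by rewrite -natr1 in h2; apply/andP; split; lra.
have [t1'|t1'] := ltP t 1; first by exists i, t; split; [rewrite t0|by []|exact: Or32].
have {t0 t1 t1'}t1 : t = 1 by lra.
subst t; exists i.+1, 0; split; first by rewrite lexx ltr01.
  by rewrite -natr1 addr0.
by have [?|?] := strand_end st; [apply: Or32|apply: Or33].
Qed.

(** The diagram has no double points besides the crossings: two strands of equal height force [phi]
    to be 0, which is a crossing, or 1, where both depths are 0 and the points coincide. *)
Lemma knot_two_over X y z z' : knot X y z -> knot X y z' -> z < z' ->
  exists i, [/\ X = i%:R, lcross q i, y = 0, z = - (1 / 2) & z' = 1 / 2].
Proof.
move=> k k'; have [X0 _ _ _] := knot_bounds k.
have [r1 r2] := ret_bounds X0.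
have [i [t [t01 Xit h]]] := knot_normal k.
have [i' [t' [t01' Xit' h']]] := knot_normal k'.
have e : i%:R + t = i'%:R + t' by rewrite -Xit -Xit'.
have [ei et] := nat_frac_inj t01 t01' e; subst i' t' => {e Xit'}.
have t01c : 0 <= t <= 1 by case/andP: t01 => -> /ltW ->.
have [p0 p1] := phi_bd i t01c; have pt1 := phi_theta t01c (i := i).
have cr : phi i t = 0 -> [/\ t = 0, lcross q i & theta i t = 1 / 2].
  move=> /(phi_eq0 t01c)[[-> l]|[t1 _]]; first by rewrite theta0 l.
  by case/andP: t01; lra.
have sret zz : strand i t y zz -> y = ret X -> zz = 0.
  case=> [[y2 ->]|[_ [[y2 _]|[y2 _]]]] y3; [|exfalso; lra|exfalso; lra].
  by rewrite pt1 ?oppr0 //; lra.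
have stip zz : strand i t y zz -> y = 1 -> ~~ in_run q i -> False.
  by case=> [[y2 _]|[-> //]] y3 _; lra.
case: h => [[y1 ->]|s|[tt y1 -> nr]];
  case: h' => [[y2 ->]|s'|[tt' y2 -> nr']]; rewrite ?ltxx //.
- by rewrite (sret _ s') // ltxx.
- by rewrite (sret _ s) // ltxx.
- case: s s' => [[y2 ->]|[ri [[y2 ->]|[y2 ->]]]] [[y2' ->]|[ri' [[y2' ->]|[y2' ->]]]] zz;
    try (by rewrite ?ltxx in zz); try lra.
  + have [|tt l th] := cr; first lra.
    by exists i; rewrite th Xit tt addr0; split => //; lra.
  + have [|tt l th] := cr; first lra.
    by rewrite th in zz; lra.
- by case: (stip _ s).
- by case: (stip _ s').
Qed.

Lemma phi_lcross i (t : R) : lcross q i -> t < 1 / 2 -> 0 <= t ->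
  phi i t = t /\ theta i t = 1 / 2 - t.
Proof.
move=> l th t0; rewrite /phi /theta l; split.
  by rewrite min_l //; case: ifP => _; lra.
rewrite max_r; last lra.
by rewrite (max_l (_ : t - 1 / 2 <= 0)) ?if_same ?subr0 //; lra.
Qed.

Lemma phi_rcross i (t : R) : rcross q i -> 1 / 2 < t -> t <= 1 ->
  phi i t = 1 - t /\ theta i t = - (t - 1 / 2).
Proof.
move=> r th t1; rewrite /phi /theta r; split.
  by rewrite min_r //; case: ifP => _; lra.
rewrite (max_r (_ : 0 <= t - 1 / 2)); last lra.
by rewrite (max_l (_ : 1 / 2 - t <= 0)) ?if_same ?sub0r //; lra.
Qed.

Lemma knot_crossing i X y z : lcross q i -> `|X - i%:R| < 1 / 2 ->
  `|y| < 1 / 2 ->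
  knot X y z <-> (y = X - i%:R /\ z = 1 / 2 - `|X - i%:R|) \/
                 (y = - (X - i%:R) /\ z = - (1 / 2 - `|X - i%:R|)).
Proof.
move=> l hX hy; have i0 : (0 < i)%N by case: (i) l.
case: i i0 l hX => // i _ l; rewrite -natr1 => hX.
have [ri ri1] := cross_runS l.
have r : rcross q i by rewrite rcross_lcrossS.
rewrite !ltr_norml in hX hy; case/andP: hX => hX1 hX2; case/andP: hy => hy1 hy2.
have i0 : 0 <= i%:R :> R by rewrite ler0n.
have X0 : 0 <= X by lra.
have [rb1 rb2] := ret_bounds X0.
have [h|h] := leP 0 (X - (i%:R + 1)).
  rewrite ger0_norm //.
  have [p th] := @phi_lcross i.+1 (X - (i%:R + 1)) l hX2 h.
  split.
    case=> _ [[yr _]|[i' [t' [t01' Xi st]]]]; first lra.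
    have t01 : 0 <= X - (i%:R + 1) <= 1 by apply/andP; split; clear -h hX2; lra.
    have e : i'%:R + t' = i.+1%:R + (X - (i%:R + 1)) by rewrite -Xi -natr1; ring.
    case: (nat_frac t01' t01 e) => [[ei et]|[ei [t1 t0]]|[ei [t0 t1]]]; last by clear -t1 hX2; lra.
      subst i' t'; move: st; rewrite /strand p th.
      case=> [[-> ->]|[_ [[-> ->]|[y2 _]]]]; [right|left|].
      - by split; [ring|clear; lra].
      - by split.
      by clear -y2 hy2 hX2; lra.
    move: ei => [ei]; subst i' t'; have [p1 th1] := @phi_rcross i 1 r ltac:(lra) (lexx _).
    move: st; rewrite /strand p1 th1.
    case=> [[y1 z1]|[_ [[y1 z1]|[y2 _]]]]; [left|right|by clear -y2 hy2; lra].
    - by clear -y1 z1 t0; split; lra.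
    by clear -y1 z1 t0; split; lra.
  move=> h2; split => //; right; exists i.+1, (X - (i%:R + 1)).
  split; [by apply/andP; split; clear -h hX2; lra|by rewrite -natr1; ring|].
  rewrite /strand p th; case: h2 => [[-> ->]|[-> ->]]; [right|left]; split => //.
  by left.
rewrite ltr0_norm //.
have u1 : 1 / 2 < X - i%:R by clear -hX1; lra.
have u2 : X - i%:R <= 1 by clear -h; lra.
have [p th] := @phi_rcross i (X - i%:R) r u1 u2.
split.
  case=> _ [[yr _]|[i' [t' [t01' Xi st]]]]; first lra.
  have t01 : 0 <= X - i%:R <= 1 by apply/andP; split; clear -h hX1; lra.
  have e : i'%:R + t' = i%:R + (X - i%:R) by rewrite -Xi; ring.
  case: (nat_frac t01' t01 e) => [[ei et]|[ei [t1 t0]]|[ei [t0 t1]]]; [|by clear -t0 hX1; lra|by clear -t1 h; lra].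
  subst i' t'; move: st; rewrite /strand p th.
  case=> [[-> ->]|[_ [[-> ->]|[y2 _]]]]; [left|right|by clear -y2 hy2 hX1; lra].
    by clear; split; lra.
  by clear; split; lra.
move=> h2; split => //; right; exists i, (X - i%:R).
split; [by apply/andP; split; clear -h hX1; lra|by ring|].
by rewrite /strand p th; case: h2 => [[-> ->]|[-> ->]]; [left|right; split => //; left]; clear; split; lra.
Qed.

(** Direction and sign separate the three passages through a column, and [F] recovers the position
    on the path from them. *)
Lemma piece_index m m' : pback q m = pback q m' -> pcol q m = pcol q m' ->
  pback q m || (pneg q m == pneg q m') -> m = m'.
Proof.
pose F b c s := let n := col_blk q c in let j := col_idx q c in
  if b then (pstart q n + ((q n).*2.+3 - j))%N else
  if j == 0%N then pstart q n else
  if s == odd j then (pstart q n + j)%N else (pstart q n + ((q n).*2.+2 + j))%N.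
have FP k : k = F (pback q k) (pcol q k) (pneg q k).
  rewrite /F; have [n|n j|n j b|n j] := pieceP q k => [|jn|jn|jn].
  - by rewrite -[cstart q n]addn0 col_blkE // col_idxE.
  - rewrite col_blkE ?col_idxE ?eqxx /csize; try lia.
    by case: eqP => //; lia.
  - by rewrite col_blkE ?col_idxE /csize; lia.
  - rewrite col_blkE ?col_idxE /csize; try lia.
    by rewrite ifF ?ifF //; [case: (odd j)|lia].
move=> eb ec es; rewrite (FP m) (FP m') -eb -ec.
by case: (pback q m) es => //= /eqP ->.
Qed.

Lemma back_run m : pback q m -> in_run q (pcol q m).
Proof.
have [n|n j|n j b|n j] := pieceP q m => //= jn _.
by rewrite in_runE ?/csize; lia.
Qed.

Lemma gap_piece m : ~~ in_run q (pcol q m) -> pneg q m.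
Proof.
have [n|n j|n j b|n j] := pieceP q m => //= jn; rewrite in_runE ?/csize; lia.
Qed.

Lemma piece_inj m t m' t' : 0 <= t < 1 -> 0 <= t' < 1 ->
  piece m t = piece m' t' -> m = m' /\ t = t'.
Proof.
move=> t01 t01'; have t01c : 0 <= t <= 1 by case/andP: t01 => -> /ltW ->.
have t01c' : 0 <= t' <= 1 by case/andP: t01' => -> /ltW ->.
have X0 := pX_ge0 q m t01c; have X0' := pX_ge0 q m' t01c'.
move=> /pt_inj[]; [lra|lra|].
wlog bb : m t m' t' t01 t01' t01c t01c' X0 X0' / pback q m ==> pback q m'.
  move=> wl eX eY eZ; have [bm|bm] := boolP (pback q m ==> pback q m'); first exact: wl.
  have bm2 : pback q m' ==> pback q m by move: bm; case: (pback q m); case: (pback q m').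
  by have [-> ->] := wl m' t' m t t01' t01 t01c' t01c X0' X0 bm2 (esym eX) (esym eY) (esym eZ).
move: bb; rewrite /pX /pY /pZ.
have [bm|bm] := boolP (pback q m); have [bm'|bm'] := boolP (pback q m') => //= _.
- move=> eX _ _; case/andP: t01 => t0 t1; case/andP: t01' => t0' t1'.
  have e : (pcol q m)%:R - t = (pcol q m')%:R - t' by lra.
  have [ec et] : pcol q m = pcol q m' /\ t = t'.
    have h1 : 0 <= 1 - t <= 1 by apply/andP; split; lra.
    have h2 : 0 <= 1 - t' <= 1 by apply/andP; split; lra.
    case: (nat_frac h1 h2 eX) => [[? ?]|[_ [? ?]]|[_ [? ?]]]; [split => //|..]; lra.
  by split => //; apply: piece_index; rewrite ?bm ?bm' ?ec.
(* Backward pieces have height at least 1 and forward ones at most 1, so both have height 1. As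
   [t' < 1], this is the right turn; as [t < 1], the forward piece then starts a gap, where its
   height is -1. *)
- move=> eX eY _; exfalso; case/andP: (t01') => t0' t1'.
  have h2 : 0 <= 1 - t' <= 1 by apply/andP; split; lra.
  have [p0 p1] := phi_bd (pcol q m) t01c; have [p0' p1'] := phi_bd (pcol q m') h2.
  have sp : psgn R q m * phi (pcol q m) t <= 1.
    by rewrite /psgn; case: ifP => _; lra.
  have /(phi_eq1 qodd (back_run bm') h2) : phi (pcol q m') (1 - t') = 1 by lra.
  case=> [[? _]|[t'0 nr]]; first lra.
  case: (nat_frac t01c h2 eX) => [[? ?]|[_ [? ?]]|[ec [tt0 ?]]].
  + by case/andP: t01; lra.
  + lra.
  have ng : ~~ in_run q (pcol q m) by rewrite ec; apply: run_last => //; exact: back_run.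
  have := eY; rewrite /psgn gap_piece //.
  have [-> _] := phi_gap t ng; lra.
- move=> eX; have [ec et] := nat_frac_inj t01 t01' eX; rewrite -ec -et => eY eZ.
  split => //; apply: piece_index; rewrite ?(negPf bm) ?(negPf bm') //=.
  apply/eqP; have [//|ne] := eqVneq (pneg q m) (pneg q m').
  exfalso; have sg : psgn R q m = - psgn R q m'.
    by rewrite /psgn; case: (pneg q m) (pneg q m') ne => [] []; rewrite ?opprK.
  have sn : psgn R q m' = 1 \/ psgn R q m' = -1 by rewrite /psgn; case: ifP; [right|left].
  rewrite sg in eY eZ.
  have p0 : phi (pcol q m) t = 0 by case: sn eY => -> ?; lra.
  have th0 : theta (pcol q m) t = 0 by case: sn eZ => -> ?; lra.
  case: (phi_eq0 t01c p0) => [[t0 l]|[t1 _]]; last by case/andP: t01; lra.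
  by move: th0; rewrite t0 theta0 l; lra.
Qed.

Lemma Gam_nonneg s : 0 <= s -> exists m t, [/\ 0 <= t < 1, s = m%:R + t & Gam s = piece m t].
Proof.
move=> s0; have /andP[h1 h2] := truncn_itv s0.
exists (Num.truncn s), (s - (Num.truncn s)%:R); split; last by rewrite /Gam ltNge s0.
  by rewrite -natr1 in h2; apply/andP; split; lra.
by ring.
Qed.

Lemma Gam_inj : injective Gam.
Proof.
have negpos s s' : s < 0 -> 0 <= s' -> Gam s = Gam s' -> False.
  move=> s0 s0' ; have [m [t [t01 es eG]]] := Gam_nonneg s0'.
  have t01c : 0 <= t <= 1 by case/andP: t01 => -> /ltW ->.
  rewrite eG (Gam_neg q (ltW s0)) => /pt_inj[||eX eY _].
  - lra.
  - by have := pX_ge0 q m t01c; lra.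
  have [t' [t01' _ st]] := @piece_strand R q m t t01c.
  have [y1 _ _] := strand_bounds t01' st.
  have rl : ret (- s) < -1 by apply: ret_lt; lra.
  lra.
move=> s s' e; have [s0|s0] := ltP s 0; have [s0'|s0'] := ltP s' 0.
- move: e; rewrite !(Gam_neg q) ?ltW // => /pt_inj[||e _ _]; lra.
- by case: (negpos s s').
- by case: (negpos s' s).
have [m [t [t01 es eG]]] := Gam_nonneg s0.
have [m' [t' [t01' es' eG']]] := Gam_nonneg s0'.
by move: e; rewrite eG eG' es es' => /(piece_inj t01 t01')[-> ->].
Qed.

Lemma pX_large N m t : (pstart q N <= m)%N -> 0 <= t <= 1 -> N%:R <= pX m t.
Proof.
move=> Nm t01; have /andP[h _] := pX_bounds q m t01; apply: le_trans h.
rewrite ler_nat; elim/(@path_ind q): m Nm => n r rn Nm.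
have Nn : (N <= n)%N.
  rewrite leqNgt; apply/negP => nN.
  by have := @block_start_mono (psize q) _ _ nN; rewrite -/(pstart q n) -/(pstart q N); lia.
apply: leq_trans Nn _; apply: leq_trans (leq_block_start (@csize_gt0 q) n) _.
by rewrite /pcol path_block // leq_addr.
Qed.

Lemma Gam_limit (e : R) : 0 < e -> exists2 S : R, 0 < S & forall s, S < `|s| ->
  [/\ `|cx (Gam s) - 1| < e, `|cy (Gam s)| < e & `|cz (Gam s)| < e].
Proof.
(* Heights and depths of the knot are at most 3 in absolute value, so 4 leaves a margin. *)
move=> e0; pose N := (Num.truncn (4 / e)).+1.
have Ne : 4 / e < N%:R by apply: truncnS_gt.
have NP X y z : N%:R <= X -> `|y| <= 3 -> `|z| <= 3 ->
   [/\ `|cx (pt X y z) - 1| < e, `|cy (pt X y z)| < e & `|cz (pt X y z)| < e].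
  move=> NX y3 z3; rewrite /pt !coordE.
  have ee : 0 < 4 / e by rewrite divr_gt0.
  have X1 : 0 < 1 + X by lra.
  rewrite ltr_pdivrMr // in Ne; have eN : e * N%:R <= e * X by rewrite ler_pM2l.
  have -> : X / (1 + X) - 1 = - (1 / (1 + X)) by field; rewrite gt_eqF.
  rewrite normrN !normrM normfV (gtr0_norm X1) normr1.
  by rewrite !ltr_pdivrMr //; split; lra.
exists (N%:R + (pstart q N)%:R) => [|s hs].
  by rewrite ltr_wpDr // ltr0n.
have p0 : 0 <= (pstart q N)%:R :> R by rewrite ler0n.
have [s0|s0] := ltP s 0.
  rewrite ltr0_norm // in hs; rewrite (Gam_neg q (ltW s0)) /return_pt.
  have [] := @ret_bounds (- s); first lra.
  move=> ? ?; apply: NP; [lra| |by rewrite normr0].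
  by rewrite ler_norml; apply/andP; split; lra.
rewrite ger0_norm // in hs.
have [m [t [t01 es ->]]] := Gam_nonneg s0.
have t01c : 0 <= t <= 1 by case/andP: t01 => -> /ltW ->.
have [t' [t01' _ st]] := @piece_strand R q m t t01c.
have [y1 y2 z1] := strand_bounds t01' st.
apply: NP; [|by rewrite ler_norml; apply/andP; split; lra|lra].
apply: pX_large => //; rewrite -ltnS -(ltr_nat R) -natr1.
have : 0 <= N%:R :> R by rewrite ler0n.
by case/andP: t01; lra.
Qed.

End Knot.

(** * Embedding and tameness *)

(** A closed subset of a compact space has a compact, hence closed image, which is the continuity of
    the inverse. *)
Lemma compact_embedding (T U : topologicalType) (e : T -> U) :
  compact [set: T] -> hausdorff_space U -> continuous e -> injective e ->
  embedding e.
Proof.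
move=> cT hU ec ei.
have eP x : e x \in range e by apply/mem_set; exists x.
pose h x : set_type (range e) := exist _ (e x) (eP x).
have gP (y : set_type (range e)) : exists x, e x = set_val y.
  by have [x _ xy] := set_mem (valP y); exists x.
have [g gE] := choice gP.
have hg : cancel h g by move=> x; apply: ei; rewrite gE.
have gh : cancel g h by move=> y; apply: val_inj; rewrite /= gE.
exists h => //; split; first exact: continuous_comp_initial.
exists g; split => // y V /=; rewrite nbhsE => -[B [oO Oy] OV].
have cD : compact (~` B).
  by apply: (subclosed_compact _ cT) => //; exact: open_closedC.
have cl : closed (e @` (~` B)).
  by apply: compact_closed => //; apply: continuous_compact => //; exact: continuous_subspaceT.
have W : nbhs (set_val y) (~` (e @` (~` B))).
  apply: open_nbhs_nbhs; split; first exact: closed_openC.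
  by move=> [x nOx xy]; apply: nOx; rewrite (_ : x = g y) //; apply: ei; rewrite gE.
have {}W : nbhs y (set_val @^-1` (~` (e @` (~` B)))).
  exact: (@initial_continuous _ _ (set_val : set_type (range e) -> U) y _ W).
apply: filterS W => y' ny; apply: OV; apply: contrapT => nO; apply: ny.
by exists (g y') => //; rewrite gE.
Qed.

Lemma compact_set_type (T : topologicalType) (A : set T) : compact A ->
  compact [set: set_type A].
Proof.
move=> cA F FF _.
pose f : set_type A -> T := set_val.
have FA : (f @ F) A.
  by rewrite /= nbhs_filterE; apply: filterS filterT => x _; exact: set_valP.
have [c [Ac cl]] := cA (f @ F) _ FA.
exists (exist _ c (mem_set Ac)); split => // P V FP.
rewrite nbhsE => -[B [[W oW WO] Oc] OV].
have FPf : (f @ F) (f @` P).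
  by rewrite /= nbhs_filterE; apply: filterS FP => x Px; exists x.
have Wc : nbhs c W.
  by apply: open_nbhs_nbhs; split => //; move: Oc; rewrite -WO.
have [_ [[x Px <-] Wx]] := cl _ _ FPf Wc.
by exists x; split => //; apply: OV; rewrite -WO.
Qed.

Lemma cont_div (R : realType) (T : topologicalType) (f g : T -> R) (x : T) :
  {for x, continuous f} -> {for x, continuous g} -> g x != 0 ->
  {for x, continuous (fun t => f t / g t)}.
Proof. by move=> fc gc gx; apply: cvgM => //; exact: cvgV. Qed.

Lemma cont_shear (R : realType) (T : topologicalType) (V : normedModType R)
  (f g : T -> V) (c : T -> R) (u : V) (s : R) : continuous f -> continuous g ->
  continuous c -> continuous (fun w => f w + s *: (g w - c w *: u)).
Proof.
move=> fc gc cc w; apply: cvgD; first exact: fc.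
apply: cvgZl_tmp; apply: cvgB; first exact: gc.
by apply: cvgZr_tmp; exact: cc.
Qed.

Section Circle.
Variable R : realType.

Definition cosx (w : S1 R) : R := (set_val w : 'rV[R]_2) 0 (@Ordinal 2 0 isT).
Definition siny (w : S1 R) : R := (set_val w : 'rV[R]_2) 0 (@Ordinal 2 1 isT).

Lemma ord2_ind (P : 'I_2 -> Prop) : P (@Ordinal 2 0 isT) ->
  P (@Ordinal 2 1 isT) -> forall i, P i.
Proof. by move=> P0 P1 [[|[|//]] h]; rewrite (bool_irrelevance h isT). Qed.

Lemma sum2 (f : 'I_2 -> R) : \sum_i f i = f (@Ordinal 2 0 isT) + f (@Ordinal 2 1 isT).
Proof.
by rewrite big_ord_recl big_ord1; congr (f _ + f _); apply: val_inj.
Qed.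

Lemma circleE (w : S1 R) : cosx w ^+ 2 + siny w ^+ 2 = 1.
Proof. by have := set_valP w; rewrite /circle /= sum2. Qed.

Lemma circle_eq (w w' : S1 R) : cosx w = cosx w' -> siny w = siny w' -> w = w'.
Proof. by move=> h1 h2; apply: val_inj; apply/rowP; apply: ord2_ind. Qed.

Lemma circle_ex (u v : R) : u ^+ 2 + v ^+ 2 = 1 ->
  exists w : S1 R, cosx w = u /\ siny w = v.
Proof.
move=> uv; pose x : 'rV[R]_2 := \row_i nth 0 [:: u; v] i.
have xP : x \in @circle R by apply/mem_set; rewrite /circle /= sum2 !mxE.
by exists (exist _ x xP); rewrite /cosx /siny /set_val /= !mxE.
Qed.

Lemma cosx_continuous : continuous cosx.
Proof.
move=> w; apply: (@continuous_comp _ _ _ (set_val : S1 R -> 'rV[R]_2) (fun x => x 0 _)).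
  exact: initial_continuous.
exact: coord_continuous.
Qed.

Lemma siny_continuous : continuous siny.
Proof.
move=> w; apply: (@continuous_comp _ _ _ (set_val : S1 R -> 'rV[R]_2) (fun x => x 0 _)).
  exact: initial_continuous.
exact: coord_continuous.
Qed.

Lemma compact_circle : compact [set: S1 R].
Proof.
apply: compact_set_type; apply: bounded_closed_compact.
  exists 1; split; first exact: num_real.
  move=> M M1 w /=; rewrite /circle /= sum2 => ww.
  have M0 : 0 <= M by apply: ltW; apply: lt_trans M1.
  rewrite [leLHS]/Num.norm /= mx_normrE.
  apply/bigmax_leP; split => // -[i j] _ /=; rewrite ord1.
  have h (a b : R) : a ^+ 2 + b ^+ 2 = 1 -> `|a| <= M.
    move=> ab; apply: le_trans (ltW M1); rewrite -(@ler_pXn2r _ 2) ?nnegrE //.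
    by rewrite real_normK ?num_real // expr1n; have := sqr_ge0 b; lra.
  by elim/ord2_ind: j; [exact: h ww|apply: h; rewrite addrC; exact: ww].
rewrite (_ : @circle R = (fun w : 'rV[R]_2 => w 0 (@Ordinal 2 0 isT) ^+ 2 +
   w 0 (@Ordinal 2 1 isT) ^+ 2) @^-1` [set 1]); last first.
  by apply/seteqP; split => w; rewrite /circle /= sum2.
apply: closed_comp; last exact: closed_eq.
move=> w _; apply: contD; under eq_fun do rewrite expr2; apply: contM;
  exact: coord_continuous.
Qed.

Lemma cosx_le1 w : cosx w <= 1.
Proof. by have := circleE w; have := sqr_ge0 (siny w); nra. Qed.

End Circle.

Section Embedding.
Variables (R : realType) (q : nat -> nat).
Hypothesis qodd : forall n, odd (q n).
Notation E := 'rV[R]_3.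
Notation Gam := (@Gam R q).

Definition knot_set : set E := [set w | w = limit_pt R \/ exists s, w = Gam s].

(** Stereographic projection from (1, 0), followed by the parametrisation by the line; the centre of
    projection goes to the limit point. *)
Definition knot_map (w : S1 R) : E :=
  if cosx w == 1 then limit_pt R else Gam (siny w / (1 - cosx w)).

Lemma Gam_lt1 s : cx (Gam s) < 1.
Proof.
have [X [y [z [k ->]]]] := @Gam_knot R q qodd s.
have [X0 _ _ _] := knot_bounds k; rewrite /pt !coordE ltr_pdivrMr; lra.
Qed.

Lemma range_knot_map : range knot_map = knot_set.
Proof.
apply/seteqP; split=> [_ [w _ <-]|_ [->|[s ->]]].
- by rewrite /knot_map; case: ifP => _; [left|right; exists (siny w / (1 - cosx w))].
- have [|w [w1 w2]] := @circle_ex R 1 0; first by rewrite expr0n expr1n addr0.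
  by exists w => //; rewrite /knot_map w1 eqxx.
have s1 : 0 < s ^+ 2 + 1 by have := sqr_ge0 s; lra.
(* Inverse stereographic projection. *)
have [|w [w1 w2]] := @circle_ex R ((s ^+ 2 - 1) / (s ^+ 2 + 1)) (2 * s / (s ^+ 2 + 1)).
  by field; rewrite gt_eqF.
exists w => //; rewrite /knot_map w1 w2.
have e : 1 - (s ^+ 2 - 1) / (s ^+ 2 + 1) = 2 / (s ^+ 2 + 1) by field; rewrite gt_eqF.
rewrite ifF; last by rewrite -subr_eq0 -oppr_eq0 opprB e; apply/negbTE; rewrite gt_eqF // divr_gt0.
by rewrite e; congr Gam; field; rewrite gt_eqF.
Qed.

Lemma knot_map_inj : injective knot_map.
Proof.
move=> w w'; have c := circleE w; have c' := circleE w'.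
have l1 := cosx_le1 w; have l1' := cosx_le1 w'.
rewrite /knot_map; case: eqP => [u1|/eqP u1]; case: eqP => [u1'|/eqP u1'].
- move=> _; apply: circle_eq; first by rewrite u1 u1'.
  have -> : siny w = 0 by apply/eqP; rewrite -sqrf_eq0; apply/eqP; move: c; rewrite u1 expr1n; lra.
  by apply/esym/eqP; rewrite -sqrf_eq0; apply/eqP; move: c'; rewrite u1' expr1n; lra.
- by move=> h; have := Gam_lt1 (siny w' / (1 - cosx w')); rewrite -h /limit_pt coordE ltxx.
- by move=> h; have := Gam_lt1 (siny w / (1 - cosx w)); rewrite h /limit_pt coordE ltxx.
move=> /(Gam_inj qodd) st.
have d0 : 1 - cosx w != 0 by rewrite subr_eq0 eq_sym.
have d0' : 1 - cosx w' != 0 by rewrite subr_eq0 eq_sym.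
set s := siny w / (1 - cosx w) in st.
have v : siny w = s * (1 - cosx w) by rewrite /s mulfVK.
have v' : siny w' = s * (1 - cosx w') by rewrite st mulfVK.
have sq u sv : u ^+ 2 + sv ^+ 2 = 1 -> sv = s * (1 - u) -> 1 - u != 0 ->
    1 + u = s ^+ 2 * (1 - u).
  move=> e1 e2 e3; apply: (mulIf e3); have : sv ^+ 2 = 1 - u ^+ 2 by lra.
  by rewrite e2 => e4; rewrite -[RHS]mulrA; move: e4; rewrite !expr2 => e4; nra.
have h := sq _ _ c v d0; have h' := sq _ _ c' v' d0'.
have uu : cosx w = cosx w'.
  have s1 : s ^+ 2 + 1 != 0 by rewrite gt_eqF //; have := sqr_ge0 s; lra.
  by apply: (mulfI s1); lra.
by apply: circle_eq => //; rewrite v v' uu.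
Qed.

Lemma knot_map_continuous : continuous knot_map.
Proof.
move=> w; have [u1|u1] := eqVneq (cosx w) 1; last first.
  have wc : {for w, continuous (fun w => Gam (siny w / (1 - cosx w)))}.
    apply: (@continuous_comp _ _ _ (fun w => siny w / (1 - cosx w)) Gam); last exact: Gam_continuous.
    apply: cont_div; last by rewrite subr_eq0 eq_sym.
      exact: siny_continuous.
    by apply: contB; [exact: contC|exact: cosx_continuous].
  have near1 : \forall x \near w, cosx x < 1.
    have : nbhs (cosx w) [set r | r < 1].
      by apply: open_nbhs_nbhs; split; [exact: open_lt|rewrite /= lt_neqAle u1 cosx_le1].
    by move=> /cosx_continuous.
  move=> V VV; change (\forall x \near w, V (knot_map x)).
  have V' : \forall x \near w, V (Gam (siny x / (1 - cosx x))).
    by apply: wc; move: VV; rewrite /knot_map (negPf u1).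
  by apply: filterS2 V' near1 => x Vx xl; rewrite /knot_map lt_eqF.
move=> V; rewrite {1}/knot_map u1 eqxx => /nbhs3P[d d0 dV].
have [S S0 SP] := @Gam_limit R q d d0.
(* A point of abscissa [u] projects to some [s] with [s ^ 2 = (1 + u) / (1 - u)], so abscissas this
   close to 1 give parameters beyond [S]. *)
have near1 : \forall x \near w, 1 - (S ^+ 2 + 1)^-1 < cosx x.
  have SS : 0 < S ^+ 2 + 1 by have := sqr_ge0 S; lra.
  apply: (@cosx_continuous R w [set r | 1 - (S ^+ 2 + 1)^-1 < r]).
  apply: open_nbhs_nbhs; split; first exact: open_gt.
  by rewrite /= u1 ltrBlDr ltrDl invr_gt0.
change (\forall x \near w, V (knot_map x)).
apply: filterS near1 => x xl; rewrite /= /knot_map.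
case: eqP => [x1|/eqP x1]; first by apply: dV; rewrite subrr normr0.
have c := circleE x; have l1 : cosx x < 1 by rewrite lt_neqAle x1 cosx_le1.
have SS : 0 < S ^+ 2 + 1 by have := sqr_ge0 S; lra.
have Sx : S < `|siny x / (1 - cosx x)|.
  have d1 : 0 < 1 - cosx x by lra.
  rewrite -(@ltr_pXn2r _ 2) ?nnegrE // ?(ltW S0) // real_normK ?num_real //.
  rewrite expr_div_n ltr_pdivlMr ?exprn_gt0 //.
  have l2 : (1 - cosx x) * (S ^+ 2 + 1) < 1.
    by rewrite -ltr_pdivlMr // div1r; lra.
  have -> : siny x ^+ 2 = (1 - cosx x) * (1 + cosx x) by rewrite -[siny x ^+ 2](addKr (cosx x ^+ 2)) c; ring.
  rewrite (_ : S ^+ 2 * (1 - cosx x) ^+ 2 = (1 - cosx x) * (S ^+ 2 * (1 - cosx x))); last by ring.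
  rewrite ltr_pM2l //; lra.
by have [h1 h2 h3] := SP _ Sx; apply: dV; rewrite /limit_pt !coordE ?subr0.
Qed.

Lemma knot_map_embedding : embedding knot_map.
Proof.
apply: compact_embedding.
- exact: compact_circle.
- exact: norm_hausdorff.
- exact: knot_map_continuous.
- exact: knot_map_inj.
Qed.

Lemma knot_set_compact : compact knot_set.
Proof.
rewrite -range_knot_map; apply: continuous_compact; last exact: compact_circle.
exact/continuous_subspaceT/knot_map_continuous.
Qed.

(** The rest of the knot is the image of a closed, hence compact, part of the circle. The arc [D] is
    written with cleared denominators, which excludes the centre of projection automatically. *)
Lemma arc_complement_closed (a b : R) :
  closed (knot_set `\` (Gam @` [set s | a < s < b])).
Proof.
pose D : set (S1 R) := [set w | 0 < siny w - a * (1 - cosx w)] `&`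
  [set w | 0 < b * (1 - cosx w) - siny w].
have lc (r : R) : continuous (fun w : S1 R => r * (1 - cosx w)).
  by apply: contM; [exact: contC|apply: contB; [exact: contC|exact: cosx_continuous]].
have oD : open D.
  by apply: openI; apply: open_pos; apply: contB => //; exact: siny_continuous.
have -> : knot_set `\` (Gam @` [set s | a < s < b]) = knot_map @` (~` D).
  have DP (w : S1 R) : cosx w != 1 -> D w <-> a < siny w / (1 - cosx w) < b.
    move=> u1; have d1 : 0 < 1 - cosx w.
      by rewrite subr_gt0 lt_neqAle u1 cosx_le1.
    rewrite /D /= ltr_pdivlMr // ltr_pdivrMr //; split; first by move=> [? ?]; apply/andP; split; lra.
    by move=> /andP[? ?]; split; lra.
  apply/seteqP; split=> x.
    rewrite -range_knot_map => -[[w _ <-] nG]; exists w => // Dw; apply: nG.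
    have u1 : cosx w != 1.
      by apply/eqP => u1; case: Dw; rewrite /= u1 subrr !mulr0; lra.
    rewrite /knot_map (negPf u1); exists (siny w / (1 - cosx w)) => //.
    exact/(DP _ u1).
  move=> [w nD <-]; split; first by rewrite -range_knot_map; exists w.
  move=> [s ab]; rewrite /knot_map; case: eqP => [_ h|/eqP u1 /(Gam_inj qodd) e].
    by have := Gam_lt1 s; rewrite h /limit_pt coordE ltxx.
  by apply: nD; apply/DP => //; rewrite -e.
apply: compact_closed; first exact: norm_hausdorff.
apply: continuous_compact; first exact/continuous_subspaceT/knot_map_continuous.
apply: (subclosed_compact _ (@compact_circle R)) => //; exact: open_closedC.
Qed.

End Embedding.

(** * Flattening monotone arcs *)

Section MonotoneArc.
Variable R : realType.

Definition increasing_on (a b : R) (f : R -> R) :=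
  forall s t, a <= s -> s < t -> t <= b -> f s < f t.

Lemma increasing_onU a c b f : increasing_on a c f -> increasing_on c b f ->
  increasing_on a b f.
Proof.
move=> h1 h2 s t as_ st tb; have [tc|ct] := leP t c; first exact: h1.
have [cs|sc] := leP c s; first exact: h2.
by apply: (lt_trans (y := f c)); [exact: h1|apply: h2].
Qed.

(** Clamping the argument to the range of [f] extends the inverse continuously to the whole line, as
    a homeomorphism of the whole space will need. *)
Lemma increasing_inverse (a b : R) (f : R -> R) : a < b -> continuous f ->
  increasing_on a b f ->
  exists2 k : R -> R, continuous k & forall s, a <= s <= b -> k (f s) = s.
Proof.
move=> ab fc fi; have fab : f a < f b by apply: fi.
pose r x := Num.min (f b) (Num.max (f a) x).
have rc : continuous r.
  apply: cont_min; first exact: contC.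
  by apply: cont_max; [exact: contC|move=> x; exact: cvg_id].
have rP x : f a <= r x <= f b.
  by rewrite /r le_min ge_min lexx (ltW fab) le_max lexx.
have [k kP] : {k : R -> R | forall x, a <= k x <= b /\ f (k x) = r x}.
  have h x : exists s, a <= s <= b /\ f s = r x.
    have [||s sab fs] := @IVT R f a b (r x) (ltW ab).
    - exact/continuous_subspaceT.
    - by rewrite min_l ?max_r ?(ltW fab).
    - by exists s; split => //; move: sab; rewrite in_itv.
  by apply: cid; have [k kP] := choice h; exists k.
have fle s t : a <= s -> t <= b -> s <= t -> f s <= f t.
  move=> as_ tb; rewrite le_eqVlt => /orP[/eqP -> //|st].
  by apply: ltW; exact: fi.
exists k.
  move=> x; have [/andP[ka kb] fk] := kP x.
  move=> V /nbhs_ballP[e /= e0 eV].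
  have h1 : \forall y \near x, k x + e / 2 <= b -> r y < f (k x + e / 2).
    have [kb'|kb'] := leP (k x + e / 2) b; last first.
      by apply: filterE => y.
    have h : \forall y \near x, r y < f (k x + e / 2).
      apply: (rc x [set z | z < f (k x + e / 2)]).
      apply: open_nbhs_nbhs; split; first exact: open_lt.
      by rewrite /= -fk; apply: fi => //; lra.
    by apply: filterS h => y hy _.
  have h2 : \forall y \near x, a <= k x - e / 2 -> f (k x - e / 2) < r y.
    have [ka'|ka'] := leP a (k x - e / 2); last first.
      by apply: filterE => y.
    have h : \forall y \near x, f (k x - e / 2) < r y.
      apply: (rc x [set z | f (k x - e / 2) < z]).
      apply: open_nbhs_nbhs; split; first exact: open_gt.
      by rewrite /= -fk; apply: fi => //; lra.
    by apply: filterS h => y hy _.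
  apply: filterS2 h1 h2 => y y1 y2; apply: eV.
  have [/andP[ya yb] fy] := kP y.
  rewrite -ball_normE /= ltr_norml; apply/andP; split.
    rewrite ltNge; apply/negP => h.
    have hb : k x + e / 2 <= b by lra.
    have h' : k x + e / 2 <= k y by lra.
    have ha : a <= k x + e / 2 by lra.
    have := fle _ _ ha yb h'; rewrite fy => h3.
    by move: (lt_le_trans (y1 hb) h3); rewrite ltxx.
  rewrite ltNge; apply/negP => h.
  have hb : a <= k x - e / 2 by lra.
  have h' : k y <= k x - e / 2 by lra.
  have ha : k x - e / 2 <= b by lra.
  have := fle _ _ ya ha h'; rewrite fy => h3.
  by move: (lt_le_trans (y2 hb) h3); rewrite ltxx.
move=> s /andP[as_ sb]; have [/andP[ka kb] fk] := kP (f s).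
have rs : r (f s) = f s.
  rewrite /r (max_r (fle _ _ (lexx _) sb as_)) min_r //.
  exact: fle.
rewrite rs in fk; have [h|h|//] := ltgtP (k (f s)) s.
- by have := fi _ _ ka h sb; rewrite fk ltxx.
- by have := fi _ _ as_ h kb; rewrite fk ltxx.
Qed.

End MonotoneArc.

Section TameArc.
Variables (R : realType) (q : nat -> nat).
Hypothesis qodd : forall n, odd (q n).
Notation E := 'rV[R]_3.
Notation Gam := (@Gam R q).

(* An arc on which a linear functional [l] is monotone is a graph over [l], so
   that a shear flattens it. *)
Lemma monotone_tame (l : R * R * R) (u : E) (a b s0 : R) : lin l u = 1 ->
  a < s0 -> s0 < b -> increasing_on a b (fun s => lin l (Gam s)) ->
  tame_at (knot_set q) (Gam s0).
Proof.
move=> lu as0 s0b inc; have ab : a < b by exact: lt_trans s0b.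
have Gc := @Gam_continuous R q qodd.
have fc : continuous (fun s => lin l (Gam s)).
  move=> s; apply: (@continuous_comp _ _ _ Gam (lin l)); first exact: Gc.
  exact: lin_continuous.
have [k kc kK] := increasing_inverse ab fc inc.
pose psi (w : E) : E := Gam (k (lin l w)).
have psic : continuous psi.
  move=> w; apply: (@continuous_comp _ _ _ (lin l) (Gam \o k)); first exact: lin_continuous.
  by apply: (@continuous_comp _ _ _ k Gam); [exact: kc|exact: Gc].
(* The displacement is the deviation of the arc from the line of direction [u]. It lies in the
   kernel of [l] and depends on [lin l w] only, so the opposite shear is the inverse. *)
pose sh (s : R) (w : E) : E := w + s *: (psi w - lin l (psi w) *: u).
have lsh s w : lin l (sh s w) = lin l w.
  by rewrite /sh lin_add lin_scale lin_add -scaleNr lin_scale lu; ring.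
have shc s : continuous (sh s).
  apply: (@cont_shear R E E id psi (fun w => lin l (psi w)) u s).
  - by move=> w; exact: cvg_id.
  - exact: psic.
  - move=> w; apply: (@continuous_comp _ _ _ psi (lin l)); first exact: psic.
    exact: lin_continuous.
have shK s : cancel (sh s) (sh (- s)).
  by move=> w; rewrite {1}/sh /psi lsh -/(psi w) scaleNr addrK.
(* The complement of the rest of the knot with both ends of the arc added: it meets the knot in
   exactly the closed arc, which the shear maps to a closed segment. *)
exists (~` (knot_set q `\` (Gam @` [set s | a < s < b])) `|` Gam @` [set s | a <= s <= b]).
split.
  apply: (@filterS _ _ _ (~` (knot_set q `\` (Gam @` [set s | a < s < b])))).
    by move=> x; left.
  apply: open_nbhs_nbhs; split; first exact/closed_openC/arc_complement_closed.
  by case=> _; apply; exists s0 => //=; rewrite as0.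
exists (sh (-1)).
  split; first exact: shc.
  by exists (sh 1); split; [exact: shc|rewrite -{2}[1]opprK; exact: shK|exact: shK].
exists (lin l (Gam a) *: u), (lin l (Gam b) *: u).
have fab : lin l (Gam a) < lin l (Gam b) by apply: inc.
have u0 : u != 0.
  by apply: contra_eq_neq lu => ->; rewrite /lin /cx /cy /cz !mxE !mulr0 !addr0 eq_sym oner_eq0.
split.
  by rewrite -subr_eq0 -scalerBl scaler_eq0 (negPf u0) orbF subr_eq0 lt_eqF.
have shG s : a <= s <= b -> sh (-1) (Gam s) = lin l (Gam s) *: u.
  by move=> sab; rewrite /sh /psi kK // scaleN1r opprB addrCA subrr addr0.
have -> : (~` (knot_set q `\` Gam @` [set s | a < s < b]) `|` Gam @` [set s | a <= s <= b]) `&` knot_set q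
   = Gam @` [set s | a <= s <= b].
  apply/seteqP; split=> x.
    case=> [[nK|//] Kx]; apply: contrapT => nG; apply: nK; split => //.
    by move=> [s /andP[h1 h2] xs]; apply: nG; exists s => //=; rewrite !ltW.
  by move=> xG; split; [right|case: xG => s _ <-; right; exists s].
apply/seteqP; split=> x.
  move=> [_ [s sab <-] <-]; rewrite shG //.
  have d0 : 0 < lin l (Gam b) - lin l (Gam a) by rewrite subr_gt0.
  exists ((lin l (Gam s) - lin l (Gam a)) / (lin l (Gam b) - lin l (Gam a))).
    case/andP: sab => s1 s2.
    have m1 : lin l (Gam a) <= lin l (Gam s).
      by move: s1; rewrite le_eqVlt => /orP[/eqP -> //|?]; apply/ltW/inc.
    have m2 : lin l (Gam s) <= lin l (Gam b).
      by move: s2; rewrite le_eqVlt => /orP[/eqP -> //|?]; apply/ltW/inc.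
    rewrite /= in_itv /= divr_ge0 ?subr_ge0 //=; last exact: ltW.
    by rewrite ler_pdivrMr // mul1r lerD2r.
  by rewrite -scalerBl scalerA mulfVK ?gt_eqF // -scalerDl addrC subrK.
move=> [t /=]; rewrite in_itv /= => /andP[t0 t1] <-.
have [||s sab fs] := @IVT R (fun s => lin l (Gam s)) a b (lin l (Gam a) + t * (lin l (Gam b) - lin l (Gam a))) (ltW ab).
- exact: (continuous_subspaceT fc).
- by rewrite min_l ?max_r ?(ltW fab) //; apply/andP; split; nra.
move: sab; rewrite in_itv /= => sab.
exists (Gam s); first by exists s.
by rewrite shG // fs -scalerBl scalerA -scalerDl.
Qed.

Lemma ltr_frac (a b c d : R) : 0 < b -> 0 < d -> a * d < c * b -> a / b < c / d.
Proof. by move=> b0 d0 h; rewrite ltr_pdivrMr // mulrAC ltr_pdivlMr. Qed.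

Lemma frac_mono (X X' : R) : 0 <= X -> X < X' -> X / (1 + X) < X' / (1 + X').
Proof. by move=> X0 XX; apply: ltr_frac; lra. Qed.

Lemma linx w : lin (1, 0, 0) w = cx w :> R. Proof. by rewrite /lin /=; ring. Qed.
Lemma linNx w : lin (-1, 0, 0) w = - cx w :> R. Proof. by rewrite /lin /=; ring. Qed.
Lemma liny w : lin (0, 1, 0) w = cy w :> R. Proof. by rewrite /lin /=; ring. Qed.
Lemma linNy w : lin (0, -1, 0) w = - cy w :> R. Proof. by rewrite /lin /=; ring. Qed.

Lemma increasing_piece m (f : E -> R) :
  (forall t t', 0 <= t -> t < t' -> t' <= 1 -> f (piece q m t) < f (piece q m t')) ->
  increasing_on m%:R m.+1%:R (fun s => f (Gam s)).
Proof.
move=> h s t ms st tm; rewrite -natr1 in tm.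
rewrite !(@Gam_itv R q qodd m); first by apply: h; lra.
- by rewrite -natr1; apply/andP; split; lra.
- by rewrite -natr1; apply/andP; split; lra.
Qed.

Lemma piece_cx_forward m : ~~ pback q m ->
  increasing_on m%:R m.+1%:R (fun s => lin (1, 0, 0) (Gam s)).
Proof.
move=> bm; apply: increasing_piece => t t' t0 tt t1; rewrite !linx !coordE.
by rewrite /pX (negPf bm); apply: frac_mono; have := ler0n R (pcol q m); lra.
Qed.

Lemma piece_cx_backward m : pback q m ->
  increasing_on m%:R m.+1%:R (fun s => lin (-1, 0, 0) (Gam s)).
Proof.
move=> bm; apply: increasing_piece => t t' t0 tt t1; rewrite !linNx !coordE ltrN2.
by rewrite /pX bm; apply: frac_mono; have := ler0n R (pcol q m); lra.
Qed.

Lemma piece_turn m : [\/ pback q m = pback q m.+1,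
  exists n, m = (pstart q n + (q n).+1)%N |
  exists n, m = (pstart q n + ((q n).*2.+3 - 1))%N].
Proof.
elim/(@path_ind q): m => n r rn.
have [->|r1] := eqVneq r (q n).+1; first by apply: Or32; exists n.
have [->|r2] := eqVneq r ((q n).*2.+3 - 1)%N; first by apply: Or33; exists n.
apply: Or31; rewrite /pback path_block //.
have [h|h] := ltnP r.+1 (psize q n).
  by rewrite -addnS path_block //; lia.
have -> : (pstart q n + r).+1 = pstart q n.+1 by rewrite pstartS; move: rn h; rewrite /psize; lia.
rewrite -[pstart q n.+1]addn0 path_block ?psize_gt0 //.
by move: rn h; rewrite /psize; lia.
Qed.

(** The direction of [X] is reversed here, but the height keeps growing, from [t] on the first piece
    to [1 + t] on the second, and still does after division by [1 + X]. *)
Lemma right_turn n : let m := (pstart q n + (q n).+1)%N in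
  increasing_on m%:R m.+2%:R (fun s => lin (0, 1, 0) (Gam s)).
Proof.
move=> m; have [|p1 p2 p3] := @piece_P q n (q n).+1; first lia.
have [|p4 p5] := @piece_R q n (q n).+1; first lia.
rewrite (_ : (pstart q n + ((q n).*2.+3 - (q n).+1) = m.+1)%N) in p4 p5; last by rewrite /m; lia.
set c := (cstart q n + (q n).+1)%N in p2 p5.
have ph t : 0 <= t -> t <= 1 -> phi q c t = t :> R.
  move=> t0 t1; rewrite /phi lcrossE ?rcrossE /csize; try lia.
  have q0 : (0 < q n)%N by have := qodd n; case: (q n).
  by rewrite ifT ?ifF; [rewrite min_l|lia|lia].
have c0 : 0 <= c%:R :> R by rewrite ler0n.
apply: (@increasing_onU _ _ m.+1%:R); apply: increasing_piece => t t' t0 tt t1;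
  rewrite !liny !coordE.
  rewrite /pY /pX /psgn -/m in p1 p2 p3 *; rewrite p1 p2 p3 /= qodd /= !ph; try lra.
  by rewrite !mul1r; apply: ltr_frac; nra.
rewrite /pY /pX p4 p5 !ph; try lra.
by apply: ltr_frac; nra.
Qed.

Lemma left_turn n : let m := (pstart q n + ((q n).*2.+3 - 1))%N in
  increasing_on m%:R m.+2%:R (fun s => lin (0, -1, 0) (Gam s)).
Proof.
move=> m; have [|p1 p2] := @piece_R q n 1; first lia.
have [|p4 p5 p6] := @piece_Q q n 1; first lia.
rewrite -/m in p1 p2.
rewrite (_ : (pstart q n + ((q n).*2.+2 + 1) = m.+1)%N) in p4 p5 p6; last by rewrite /m; lia.
set c := (cstart q n + 1)%N in p2 p5.
have ph t : 0 <= t -> t <= 1 -> phi q c t = 1 - t :> R.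
  move=> t0 t1; rewrite /phi lcrossE ?rcrossE /csize; try lia.
  have q0 : (0 < q n)%N by have := qodd n; case: (q n).
  by rewrite ltnn /= q0 min_r //; lra.
(* The gap before the run yields this bound; the projected height [(2 - t) / (c + 2 - t)] is
   strictly decreasing because [c] is positive. *)
have c0 : 1 <= c%:R :> R by rewrite /c natrD lerDr ler0n.
apply: (@increasing_onU _ _ m.+1%:R); apply: increasing_piece => t t' t0 tt t1;
  rewrite !linNy !coordE ltrN2.
  rewrite /pY /pX p1 p2 !ph; try lra.
  by apply: ltr_frac; nra.
rewrite /pY /pX /psgn p4 p5 p6 /= !ph; try lra.
by rewrite !mul1r; apply: ltr_frac; nra.
Qed.

(** The projected height of the return arc is [- (1 + 3 X) / (1 + X) ^ 2], which is monotone for [X]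
    up to 1/3; the left end -1/4 stays within this range. *)
Lemma start_turn : increasing_on (- (1 / 4)) 1 (fun s => lin (0, 1, 0) (Gam s)).
Proof.
apply: (@increasing_onU _ _ 0).
  move=> s t s0 st t0; rewrite !liny !(Gam_neg q) //; last by lra.
  rewrite /return_pt !coordE /ret !mulNr ltrN2.
  have h X : 0 <= X -> (1 + 3 * X) / (1 + X) / (1 + X) = (1 + 3 * X) / ((1 + X) * (1 + X)) :> R.
    by move=> X0; field; rewrite gt_eqF //; lra.
  rewrite !h; try lra.
  set X := - t; set X' := - s; have X0 : 0 <= X by rewrite /X; lra.
  have XX : X < X' by rewrite /X /X'; lra.
  have X1 : X' <= 1 / 4 by rewrite /X'; lra.
  apply: ltr_frac; [nra|nra|rewrite -subr_gt0].
  rewrite (_ : _ - _ = (X' - X) * (1 - X - X' - 3 * (X * X'))); last by ring.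
  by rewrite mulr_gt0 ?subr_gt0 //; nra.
have [p1 p2 p3] := piece_gap q 0.
apply: (@increasing_piece 0) => t t' t0 tt t1; rewrite !liny !coordE.
have ng : ~~ in_run q (cstart q 0) by rewrite -[cstart q 0]addn0 in_runE.
rewrite /pY /pX /psgn p1 p2 p3.
have [-> _] := phi_gap t ng; have [-> _] := phi_gap t' ng.
by rewrite /= add0r; apply: ltr_frac; lra.
Qed.

(** Around every parameter the first coordinate is monotone, except at the turns and at the start,
    where the second one is. *)
Theorem knot_tame s : tame_at (knot_set q) (Gam s).
Proof.
have l1 : lin (1, 0, 0) (vec3 1 0 0) = 1 :> R by rewrite linx coordE.
have l2 : lin (-1, 0, 0) (vec3 (-1) 0 0) = 1 :> R by rewrite linNx coordE opprK.
have l3 : lin (0, 1, 0) (vec3 0 1 0) = 1 :> R by rewrite liny coordE.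
have l4 : lin (0, -1, 0) (vec3 0 (-1) 0) = 1 :> R by rewrite linNy coordE opprK.
have [s0|s0|->] := ltgtP s 0; last 1 first.
- by apply: (monotone_tame l3 _ _ start_turn); lra.
- apply: (@monotone_tame _ _ (s - 1) 0 s l2) => //; first lra.
  move=> t t' t0 tt t1; rewrite !linNx !(Gam_neg q) //; last by lra.
  by rewrite /return_pt !coordE ltrN2; apply: frac_mono; lra.
have [m /andP[m1]] := Gam_cases s0.
rewrite le_eqVlt => /orP[/eqP es|m2]; last first.
  have [bm|bm] := boolP (pback q m).
    exact: (monotone_tame l2 m1 m2 (piece_cx_backward bm)).
  exact: (monotone_tame l1 m1 m2 (piece_cx_forward bm)).
have m2 : s < m.+2%:R by rewrite es ltr_nat.
have [e|[n en]|[n en]] := piece_turn m.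
- have [bm|bm] := boolP (pback q m).
    apply: (monotone_tame l2 m1 m2 (increasing_onU (piece_cx_backward bm) _)).
    by apply: piece_cx_backward; rewrite -e.
  apply: (monotone_tame l1 m1 m2 (increasing_onU (piece_cx_forward bm) _)).
  by apply: piece_cx_forward; rewrite -e.
- apply: (monotone_tame l3 m1 m2); rewrite en; exact: right_turn.
- apply: (monotone_tame l4 m1 m2); rewrite en; exact: left_turn.
Qed.

End TameArc.

(** * Dihedral local systems *)

Section InverseCoordinates.
Variables (R : realType) (q : nat -> nat).
Hypothesis qodd : forall n, odd (q n).
Notation E := 'rV[R]_3.
Notation K := (@knot_set R q).
Notation knot := (@knot R q).
Notation strand := (@strand R q).
Notation phi := (@phi R q).

(* The coordinates of [pt] on the half-space [cx w < 1]. *)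
Definition Xc (w : E) : R := cx w / (1 - cx w).
Definition Yc (w : E) : R := cy w / (1 - cx w).
Definition Zc (w : E) : R := cz w / (1 - cx w).

Lemma pt_coord w : cx w < 1 -> -1 < Xc w /\ pt (Xc w) (Yc w) (Zc w) = w.
Proof.
move=> w1; have d0 : 0 < 1 - cx w by lra.
have e : 1 + Xc w = (1 - cx w)^-1 by rewrite /Xc; field; rewrite gt_eqF.
have h0 : 0 < 1 + Xc w by rewrite e invr_gt0.
split; first lra.
by apply: vec3_eq; rewrite /pt !coordE e invrK /Xc /Yc /Zc mulfVK // gt_eqF.
Qed.

Lemma coord_pt X y z : -1 < X -> [/\ cx (pt X y z) < 1, Xc (pt X y z) = X,
  Yc (pt X y z) = y & Zc (pt X y z) = z].
Proof.
move=> X1; have d : 0 < 1 + X by lra.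
have e : 1 - X / (1 + X) = (1 + X)^-1 by field; rewrite gt_eqF.
split; first by rewrite /pt coordE ltr_pdivrMr //; lra.
- by rewrite /Xc /pt !coordE e invrK mulfVK // gt_eqF.
- by rewrite /Yc /pt !coordE e invrK mulfVK // gt_eqF.
- by rewrite /Zc /pt !coordE e invrK mulfVK // gt_eqF.
Qed.

Lemma coord_continuous_at (w : E) : cx w < 1 -> [/\ {for w, continuous Xc},
  {for w, continuous Yc} & {for w, continuous Zc}].
Proof.
move=> w1; have n0 : 1 - cx w != 0 by rewrite gt_eqF //; lra.
have dc : {for w, continuous (fun w : E => 1 - cx w)}.
  by apply: contB; [exact: contC|exact: cx_continuous].
by split; apply: cont_div => //; [exact: cx_continuous|exact: cy_continuous|exact: cz_continuous].
Qed.

Lemma knot_setP w : cx w < 1 -> K w <-> knot (Xc w) (Yc w) (Zc w).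
Proof.
move=> w1; have [X1 ew] := pt_coord w1; split; last first.
  by move=> /(knot_Gam qodd)[s es]; right; exists s; rewrite es ew.
case=> [e|[s es]]; first by rewrite e /limit_pt coordE ltxx in w1.
have [X [y [z [k eG]]]] := Gam_knot qodd s.
have [X0 _ _ _] := knot_bounds k.
have [|_ h1 h2 h3] := @coord_pt X y z; first lra.
by rewrite es eG h1 h2 h3.
Qed.

Lemma knot_set_pt X y z : knot X y z -> K (pt X y z).
Proof. by move=> /(knot_Gam qodd)[s es]; right; exists s. Qed.

Lemma knot_set_ge1 w : 1 <= cx w -> K w -> w = limit_pt R.
Proof.
by move=> w1 [//|[s es]]; have := Gam_lt1 qodd s; rewrite -es ltNge w1.
Qed.

Lemma same_vertical (w k : E) : cx w < 1 -> cx k = cx w -> cy k = cy w ->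
  Xc k = Xc w /\ Yc k = Yc w.
Proof. by move=> w1 hx hy; rewrite /Xc /Yc hx hy. Qed.

Definition over_free (w : E) := forall z, ~ K (vec3 (cx w) (cy w) z).

Lemma above_below_free w : above K 1 w -> above K (-1) w -> over_free w.
Proof.
move=> h1 h2 z Kz; have := h1 _ Kz; have := h2 _ Kz; rewrite !coordE.
by move=> /(_ erefl erefl) ? /(_ erefl erefl) ?; lra.
Qed.

Lemma free_knot w z : cx w < 1 -> over_free w -> ~ knot (Xc w) (Yc w) z.
Proof.
move=> w1 f k; have [X1 ew] := pt_coord w1.
apply: (f (cz (pt (Xc w) (Yc w) z))).
have -> : vec3 (cx w) (cy w) (cz (pt (Xc w) (Yc w) z)) = pt (Xc w) (Yc w) z.
  by apply: vec3_eq; rewrite !coordE // -[in LHS]ew !coordE.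
exact: knot_set_pt.
Qed.

Lemma aboveP w (s : R) : cx w < 1 -> s != 0 ->
  above K s w <-> forall z, knot (Xc w) (Yc w) z -> s * z < s * Zc w.
Proof.
move=> w1 s0; have [X1 ew] := pt_coord w1; have d : 0 < (1 - cx w)^-1 by rewrite invr_gt0; lra.
split=> [h z k|h k Kk hx hy].
  have e : pt (Xc w) (Yc w) z = vec3 (cx w) (cy w) (cz (pt (Xc w) (Yc w) z)).
    by apply: vec3_eq; rewrite !coordE // -[in RHS]ew !coordE.
  have := h _ (knot_set_pt k); rewrite {1 2}e !coordE => /(_ erefl erefl).
  rewrite -[in X in _ < X]ew !coordE !mulrA ltr_pM2r // invr_gt0; lra.
have k1 : cx k < 1 by rewrite hx.
have [hX hY] := same_vertical w1 hx hy.
have := Kk; rewrite knot_setP // hX hY => /h.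
by rewrite /Zc hx !mulrA ltr_pM2r.
Qed.

(** Such a point has knot points on both sides of it on its vertical line, so it lies over a double
    point of the diagram. *)
Lemma between_crossing w : ~ K w -> ~ above K 1 w -> ~ above K (-1) w ->
  [/\ cx w < 1, Yc w = 0, `|Zc w| < 1 / 2 &
   exists i, Xc w = i%:R /\ lcross q i].
Proof.
move=> nK nF nB; have [w1|w1] := ltP (cx w) 1; last first.
  exfalso; apply: nF => k Kk hx hy; have k1 : 1 <= cx k by rewrite hx.
  have ek := knot_set_ge1 k1 Kk.
  have [//|h] := ltP (1 * cz k) (1 * cz w); exfalso; apply: nB => k' Kk' hx' hy'.
  have k1' : 1 <= cx k' by rewrite hx'.
  have ek' := knot_set_ge1 k1' Kk'.
  rewrite !mulN1r ltrN2 lt_neqAle; apply/andP; split.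
    apply/eqP => ez; apply: nK; rewrite (_ : w = k') //.
    by apply: vec3_eq.
  by move: h; rewrite !mul1r ek ek'.
have ex s : s != 0 -> ~ above K s w -> exists z, knot (Xc w) (Yc w) z /\ s * Zc w <= s * z.
  move=> s0 ns; apply: contrapT => no; apply: ns; apply/aboveP => // z k.
  by rewrite ltNge; apply/negP => h; apply: no; exists z.
have nk : ~ knot (Xc w) (Yc w) (Zc w) by rewrite -knot_setP.
have [z1 [k1]] := ex 1 (oner_neq0 _) nF; rewrite !mul1r => h1.
have [|z2 [k2]] := ex (-1) _ nB; first by rewrite oppr_eq0 oner_neq0.
rewrite !mulN1r lerN2 => h2.
have l1 : Zc w < z1.
  by rewrite lt_neqAle h1 andbT; apply/eqP => e; apply: nk; rewrite e.
have l2 : z2 < Zc w.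
  by rewrite lt_neqAle h2 andbT; apply/eqP => e; apply: nk; rewrite -e.
have [i [eX l ey e1 e2]] := knot_two_over k2 k1 (lt_trans l2 l1).
split => //; last by exists i.
by rewrite ltr_norml; apply/andP; split; lra.
Qed.

Lemma lt_stable (g : R -> R) (t y : R) : {for t, continuous g} -> y != g t ->
  exists2 e : R, 0 < e & forall t' y', `|t' - t| < e -> `|y' - y| < e ->
    (y' < g t') = (y < g t).
Proof.
move=> gc yg; pose d := `|y - g t| / 2.
have d0 : 0 < d by rewrite divr_gt0 // normr_gt0 subr_eq0.
have : \forall s \near t, ball (g t) d (g s) by apply: gc; exact: nbhsx_ballx.
move=> /nbhs_ballP[e /= e0 eP]; exists (Num.min e d) => [|t' y']; first by rewrite lt_min e0.
rewrite !lt_min => /andP[te _] /andP[_]; rewrite ltr_norml => /andP[y1 y2].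
have : ball (g t) d (g t') by apply: eP; rewrite -ball_normE /= distrC.
rewrite -ball_normE /= ltr_norml => /andP[g1 g2].
rewrite /d in y1 y2 g1 g2; have [h|h|h] := ltgtP y (g t).
- by rewrite ltr0_norm in y1 y2 g1 g2; lra.
- by rewrite gtr0_norm in y1 y2 g1 g2; lra.
- by rewrite h eqxx in yg.
Qed.

End InverseCoordinates.

Lemma col_succ q i :
  [/\ col_blk q i.+1 = col_blk q i, col_idx q i.+1 = (col_idx q i).+1 &
    (col_idx q i <= q (col_blk q i))%N] \/
  [/\ col_idx q i = (q (col_blk q i)).+1 & col_idx q i.+1 = 0%N].
Proof.
have [_ h] := block_ofP (csize_gt0 q) i.
rewrite /col_blk /col_idx /=; move: h; rewrite /csize; case: ifP => /= h1 h2.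
  by left; split => //; lia.
by right; split => //; lia.
Qed.

Section Labels.
Variables (R : realType) (q : nat -> nat).
Hypothesis qodd : forall n, odd (q n).
Variables (G : groupType) (a : G) (h : nat -> G).
Hypothesis ahq : forall n, ((a * h n) ^+ q n = 1)%g.
Notation E := 'rV[R]_3.
Notation K := (@knot_set R q).
Notation knot := (@knot R q).
Notation phi := (@phi R q).

Definition run_label i : G := h (col_blk q i).
Definition mid_label i : G := ((a * run_label i) ^+ (col_idx q i).-1)%g.

(* Transition element of a torsor between the front and the back of the
   diagram, as a function on the complementary regions of the diagram. *)
Definition col_label i (t y : R) : G :=
  if y < ret (i%:R + t) then 1%g else
  if y < - phi i t then a else
  if ~~ in_run q i then 1%g else
  if y < phi i t then mid_label i else
  if y < 2 - phi i t then run_label i else 1%g.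

Definition plane_label (X y : R) : G :=
  if X < 0 then 1%g else col_label (Num.truncn X) (X - (Num.truncn X)%:R) y.

Definition label (w : E) : G :=
  if cx w < 1 then plane_label (Xc w) (Yc w) else 1%g.

(** The relation [ahq] enters at the right end of a run: the last bigon opens into the gap, so its
    label [(a * h n) ^+ q n] has to be the outer label 1. *)
Lemma col_label_match i y : col_label i 1 y = col_label i.+1 0 y.
Proof.
rewrite /col_label addr0 natr1; have [<- _] := col_match R q i.
case: ifP => // _; case: ifP => // y1; have := rcross_lcrossS q i.
rewrite /in_run phi1 /rcross /mid_label /run_label.
have [[e1 e2 e3]|[e1 e2]] := col_succ q i.
  rewrite e1 e2 e3 andbT; have [e0|e0] := posnP (col_idx q i).
    rewrite e0 /= expg0 => _; rewrite (_ : 2 - 1 = 1 :> R) ?if_same //; last by lra.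
    by case: (y < 1).
  move=> _; rewrite /=; move: y1; rewrite phi1 /rcross e0 e3 /= oppr0 => ->.
  by [].
rewrite e1 e2 /= ltnn => _ /=.
rewrite ahq (_ : 2 - 1 = 1 :> R); last by lra.
by case: (y < 1).
Qed.

(** Beyond height 3 only the outer region remains. Near a point of the plane [cx w = 1] with
    [cy w != 0] the heights [Yc] are that large, so [label] is 1 on both sides of this plane. *)
Lemma plane_label_far X y : 3 < `|y| -> plane_label X y = 1%g.
Proof.
move=> y3; rewrite /plane_label; case: ifP => // X0.
have /truncn_itv/andP[h1 h2] : 0 <= X by rewrite leNgt X0.
set i := Num.truncn X in h1 h2 *; set t := X - _.
have t01 : 0 <= t <= 1 by rewrite -natr1 in h2; rewrite /t; apply/andP; split; lra.
have [p0 p1] := phi_bd q i t01.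
have X0' : 0 <= i%:R + t by case/andP: t01; have := ler0n R i; lra.
have [r1 r2] := ret_bounds X0'; rewrite /col_label.
have [y0|y0] := leP 0 y.
  rewrite ger0_norm // in y3.
  case: ifP => // _; case: ifP => [?|_]; first by exfalso; lra.
  case: ifP => // _; case: ifP => [?|_]; first by exfalso; lra.
  by case: ifP => [?|//]; exfalso; lra.
rewrite ltr0_norm // in y3.
by rewrite ifT //; lra.
Qed.

Lemma col_label_stable i t y : 0 <= t <= 1 ->
  (forall z, ~ knot (i%:R + t) y z) ->
  exists2 e : R, 0 < e & forall t' y', `|t' - t| < e -> `|y' - y| < e ->
    col_label i t' y' = col_label i t y.
Proof.
move=> t01 nk; have t0 : 0 <= t by case/andP: t01.
have it0 : 0 <= i%:R + t by rewrite addr_ge0.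
have [e1 e10 h1] : exists2 e : R, 0 < e & forall t' y', `|t' - t| < e -> `|y' - y| < e ->
    (y' < ret (i%:R + t')) = (y < ret (i%:R + t)).
  apply: (@lt_stable R (fun t => ret (i%:R + t))).
    apply: cont_div; last by rewrite gt_eqF //; lra.
      by apply: contN; apply: contD; [exact: contC|apply: contM; [exact: contC|apply: contD; [exact: contC|move=> x; exact: cvg_id]]].
    by apply: contD; [exact: contC|apply: contD; [exact: contC|move=> x; exact: cvg_id]].
  by apply/eqP => e; apply: (nk 0); split => //; left.
have [e2 e20 h2] : exists2 e : R, 0 < e & forall t' y', `|t' - t| < e -> `|y' - y| < e ->
    (y' < - phi i t') = (y < - phi i t).
  apply: (@lt_stable R (fun t => - phi i t)).
    by apply: contN; exact: phi_continuous.
  by apply/eqP => e; apply: (nk (- theta q i t)); split => //; right; exists i, t; split => //; left.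
have [ri|ri] := boolP (in_run q i); last first.
  exists (Num.min e1 e2) => [|t' y']; first by rewrite lt_min e10.
  by rewrite !lt_min => /andP[? ?] /andP[? ?]; rewrite /col_label h1 // h2 // ri.
have [e3 e30 h3] : exists2 e : R, 0 < e & forall t' y', `|t' - t| < e -> `|y' - y| < e ->
    (y' < phi i t') = (y < phi i t).
  apply: (@lt_stable R (phi i)); first exact: phi_continuous.
  by apply/eqP => e; apply: (nk (theta q i t)); split => //; right; exists i, t; split => //; right; split => //; left.
have [e4 e40 h4] : exists2 e : R, 0 < e & forall t' y', `|t' - t| < e -> `|y' - y| < e ->
    (y' < 2 - phi i t') = (y < 2 - phi i t).
  apply: (@lt_stable R (fun t => 2 - phi i t)).
    by apply: contB; [exact: contC|exact: phi_continuous].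
  by apply/eqP => e; apply: (nk 0); split => //; right; exists i, t; split => //; right; split => //; right.
exists (Num.min (Num.min e1 e2) (Num.min e3 e4)) => [|t' y'].
  by rewrite !lt_min e10 e20 e30.
rewrite !lt_min => /andP[/andP[? ?] /andP[? ?]] /andP[/andP[? ?] /andP[? ?]].
by rewrite /col_label h1 // h2 // h3 // h4.
Qed.

Lemma plane_label_col i t y : 0 <= t <= 1 ->
  plane_label (i%:R + t) y = col_label i t y.
Proof.
move=> /andP[t0]; rewrite le_eqVlt => /orP[/eqP ->|t1].
  rewrite natr1 /plane_label ltNge ler0n /= natrK subrr; exact/esym/col_label_match.
have e : Num.truncn (i%:R + t : R) = i.
  by apply/truncn_def; rewrite -natr1 lerDl t0 ltrD2l.
rewrite /plane_label ltNge addr_ge0 //= e; congr col_label; ring.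
Qed.

Lemma plane_label_stable X y : (forall z, ~ knot X y z) ->
  exists2 e : R, 0 < e & forall X' y', `|X' - X| < e -> `|y' - y| < e ->
    plane_label X' y' = plane_label X y.
Proof.
move=> nk; have neg X' : X' < 0 -> plane_label X' = fun=> 1%g.
  by move=> X0; apply/funext => y'; rewrite /plane_label X0.
have [X0|X0|X0] := ltgtP X 0.
- exists (- X) => [|X' y']; first by rewrite oppr_gt0.
  by rewrite ltr_norml => /andP[? ?] _; rewrite !neg //; lra.
- have [m /andP[m1 m2]] := Gam_cases X0.
  have t01 : 0 <= X - m%:R <= 1 by rewrite -natr1 in m2; apply/andP; split; lra.
  have eX : m%:R + (X - m%:R) = X by ring.
  have nk' z : ~ knot (m%:R + (X - m%:R)) y z by rewrite eX; exact: nk.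
  have [e e0 eP] := col_label_stable t01 nk'.
  move: m2; rewrite le_eqVlt => /orP[/eqP m2|m2]; last first.
    exists (Num.min e (Num.min (X - m%:R) (m.+1%:R - X))) => [|X' y'].
      by rewrite !lt_min e0 /= !subr_gt0 m1.
    rewrite !lt_min !ltr_norml => /andP[/andP[? ?] /andP[/andP[? ?] /andP[? ?]]] /andP[/andP[? ?] _].
    have eX' : m%:R + (X' - m%:R) = X' by ring.
    rewrite -eX -eX' !plane_label_col //; last by rewrite -natr1 in m2 *; apply/andP; split; lra.
    by apply: eP; rewrite ltr_norml; apply/andP; split; lra.
  have t01' : 0 <= (0 : R) <= 1 by rewrite lexx ler01.
  have nk2 z : ~ knot (m.+1%:R + 0) y z by rewrite addr0 -m2; exact: nk.
  have [e2 e20 eP2] := col_label_stable t01' nk2.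
  rewrite -natr1 in m2; have XE : X - m%:R = 1 by lra.
  exists (Num.min (Num.min e e2) 1) => [|X' y']; first by rewrite !lt_min e0 e20 ltr01.
  rewrite !lt_min !ltr_norml => /andP[/andP[/andP[a1 a2] /andP[a3 a4]] /andP[a5 a6]].
  move=> /andP[/andP[/andP[b1 b2] /andP[b3 b4]] _].
  have -> : plane_label X y = col_label m 1 y by rewrite -eX plane_label_col // XE.
  have [XX|XX] := leP X' X.
    have eX' : m%:R + (X' - m%:R) = X' by ring.
    rewrite -eX' plane_label_col; last by apply/andP; split; clear -XX XE a5; lra.
    rewrite XE in eP; apply: eP; rewrite ltr_norml; apply/andP; split; first by clear -a1 XE; lra.
    - by clear -a2 XE; lra.
    - exact: b1.
    exact: b2.
  have eX' : m.+1%:R + (X' - m.+1%:R) = X' by ring.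
  rewrite -eX' plane_label_col; last by rewrite -natr1; apply/andP; split; clear -XX XE a6; lra.
  rewrite col_label_match; apply: eP2; rewrite ?subr0 ltr_norml -?natr1; apply/andP; split.
  - by clear -a3 XE; lra.
  - by clear -a4 XE; lra.
  - exact: b3.
  exact: b4.
- have t01' : 0 <= (0 : R) <= 1 by rewrite lexx ler01.
  have nk2 z : ~ knot (0%:R + 0) y z by rewrite (_ : 0%:R + 0 = X); [exact: nk|rewrite addr0 X0].
  have col0 t y' : 0 <= t <= 1 -> plane_label t y' = col_label 0 t y'.
    by move=> t01; rewrite -[in LHS](add0r t); exact: (@plane_label_col 0).
  have [e e0 eP] := col_label_stable t01' nk2.
  have c0 : col_label 0 0 y = 1%g.
    rewrite /col_label addr0 phi0 /= (_ : ret 0 = -1); last by rewrite /ret; field; lra.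
    by case: ifP => //; case: ifP.
  exists (Num.min e 1) => [|X' y']; first by rewrite lt_min e0 ltr01.
  rewrite !lt_min X0 subr0 => /andP[h1 h2] /andP[h3 _].
  have -> : plane_label 0 y = 1%g by rewrite col0.
  have [X'0|X'0] := ltP X' 0; first by rewrite neg.
  rewrite col0; last first.
    by move: h2; rewrite ltr_norml => /andP[? ?]; apply/andP; split; lra.
  by rewrite -c0; apply: eP => //; rewrite subr0.
Qed.

Lemma label_stable w : over_free q w -> \forall z \near w, label z = label w.
Proof.
move=> fw; have [w1|w1|w1] := ltgtP (cx w) 1.
- have [Xk Yk Zk] := coord_continuous_at w1.
  have [e e0 eP] := plane_label_stable (fun z => @free_knot R q qodd w z w1 fw).
  have n1 : \forall z \near w, cx z < 1.
    apply: (@cx_continuous R w [set r | r < 1]).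
    by apply: open_nbhs_nbhs; split; [exact: open_lt|].
  have n2 : \forall z \near w, ball (Xc w) e (Xc z) by apply: Xk; exact: nbhsx_ballx.
  have n3 : \forall z \near w, ball (Yc w) e (Yc z) by apply: Yk; exact: nbhsx_ballx.
  apply: filterS3 n1 n2 n3 => z z1; rewrite -!ball_normE /= => zX zY.
  by rewrite /label z1 w1; apply: eP; rewrite distrC.
- have n1 : \forall z \near w, 1 < cx z.
    apply: (@cx_continuous R w [set r | 1 < r]).
    by apply: open_nbhs_nbhs; split; [exact: open_gt|].
  by apply: filterS n1 => z z1; rewrite /label !ifF //; apply/negbTE; rewrite -leNgt ltW.
have y0 : cy w != 0.
  apply/eqP => y0; apply: (fw 0); left; apply: vec3_eq; rewrite !coordE //.
(* The quotient of the constants 1/2 and 1/6 is the height 3 that [plane_label_far] requires. *)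
have n1 : \forall z \near w, `|cy w| / 2 < `|cy z|.
  apply: (@cont_norm R E (@cy R) (@cy_continuous R) w [set r | `|cy w| / 2 < r]).
  apply: open_nbhs_nbhs; split; first exact: open_gt.
  by rewrite /= ltr_pdivrMr // ltr_pMr ?normr_gt0 //; lra.
have n2 : \forall z \near w, 1 - `|cy w| / 6 < cx z.
  apply: (@cx_continuous R w [set r | 1 - `|cy w| / 6 < r]).
  apply: open_nbhs_nbhs; split; first exact: open_gt.
  by rewrite /= w1 ltrBlDr ltrDl divr_gt0 // normr_gt0.
apply: filterS2 n1 n2 => z z1 z2; rewrite /label w1 ltxx.
case: ifP => // z3; apply: plane_label_far.
by rewrite /Yc normrM normfV (gtr0_norm (_ : 0 < 1 - cx z)) ?subr_gt0 // ltr_pdivlMr ?subr_gt0 //; lra.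
Qed.

End Labels.

(** The involution [a] inverts [a * h] by conjugation, so the powers of [a * h] solve the recursion
    that the crossings impose on the bigons. *)
Lemma dihedral_power (G : groupType) (a h : G) k : (a * a = 1 -> h * h = 1 ->
  a * ((a * h) ^+ k)^-1 * h = (a * h) ^+ k.+1)%g.
Proof.
move=> aa hh; have ai : (a^-1 = a)%g by apply: mulg1_eq.
have hi : (h^-1 = h)%g by apply: mulg1_eq.
elim: k => [|k IH]; first by rewrite expg0 invg1 mulg1 expg1.
by rewrite expgS invgM invgM ai hi [in RHS]expgSr -IH !mulgA.
Qed.

Lemma nontrivial_autoW (T : topologicalType) (G : groupType) (v : T -> T -> G)
  (Y Z : set T) (al : T -> G) : Z `<=` Y -> nontrivial_auto v Y al ->
  nontrivial_auto v Z al.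
Proof.
move=> ZY [u1 h]; split=> [x /ZY /u1//|x /ZY /h [g hg]].
by exists g; apply: filterS hg => z zP /ZY.
Qed.

Lemma trivialised_auto (T : topologicalType) (G : groupType) (v : T -> T -> G)
  (Y : set T) (al u : T -> G) : nontrivial_auto v Y al -> trivialises v Y u ->
  locally_constant Y (fun x => u x * al x * (u x)^-1)%g.
Proof.
move=> [_ alP] uP x Yx; have [g hg] := alP x Yx; have [k hk] := uP x Yx.
have e z : Y z -> (Y z -> v x z * al z * (v x z)^-1 = g)%g ->
    (Y z -> u z = k * v x z)%g -> (u z * al z * (u z)^-1 = k * g * k^-1)%g.
  by move=> Yz /(_ Yz) <- /(_ Yz) ->; rewrite invgM !mulgA.
have ex : (u x * al x * (u x)^-1 = k * g * k^-1)%g.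
  by apply: e => //; [exact: nbhs_singleton hg|exact: nbhs_singleton hk].
by apply: filterS2 hg hk => z h1 h2 Yz; rewrite ex; apply: e.
Qed.

Section ContinuousAt.
Variables (R : realType) (T : topologicalType).
Implicit Types (f g : T -> R) (x : T).

Lemma cont_at_sub f g x : {for x, continuous f} -> {for x, continuous g} ->
  {for x, continuous (fun z => f z - g z)}.
Proof. by move=> fc gc; apply: cvgB. Qed.

Lemma cont_at_add f g x : {for x, continuous f} -> {for x, continuous g} ->
  {for x, continuous (fun z => f z + g z)}.
Proof. by move=> fc gc; apply: cvgD. Qed.

Lemma cont_at_cst (c : R) x : {for x, continuous (fun _ : T => c)}.
Proof. exact: cvg_cst. Qed.

Lemma near_lt f x c : {for x, continuous f} -> f x < c -> \forall z \near x, f z < c.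
Proof.
move=> fc fx; apply: (fc [set r | r < c]); apply: open_nbhs_nbhs.
by split; [exact: open_lt|exact: fx].
Qed.

Lemma near_gt f x c : {for x, continuous f} -> c < f x -> \forall z \near x, c < f z.
Proof.
move=> fc fx; apply: (fc [set r | c < r]); apply: open_nbhs_nbhs.
by split; [exact: open_gt|exact: fx].
Qed.

Lemma near_norm_lt f x c : {for x, continuous f} -> `|f x| < c ->
  \forall z \near x, `|f z| < c.
Proof. by move=> fc; apply: near_lt; exact: cvg_norm. Qed.

Lemma near_sign f x : {for x, continuous f} -> f x != 0 ->
  \forall z \near x, f z != 0 /\ (0 < f z) = (0 < f x).
Proof.
move=> fc; rewrite neq_lt => /orP[f0|f0].
  by apply: filterS (near_lt fc f0) => z z0; rewrite lt_eqF // !ltNge !ltW.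
by apply: filterS (near_gt fc f0) => z z0; rewrite gt_eqF // z0 f0.
Qed.

End ContinuousAt.

(** * The strands near a crossing *)

Section CrossingNeighbourhood.
Variable R : realType.
Notation E := 'rV[R]_3.

(* [front i = 0] (resp. [back i = 0]) is the front (resp. back) strand at the
   crossing [i]. *)
Definition front (i : nat) (w : E) : R := Yc w - (Xc w - i%:R).
Definition back (i : nat) (w : E) : R := Yc w + (Xc w - i%:R).

Definition crossing_nbhd (i : nat) (d : R) (w : E) : Prop :=
  [/\ cx w < 1, `|Xc w - i%:R| < d, `|Yc w| < d & `|Zc w| < 1 / 2 - d].

Lemma near_crossing_nbhd i d w : crossing_nbhd i d w ->
  \forall z \near w, crossing_nbhd i d z.
Proof.
move=> [w1 wX wY wZ]; have [Xk Yk Zk] := coord_continuous_at w1.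
have n1 : \forall z \near w, cx z < 1 by apply: near_lt w1; exact: cx_continuous.
have n2 := near_norm_lt (cont_at_sub Xk (@cont_at_cst R _ i%:R w)) wX.
have n3 := near_norm_lt Yk wY.
have n4 := near_norm_lt Zk wZ.
by apply: filterS2 (filterI n1 n2) (filterI n3 n4) => z [? ?] [? ?]; split.
Qed.

Lemma front_continuous_at i w : cx w < 1 -> {for w, continuous (front i)}.
Proof.
move=> w1; have [Xk Yk _] := coord_continuous_at w1.
by apply: cont_at_sub => //; apply: cont_at_sub => //; exact: cont_at_cst.
Qed.

Lemma back_continuous_at i w : cx w < 1 -> {for w, continuous (back i)}.
Proof.
move=> w1; have [Xk Yk _] := coord_continuous_at w1.
by apply: cont_at_add => //; apply: cont_at_sub => //; exact: cont_at_cst.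
Qed.

Lemma truncn_crossing i d w : crossing_nbhd i d w -> d < 1 / 2 ->
  forall k, Xc w = k%:R -> k = i.
Proof.
move=> [_ wX _ _] d2 k ek; rewrite ek ltr_norml in wX; case/andP: wX => h1 h2.
have [ki|ki|//] := ltngtP k i; exfalso.
- have hk : (k.+1%:R <= i%:R :> R) by rewrite ler_nat.
  by rewrite -natr1 in hk; lra.
- have hk : (i.+1%:R <= k%:R :> R) by rewrite ler_nat.
  by rewrite -natr1 in hk; lra.
Qed.

End CrossingNeighbourhood.

Section CrossingStrands.
Variables (R : realType) (q : nat -> nat).
Hypothesis qodd : forall n, odd (q n).
Notation E := 'rV[R]_3.
Notation K := (@knot_set R q).

Lemma above_front i d w : lcross q i -> 0 < d -> d < 1 / 2 -> crossing_nbhd i d w ->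
  above K 1 w <-> front i w != 0.
Proof.
move=> l d0 d2 [w1 wX wY]; rewrite ltr_norml => /andP[wZ1 wZ2].
have X2 : `|Xc w - i%:R| < 1 / 2 by apply: lt_trans d2.
have Y2 : `|Yc w| < 1 / 2 by apply: lt_trans d2.
rewrite aboveP ?oner_neq0 //; split=> [h|h z].
  apply/eqP; rewrite /front => /eqP; rewrite subr_eq0 => /eqP e.
  have /h : knot q (Xc w) (Yc w) (1 / 2 - `|Xc w - i%:R|).
    by apply/(knot_crossing _ l X2 Y2); left.
  lra.
move=> /(knot_crossing _ l X2 Y2)[[e _]|[_ ->]].
  by rewrite /front e subrr eqxx in h.
lra.
Qed.

Lemma below_back i d w : lcross q i -> 0 < d -> d < 1 / 2 -> crossing_nbhd i d w ->
  above K (-1) w <-> back i w != 0.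
Proof.
move=> l d0 d2 [w1 wX wY]; rewrite ltr_norml => /andP[wZ1 wZ2].
have X2 : `|Xc w - i%:R| < 1 / 2 by apply: lt_trans d2.
have Y2 : `|Yc w| < 1 / 2 by apply: lt_trans d2.
have n1 : (-1 : R) != 0 by rewrite oppr_eq0 oner_neq0.
rewrite aboveP //; split=> [h|h z].
  apply/eqP; rewrite /back => e.
  have /h : knot q (Xc w) (Yc w) (- (1 / 2 - `|Xc w - i%:R|)).
    by apply/(knot_crossing _ l X2 Y2); right; split => //; lra.
  lra.
move=> /(knot_crossing _ l X2 Y2)[[_ ->]|[e _]].
  lra.
by rewrite /back e addNr eqxx in h.
Qed.

Lemma crossing_nbhd_ex w : ~ K w -> ~ above K 1 w -> ~ above K (-1) w ->
  exists i d, [/\ lcross q i, Xc w = i%:R, 0 < d, d < 1 / 2 & crossing_nbhd i d w].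
Proof.
move=> nK nF nB; have [w1 wY wZ [i [wX l]]] := between_crossing qodd nK nF nB.
exists i, ((1 / 2 - `|Zc w|) / 2); have z0 := normr_ge0 (Zc w).
split => //; [lra|lra|split => //].
- by rewrite wX subrr normr0; lra.
- by rewrite wY normr0; lra.
- lra.
Qed.

End CrossingStrands.

Section DihedralSystem.
Variables (R : realType) (q : nat -> nat).
Hypothesis qodd : forall n, odd (q n).
Variables (G : groupType) (a : G) (h : nat -> G).
Hypothesis aa : (a * a = 1)%g.
Hypothesis hh : forall n, (h n * h n = 1)%g.
Hypothesis ahq : forall n, ((a * h n) ^+ q n = 1)%g.
Notation E := 'rV[R]_3.
Notation K := (@knot_set R q).
Notation label := (@label R q G a h).
Notation run_label := (run_label q h).
Notation mid_label := (mid_label q a h).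

Lemma crossing_labels i : lcross q i -> run_label i.-1 = run_label i /\
  mid_label i = (a * (mid_label i.-1)^-1 * run_label i)%g.
Proof.
case: i => // i; rewrite -rcross_lcrossS /rcross => r /=.
rewrite /mid_label /run_label.
have [[e1 e2 e3]|[e1 e2]] := col_succ q i; last by move: r; rewrite e1 ltnn andbF.
rewrite e1 e2 dihedral_power //; split => //.
by case: (col_idx q i) r.
Qed.

(** The signs of [front] and [back] distinguish the four regions at a crossing: the loop above, the
    bigons to the left and right, the side below. *)
Lemma crossing_label i w : lcross q i -> cx w < 1 -> `|Xc w - i%:R| < 1 / 2 ->
  `|Yc w| < 1 / 2 -> front i w != 0 -> back i w != 0 ->
  label w = if 0 < front i w then (if 0 < back i w then run_label i else mid_label i.-1)
            else (if 0 < back i w then mid_label i else a).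
Proof.
move=> l w1; rewrite /front /back /label w1; move: (Xc w) (Yc w) => X y.
have [rl _] := crossing_labels l.
case: i l rl => // i l rl; rewrite !ltr_norml -[i.+1%:R]natr1 => /andP[X1 X2] /andP[y1 y2].
have i0 := ler0n R i; have [ri ri1] := cross_runS l.
have r : rcross q i by rewrite rcross_lcrossS.
have X0 : 0 <= X by clear -X1 i0 qodd aa hh ahq; lra.
have [_ r2] := ret_bounds X0; have yr : (y < ret X) = false.
  by apply/negbTE; rewrite -leNgt; clear -r2 y1 qodd aa hh ahq; lra.
set u := X - (i%:R + 1) in X1 X2 *.
have sg (b : R) : b != 0 -> (0 < - b) = ~~ (0 < b).
  by move=> b0; rewrite oppr_gt0 ltNge le_eqVlt eq_sym (negPf b0).
move=> f0 b0; have y2u : (y < 2 - u) /\ (y < 2 + u) by clear -y2 X1 X2 qodd aa hh ahq; split; lra.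
have e1 : (y < u) = ~~ (0 < y - u) by rewrite -(sg _ f0) oppr_gt0 subr_lt0.
have e2 : (y < - u) = ~~ (0 < y + u) by rewrite -(sg _ b0) oppr_gt0 -ltrBrDr sub0r.
have [XX|XX] := leP 0 u.
  have eX : i.+1%:R + u = X by rewrite /u -natr1; ring.
  have [p _] := @phi_lcross R q i.+1 u l X2 XX.
  rewrite -{1}eX plane_label_col //; last by apply/andP; split => //; clear -X2 qodd aa hh ahq; lra.
  have fb : 0 < y - u -> 0 < y + u by clear -XX qodd aa hh ahq; lra.
  rewrite /col_label eX p ri1 yr e1 e2 y2u.1 /=.
  by move: fb; case: (0 < y - u); case: (0 < y + u) => // /(_ isT).
have eX : i%:R + (u + 1) = X by rewrite /u; ring.
have u1 : 1 / 2 < u + 1 by clear -X1 qodd aa hh ahq; lra.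
have u2 : u + 1 <= 1 by clear -XX qodd aa hh ahq; lra.
have [p _] := @phi_rcross R q i (u + 1) r u1 u2.
rewrite -{1}eX plane_label_col //; last by apply/andP; split => //; clear -u1 qodd aa hh ahq; lra.
have e3 : 1 - (u + 1) = - u by ring.
rewrite /col_label eX p ri yr e3 opprK e1 e2 y2u.2 /=.
have bf : 0 < y + u -> 0 < y - u by clear -XX qodd aa hh ahq; lra.
by move: bf; rewrite -rl; case: (0 < y + u); case: (0 < y - u) => // /(_ isT).
Qed.

(** Left factors that fit the trivialisations in front and behind together to one germ. Four
    quadrants constrain four constants, one of which is normalised to 1; the fourth constraint is
    [crossing_labels]. *)
Definition front_value i (s : bool) : G :=
  if s then 1%g else (mid_label i.-1 * a^-1)%g.
Definition back_value i (s : bool) : G :=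
  if s then run_label i else mid_label i.-1.

Lemma crossing_value i w d : lcross q i -> d < 1 / 2 -> crossing_nbhd i d w ->
  front i w != 0 -> back i w != 0 ->
  (back_value i (0 < back i w) * (label w)^-1 = front_value i (0 < front i w))%g.
Proof.
move=> l d2 [w1 wX wY _] f0 b0.
rewrite (crossing_label l w1 (lt_trans wX d2) (lt_trans wY d2) f0 b0).
rewrite /back_value /front_value; have [_ e] := crossing_labels l.
case: (0 < front i w); case: (0 < back i w); rewrite ?mulgV //.
by rewrite e !invgM invgK !mulgA mulgV mul1g.
Qed.

(** Given by the back trivialisation away from the back strand and by the front one over it; where
    both apply they agree by [crossing_value]. *)
Definition crossing_germ i (z : E) : G :=
  if back i z == 0 then front_value i (0 < front i z)
  else (back_value i (0 < back i z) * (label z)^-1)%g.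

(** The system glued from trivial ones in front and behind with transition element [label]. For the
    remaining points off the knot, [Xc x] is an integer and the truncation returns the crossing. *)
Definition dihedral_system (x z : E) : G :=
  if `[< above K 1 x >] then 1%g else
  if `[< above K (-1) x >] then (label z)^-1%g
  else crossing_germ (Num.truncn (Xc x)) z.

Lemma crossing_germ_front i d y : lcross q i -> 0 < d -> d < 1 / 2 ->
  crossing_nbhd i d y -> above K 1 y ->
  \forall z \near y, crossing_germ i z = front_value i (0 < front i y).
Proof.
move=> l d0 d2 yN /(above_front qodd l d0 d2 yN) f0.
have y1 : cx y < 1 by case: yN.
have n1 := near_sign (@front_continuous_at R i y y1) f0.
have n2 := near_crossing_nbhd yN.
apply: filterS2 n1 n2 => z [zf <-] zN; rewrite /crossing_germ.
by case: eqP => // /eqP zb; exact: crossing_value d2 zN zf zb.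
Qed.

Lemma crossing_germ_back i d y : lcross q i -> 0 < d -> d < 1 / 2 ->
  crossing_nbhd i d y -> above K (-1) y ->
  \forall z \near y, crossing_germ i z = (back_value i (0 < back i y) * (label z)^-1)%g.
Proof.
move=> l d0 d2 yN /(below_back qodd l d0 d2 yN) f0.
have y1 : cx y < 1 by case: yN.
have n1 := near_sign (@back_continuous_at R i y y1) f0.
by apply: filterS n1 => z [zf <-]; rewrite /crossing_germ (negPf zf).
Qed.

Let cK : compact K := knot_set_compact qodd.

Lemma dihedral_trivialises_front :
  trivialises dihedral_system (above K 1) (fun=> 1%g).
Proof.
move=> x xF; exists 1%g; apply: filterE => z _.
by rewrite /dihedral_system; case: asboolP => // _; rewrite mulg1.
Qed.

Lemma dihedral_trivialises_back :
  trivialises dihedral_system (above K (-1)) (fun z => (label z)^-1)%g.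
Proof.
move=> x xB; rewrite /dihedral_system; case: asboolP => [xF|nF].
  exists ((label x)^-1)%g.
  have := label_stable qodd ahq (above_below_free xF xB).
  by apply: filterS => z -> _; rewrite mulg1.
exists 1%g; apply: filterE => z _.
by case: asboolP => // _; rewrite mul1g.
Qed.

Theorem dihedral_local_system : local_system (~` K) dihedral_system.
Proof.
have openF s : open (above K s) by exact: open_above.
move=> x nK; have [xF|nF] := pselect (above K 1 x).
  have nF : nbhs x (above K 1) by exact: open_nbhs_nbhs.
  apply: filterS nF => y yF; exists 1%g; apply: filterE => z.
  by rewrite /dihedral_system !asboolT // mulg1.
have [xB|nB] := pselect (above K (-1) x).
  have nB : nbhs x (above K (-1)) by exact: open_nbhs_nbhs.
  apply: filterS nB => y yB; rewrite /dihedral_system (asboolF nF) (asboolT xB).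
  have [yF|nyF] := pselect (above K 1 y); last first.
    by exists 1%g; apply: filterE => z; rewrite (asboolF nyF) (asboolT yB) mul1g.
  exists (label y); have := label_stable qodd ahq (above_below_free yF yB).
  by apply: filterS => z ->; rewrite (asboolT yF) mulgV.
have [i [d [l eX d0 d2 xN]]] := crossing_nbhd_ex qodd nK nF nB.
have xE z : dihedral_system x z = crossing_germ i z.
  by rewrite /dihedral_system (asboolF nF) (asboolF nB) eX natrK.
apply: filterS (near_crossing_nbhd xN) => y yN.
have [yF|nyF] := pselect (above K 1 y).
  exists ((front_value i (0 < front i y))^-1)%g.
  apply: filterS (crossing_germ_front l d0 d2 yN yF) => z e.
  by rewrite xE e mulVg /dihedral_system asboolT.
have [yB|nyB] := pselect (above K (-1) y).
  exists ((back_value i (0 < back i y))^-1)%g.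
  apply: filterS (crossing_germ_back l d0 d2 yN yB) => z e.
  by rewrite xE e mulKg /dihedral_system (asboolF nyF) asboolT.
(* What remains is a point between the two strands of a crossing, which is again [i] since the
   neighbourhood contains no other; so [x] and [y] have the same germ. *)
exists 1%g; have [Ky|nKy] := pselect (K y).
  exfalso; case: (yN) => y1 yX yY yZ.
  have X2 : `|Xc y - i%:R| < 1 / 2 by apply: lt_trans d2.
  have Y2 : `|Yc y| < 1 / 2 by apply: lt_trans d2.
  move: yZ; rewrite ltr_norml => /andP[z1 z2].
  by case/(knot_setP qodd y1)/(knot_crossing _ l X2 Y2): Ky => [[_ e]|[_ e]]; lra.
have [i' [d' [l' eX' _ _ _]]] := crossing_nbhd_ex qodd nKy nyF nyB.
have ii := truncn_crossing yN d2 eX'; subst i'.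
apply: filterE => z.
by rewrite xE /dihedral_system (asboolF nyF) (asboolF nyB) eX' natrK mul1g.
Qed.

End DihedralSystem.

(** * Test graphs *)

Section Ladder.
Variables (R : realType) (q : nat -> nat).
Hypothesis qodd : forall n, odd (q n).
Notation E := 'rV[R]_3.
Notation K := (@knot_set R q).
Notation knot := (@knot R q).

Definition rail_pt (X y1 z1 y2 z2 t : R) : E :=
  pt X (y1 + t * (y2 - y1)) (z1 + t * (z2 - z1)).

Definition rail (X y1 z1 y2 z2 : R) : set E :=
  rail_pt X y1 z1 y2 z2 @` `[0, 1].

Lemma rail_continuous X y1 z1 y2 z2 : continuous (rail_pt X y1 z1 y2 z2).
Proof.
have c (u v w : R) : continuous (fun t : R => (u + t * (v - u)) / w).
  apply: contM; last exact: contC.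
  apply: contD; first exact: contC.
  by apply: contM; [move=> x; exact: cvg_id|exact: contC].
by move=> t; apply: vec3_cvg; [exact: cvg_cst|exact: c|exact: c].
Qed.

Lemma rail_closed X y1 z1 y2 z2 : closed (rail X y1 z1 y2 z2).
Proof.
apply: compact_closed; first exact: norm_hausdorff.
apply: continuous_compact; last exact: segment_compact.
by apply: continuous_subspaceT; exact: rail_continuous.
Qed.

Lemma convex_rail X y1 z1 y2 z2 : convex_set (rail X y1 z1 y2 z2).
Proof.
move=> _ _ t [r /=] + <- [s /=] + <- /andP[t0 t1].
rewrite !in_itv /= => /andP[r0 r1] /andP[s0 s1].
exists (r + t * (s - r)); last by apply: vec3_eq; rewrite /rail_pt /pt !coordE; ring.
by rewrite /= in_itv /=; apply/andP; split; nra.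
Qed.

(* The first crossing of the run [n]. *)
Definition kap (n : nat) : nat := (cstart q n + 2)%N.

(* A theta graph in the plane of the crossing: its two cells are pierced by the
   crossing strands and by the third strand of the run. *)
Definition ladder (n : nat) : set E := let X := (kap n)%:R in
  [set w | [\/ rail X (-1) 1 3 1 w, rail X (-1) (-1) 3 (-1) w |
   [\/ rail X (-1) 1 (-1) (-1) w, rail X 1 1 1 (-1) w | rail X 3 1 3 (-1) w]]].

Lemma qpos n : (0 < q n)%N. Proof. by have := qodd n; case: (q n). Qed.

Lemma kap_cross n : [/\ lcross q (kap n), col_blk q (kap n) = n,
  col_idx q (kap n) = 2%N & col_blk q (kap n).-1 = n].
Proof.
have h : (2 < csize q n)%N by rewrite /csize; have := qpos n; lia.
rewrite /kap lcrossE // col_blkE // col_idxE //; split => //.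
by rewrite addn2 -pred_Sn -addn1 col_blkE //; lia.
Qed.

Lemma knot_kap n y z : knot (kap n)%:R y z ->
  [\/ y < -1, y = 0 /\ `|z| = 1 / 2 | y = 2 /\ z = 0].
Proof.
have [l _ _ _] := kap_cross n; move=> /knot_normal[i [t [t01 eX st]]].
have hh : `|1 / 2| = 1 / 2 :> R by rewrite ger0_norm //; lra.
have [ei et] : kap n = i /\ 0 = t.
  by apply: (@nat_frac_inj R) => //; rewrite ?addr0 // lexx ltr01.
subst i t; case: st => [[-> _]|st|st]; last first.
- by have [_ _ _] := st; rewrite cross_run ?l.
- move: st; rewrite /strand phi0 theta0 l => -[[-> ->]|[_ [[-> ->]|[-> ->]]]].
  + by constructor 2; rewrite oppr0 normrN.
  + by constructor 2.
  by constructor 3; rewrite subr0.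
- by constructor 1; apply: ret_lt; rewrite ltr0n /kap addn2.
Qed.

Lemma coord_kap n y z : let w := pt (kap n)%:R y z : E in
  [/\ cx w < 1, Xc w = (kap n)%:R, Yc w = y & Zc w = z].
Proof. by apply: coord_pt; apply: lt_le_trans (ler0n _ _); lra. Qed.

Lemma above_kap n (s y z : R) : `|s| = 1 -> -1 <= y ->
  (y = 0 \/ y = 2 -> 1 / 2 < s * z) -> above K s (pt (kap n)%:R y z).
Proof.
move=> s1 y1 hy; have [w1 eX eY eZ] := coord_kap n y z.
apply/(aboveP qodd w1); first by rewrite -normr_eq0 s1 oner_neq0.
rewrite eX eY eZ => z' /knot_kap[h|[h z'2]|[h ->]]; first lra.
  apply: le_lt_trans (hy (or_introl h)); rewrite -z'2 -[ `|z'|]mul1r -s1 -normrM.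
  exact: ler_norm.
by rewrite mulr0; apply: lt_trans (hy (or_intror h)); lra.
Qed.

Lemma ladder_closed n : closed (ladder n).
Proof.
rewrite (_ : ladder n = let X := (kap n)%:R in
  rail X (-1) 1 3 1 `|` rail X (-1) (-1) 3 (-1) `|`
  (rail X (-1) 1 (-1) (-1) `|` rail X 1 1 1 (-1) `|` rail X 3 1 3 (-1))).
  by rewrite /=; repeat apply: closedU; exact: rail_closed.
apply/seteqP; split=> w.
  by case=> [h|h|[h|h|h]]; [left; left|left; right|right; left; left|right; left; right|right; right].
by case=> [[h|h]|[[h|h]|h]]; [constructor 1|constructor 2|constructor 3; constructor 1|
  constructor 3; constructor 2|constructor 3; constructor 3].
Qed.

Lemma rail_above n (s : R) : `|s| = 1 ->
  rail (kap n)%:R (-1) s 3 s `<=` above K s /\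
  forall y, y = -1 \/ y = 1 \/ y = 3 -> rail (kap n)%:R y 1 y (-1) `<=` above K s.
Proof.
move=> s1; split=> [_ [t /=] + <-|y hy _ [t /=] + <-]; rewrite in_itv /= => /andP[t0 t1].
  apply: above_kap => //; first lra.
  rewrite subrr mulr0 addr0 => _; rewrite -expr2 -real_normK ?num_real // s1 expr1n; lra.
rewrite /rail_pt subrr mulr0 addr0.
by case: hy => [->|[->|->]]; apply: above_kap => //; try lra; case; lra.
Qed.

Lemma ladder_above n w : ladder n w -> above K 1 w \/ above K (-1) w.
Proof.
have n1 : `|1| = 1 :> R by rewrite normr1.
have m1 : `|-1| = 1 :> R by rewrite normrN1.
have [f1 f2] := rail_above n n1; have [b1 _] := rail_above n m1.
case=> [/f1|/b1|[h|h|h]]; [by left|by right|..]; left; apply: f2 h; tauto.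
Qed.

Lemma above_off (s : R) : above K s `<=` ~` K.
Proof. by move=> w h /h /(_ erefl erefl); rewrite ltxx. Qed.

Lemma ladder_off n : ladder n `<=` ~` K.
Proof. by move=> w /ladder_above[] /above_off. Qed.

Lemma ladder_coord n w : ladder n w -> exists y z, [/\ `|y| <= 3, `|z| <= 1 &
  w = pt (kap n)%:R y z].
Proof.
have h (y1 z1 y2 z2 : R) : -1 <= y1 <= 3 -> -1 <= y2 <= 3 -> -1 <= z1 <= 1 -> -1 <= z2 <= 1 ->
  rail (kap n)%:R y1 z1 y2 z2 w -> exists y z, [/\ `|y| <= 3, `|z| <= 1 &
  w = pt (kap n)%:R y z].
  move=> /andP[? ?] /andP[? ?] /andP[? ?] /andP[? ?] [t /=]; rewrite in_itv /= => /andP[t0 t1] <-.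
  exists (y1 + t * (y2 - y1)), (z1 + t * (z2 - z1)).
  by split => //; rewrite ler_norml; apply/andP; split; nra.
by case=> [|| []]; apply: h; lra.
Qed.

Lemma ladder_small N : nbhs (limit_pt R) N -> exists n0, forall n, (n0 <= n)%N ->
  ladder n `<=` N.
Proof.
move=> /nbhs3P[e e0 eN]; pose N0 := (Num.truncn (3 / e)).+1.
exists N0 => n n0 w /ladder_coord[y [z [y3 z1 ->]]].
have k0 : 3 / e < (kap n)%:R.
  apply: lt_le_trans (_ : N0%:R <= _); first exact: truncnS_gt.
  rewrite ler_nat; apply: leq_trans n0 _; rewrite /kap.
  by have := leq_block_start (csize_gt0 q) n; rewrite /cstart; lia.
have d0 : 0 < 3 / e by rewrite divr_gt0.
set k := (kap n)%:R in k0 *; have k1 : 0 < 1 + k by lra.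
have ek : 3 < e * (1 + k).
  by move: k0; rewrite ltr_pdivrMr // => ?; nra.
apply: eN; rewrite /limit_pt /pt !coordE ?subr0.
- have -> : k / (1 + k) - 1 = - (1 + k)^-1 by field; rewrite gt_eqF.
  by rewrite normrN gtr0_norm ?invr_gt0 // -div1r ltr_pdivrMr //; lra.
- by rewrite normrM normfV (gtr0_norm k1) ltr_pdivrMr //; lra.
- by rewrite normrM normfV (gtr0_norm k1) ltr_pdivrMr //; lra.
Qed.


Variables (G : groupType) (a : G) (h : nat -> G).
Hypothesis aa : (a * a = 1)%g.
Hypothesis hh : forall n, (h n * h n = 1)%g.
Hypothesis ahq : forall n, ((a * h n) ^+ q n = 1)%g.
Notation label := (@label R q G a h).
Notation system := (@dihedral_system R q G a h).

Lemma label_kap n z : [/\ label (pt (kap n)%:R (-1) z) = a,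
  label (pt (kap n)%:R 1 z) = h n & label (pt (kap n)%:R 3 z) = 1%g].
Proof.
have [l b i2 _] := kap_cross n; have r : in_run q (kap n) by rewrite /in_run i2.
have lE y : label (pt (kap n)%:R y z) = col_label q a h (kap n) 0 y.
  have [w1 eX eY _] := coord_kap n y z.
  by rewrite /label w1 eX eY -[(kap n)%:R]addr0 plane_label_col // lexx ler01.
have rl : ret ((kap n)%:R + 0 : R) < -1.
  by rewrite addr0; apply: ret_lt; rewrite ltr0n /kap addn2.
rewrite !lE /col_label addr0 phi0 l r oppr0 addr0 /run_label b /=.
rewrite addr0 in rl.
have F (y y' : R) : y' <= y -> (y < y') = false by move=> ?; apply/negbTE; rewrite -leNgt.
rewrite !(F _ (ret _)) ?(F 1 0) ?(F 3 0) ?(F 3 2) ?ltrN10 ?ltr1n //; lra.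
Qed.

(** An automorphism takes one value [e] on the front rail and the three posts. Along the back rail,
    its conjugates by the labels [a], [h n] and 1 at the posts must agree, so [e] commutes with both
    holonomies. *)
Lemma ladder_no_auto n : has_auto system (ladder n) ->
  exists e, [/\ e <> 1, e * a = a * e & e * h n = h n * e]%g.
Proof.
move=> [al alP]; set k : R := (kap n)%:R.
have [f1 f2] := rail_above n (normr1 R); have [b1 _] := rail_above n (normrN1 R).
have front Y : Y `<=` ladder n -> convex_set Y -> Y `<=` above K 1 ->
    forall w w', Y w -> Y w' -> al w = al w'.
  move=> Yl cY YF w w' Yw Yw'.
  have := trivialised_auto (nontrivial_autoW Yl alP) (trivialisesW YF (@dihedral_trivialises_front R q G a h)).
  move=> /(convex_connective cY)/(_ _ _ Yw Yw').
  by rewrite !mul1g invg1 !mulg1.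
have back w w' : rail k (-1) (-1) 3 (-1) w -> rail k (-1) (-1) 3 (-1) w' ->
    ((label w)^-1 * al w * label w = (label w')^-1 * al w' * label w')%g.
  have b2 : rail k (-1) (-1) 3 (-1) `<=` ladder n by move=> x; constructor 2.
  have := trivialised_auto (nontrivial_autoW b2 alP) (trivialisesW b1 (dihedral_trivialises_back qodd ahq)).
  by move=> /(convex_connective (@convex_rail _ _ _ _ _)) fc wP wP'; have := fc _ _ wP wP'; rewrite !invgK.
have ends X y1 z1 y2 z2 : rail X y1 z1 y2 z2 (pt X y1 z1) /\ rail X y1 z1 y2 z2 (pt X y2 z2).
  split; [exists 0|exists 1] => //; rewrite /= ?in_itv /= ?lexx ?ler01 //.
    by rewrite /rail_pt !mul0r !addr0.
  by rewrite /rail_pt !mul1r ![_ + (_ - _)]addrC !subrK.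
have mid X z : rail X (-1) z 3 z (pt X 1 z).
  exists (1 / 2); first by rewrite /= in_itv /=; apply/andP; split; lra.
  by rewrite /rail_pt subrr mulr0 addr0 (_ : -1 + 1 / 2 * (3 - -1) = 1) //; lra.
have top w w' : rail k (-1) 1 3 1 w -> rail k (-1) 1 3 1 w' -> al w = al w'.
  by apply: front f1 _ _; [move=> x; constructor 1|exact: convex_rail].
have post y : y = -1 \/ y = 1 \/ y = 3 -> al (pt k y (-1)) = al (pt k y 1).
  move=> hy; apply: (front (rail k y 1 y (-1))); try by case: (ends k y 1 y (-1)).
  - by move=> x hx; constructor 3; case: hy hx => [->|[->|->]] hx;
      [constructor 1|constructor 2|constructor 3].
  - exact: convex_rail.
  - exact: f2.
set e := al (pt k (-1) 1).
have t1 : al (pt k 1 1) = e by apply: top; [exact: mid|case: (ends k (-1) 1 3 1)].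
have t3 : al (pt k 3 1) = e by apply: top; case: (ends k (-1) 1 3 1).
have p1 : al (pt k (-1) (-1)) = e by apply: post; left.
have p2 : al (pt k 1 (-1)) = e by rewrite post ?t1 //; right; left.
have p3 : al (pt k 3 (-1)) = e by rewrite post ?t3 //; right; right.
have [B1 B3] := ends k (-1) (-1) 3 (-1); have B2 := mid k (-1).
have [l1 l2 l3] := label_kap n (-1).
have := back _ _ B1 B3; have := back _ _ B2 B3.
rewrite p1 p2 p3 l1 l2 l3 invg1 mul1g mulg1 => eh ea.
exists e; split.
- by have [al1 _] := alP; apply: al1; constructor 1; case: (ends k (-1) 1 3 1).
- by rewrite -{2}ea !mulgA mulgV mul1g.
- by rewrite -{2}eh !mulgA mulgV mul1g.
Qed.

(** Bigon labels are now powers of [a * a = 1], so only the labels 1 and [a] occur in the slab [V]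
    around the graph, and [a] commutes with them. *)
Lemma ladder_auto n : a <> 1%g -> h n = a -> has_auto system (ladder n).
Proof.
move=> a1 hn; have [l b i2 b'] := kap_cross n; set k : R := (kap n)%:R.
pose V : set E := [set w | cx w < 1] `&` [set w | `|Xc w - k| < 1].
have oV : open V.
  rewrite openE => w [/= w1 wX]; have [Xk _ _] := coord_continuous_at w1.
  have n1 : \forall z \near w, cx z < 1 by apply: near_lt w1; exact: cx_continuous.
  have n2 := near_norm_lt (cont_at_sub Xk (@cont_at_cst R _ k w)) wX.
  by apply: filterS2 n1 n2.
have Vl w : V w -> label w = 1%g \/ label w = a.
  move=> [/= w1]; rewrite /label w1 ltr_norml => /andP[X1 X2].
  have kS : kap n = (kap n).-1.+1 by rewrite /kap addn2.
  have [j [t [t01 eX bj]]] : exists j t, [/\ 0 <= t <= 1, Xc w = j%:R + t & col_blk q j = n].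
    have kE : k = (kap n).-1%:R + 1 by rewrite natr1 -kS.
    have [X3|X3] := leP k (Xc w).
      by exists (kap n), (Xc w - k); split => //; [apply/andP; split; lra|rewrite -/k; lra].
    by exists (kap n).-1, (Xc w - k + 1); split => //; [apply/andP; split; lra|lra].
  rewrite eX plane_label_col // /col_label /mid_label /run_label bj hn aa expg1n.
  by do !case: ifP => _; tauto.
have oF s : open (above K s) by apply: open_above; exact: knot_set_compact.
have F1 : trivialises system (V `&` above K 1) (fun=> 1%g).
  by apply: trivialisesW (@dihedral_trivialises_front R q G a h) => w [].
have B1 : trivialises system (V `&` above K (-1)) (fun z => (label z)^-1%g).
  by apply: trivialisesW (dihedral_trivialises_back qodd ahq) => w [].
have ane : a != 1%g by apply/eqP.
have := two_charts_auto (openI oV (oF 1)) (openI oV (oF (-1))) F1 B1 ane ane.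
move=> /(_ _)/has_autoW; apply => [w|w [Vw _] _]; last first.
  by rewrite invgK mul1g; case: (Vl _ Vw) => ->; rewrite ?mulg1 ?mul1g.
move=> wl; have Vw : V w.
  have [y [z [_ _ ->]]] := ladder_coord wl.
  by have [w1 eX _ _] := coord_kap n y z; split => //=; rewrite eX subrr normr0.
by case: (ladder_above wl) => ?; [left|right]; split.
Qed.

End Ladder.

(** * The values of an arbitrary local system *)

(** Relative to the germ at [x] the automorphism is a constant [g] on nearby points of [D], and this
    constant prescribes its value at [x]. By density it differs from 1 and is compatible with
    neighbouring germs. *)
Lemma extend_auto (T : topologicalType) (G : groupType) (v : T -> T -> G)
  (X D : set T) (al : T -> G) : local_system X v ->
  (forall x, X x -> forall N, nbhs x N -> exists z, N z /\ D z) ->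
  (forall x, D x -> al x <> 1%g) ->
  (forall x, X x -> exists g : G, \forall z \near x,
     D z -> v x z * al z * (v x z)^-1 = g)%g ->
  has_auto v X.
Proof.
move=> vP dense al1 alP.
have /choice[g gP] : forall x, exists g : G, X x -> \forall z \near x,
     D z -> (v x z * al z * (v x z)^-1 = g)%g.
  move=> x; have [/alP[g hg]|nX] := pselect (X x); first by exists g.
  by exists 1%g.
exists (fun x => (v x x)^-1 * g x * v x x)%g; split=> [x Xx e|x Xx].
  have [z [zP Dz]] := dense x Xx _ (gP x Xx).
  have g1 : g x = 1%g.
    by have := congr1 (fun k => v x x * k * (v x x)^-1)%g e; rewrite !mulgA mulgV mul1g mulgK mulg1 mulgV.
  apply: (al1 z Dz); have := congr1 (fun k => (v x z)^-1 * k * v x z)%g (zP Dz).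
  by rewrite g1 mulg1 mulVg !mulgA mulVg mul1g mulgVK.
exists (g x); apply: filterS2 (vP x Xx) (nbhs_interior (gP x Xx)) => y [k hk] gx Xy.
have [z [[[h1 h2] h3] Dz]] := dense y Xy _ (filterI (filterI hk gx) (gP y Xy)).
have := h3 Dz; have := h2 Dz; rewrite h1 (nbhs_singleton hk) => <- <-.
by rewrite !invgM !mulgA; do 3?rewrite ?mulgV ?mul1g ?mulgVK ?mulgK ?mulVg.
Qed.

Section Regions.
Variables (R : realType) (q : nat -> nat).
Hypothesis qodd : forall n, odd (q n).
Notation E := 'rV[R]_3.
Notation K := (@knot_set R q).
Notation knot := (@knot R q).
Notation phi := (@phi R q).

Lemma strand_over i t y z : strand q i t y z ->
  y = - phi i t \/ in_run q i /\ (y = phi i t \/ y = 2 - phi i t).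
Proof. by case=> [[-> _]|[r [[-> _]|[-> _]]]]; auto. Qed.

Lemma knot_over i t y z : 0 <= t <= 1 -> knot (i%:R + t) y z ->
  [\/ y = ret (i%:R + t), y = - phi i t, in_run q i /\ (y = phi i t \/ y = 2 - phi i t) |
   [/\ ~~ in_run q i, y = 1 & t = 0 \/ t = 1]].
Proof.
move=> t01 [X0 [[-> _]|[i' [t' [t01' e st]]]]]; first by constructor 1.
have [[? ?]|[? [? ?]]|[? [? ?]]] := nat_frac t01 t01' e; subst.
- by have [->|h] := strand_over st; [constructor 2|constructor 3].
- have [e1 _] := col_match R q i; have := strand_over st; rewrite -e1.
  case=> [->|[_ h]]; [by constructor 2|have [r|r] := boolP (in_run q i); first by constructor 3].
  have [p _] := @phi_gap R q i 1 r; constructor 4; rewrite p in h; split=> //; last by right.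
  by case: h => ->; lra.
- have [e1 _] := col_match R q i'; have := strand_over st; rewrite e1.
  case=> [->|[_ h]]; [by constructor 2|have [r|r] := boolP (in_run q i'.+1); first by constructor 3].
  have [p _] := @phi_gap R q i'.+1 0 r; constructor 4; rewrite p in h; split=> //; last by left.
  by case: h => ->; lra.
Qed.

Lemma over_free_pt X y z : -1 < X -> (forall z', ~ knot X y z') -> over_free q (pt X y z : E).
Proof.
move=> X1 f z' Kz'; have [w1 eX eY _] := @coord_pt R X y z X1.
have w1' : cx (vec3 (cx (pt X y z)) (cy (pt X y z)) z') < 1 by rewrite coordE.
have [hX hY] := @same_vertical R (pt X y z) (vec3 (cx (pt X y z)) (cy (pt X y z)) z') w1 (cxE _ _ _) (cyE _ _ _).
by move: Kz' => /(knot_setP qodd w1'); rewrite hX hY eX eY; exact: f.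
Qed.

Lemma knot_set_bounds k : K k -> [/\ 0 <= cx k, cx k <= 1, -3 * (1 - cx k) <= cy k &
  cy k <= 2 * (1 - cx k)].
Proof.
case=> [->|[s es]]; first by rewrite /limit_pt !coordE; split; lra.
have [X [y [z [h eG]]]] := Gam_knot qodd s; rewrite es eG.
have [X0 y1 y2 _] := knot_bounds h; have [r1 r2] := ret_bounds X0.
have X1 : 0 < 1 + X by lra.
have e : 1 - X / (1 + X) = (1 + X)^-1 by field; rewrite gt_eqF.
rewrite /pt !coordE e; split; first by rewrite divr_ge0 //; lra.
- by rewrite ler_pdivrMr //; lra.
- by rewrite ler_pM2r ?invr_gt0 //; lra.
- by rewrite ler_pM2r ?invr_gt0 //; lra.
Qed.

Variables (A : Type) (t : E -> A).
Hypothesis tP : locally_constant (over_free q) t.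

Lemma value_vertical w z : over_free q w -> t (vec3 (cx w) (cy w) z) = t w.
Proof.
move=> fw; have cV : convex_set [set w' : E | cx w' = cx w /\ cy w' = cy w].
  by move=> u1 u2 s [e1 e2] [e3 e4] _; rewrite /= !coordE e1 e2 e3 e4; split; ring.
have := convex_connective cV; apply => //=; last by rewrite !coordE.
by apply: locally_constantW tP => w' [e1 e2] z'; rewrite e1 e2; exact: fw.
Qed.

(** The function [t] is constant on a vertical line that misses the knot, so the point of depth 0
    represents the line. *)
Definition value (X y : R) : A := t (pt X y 0).

Lemma value_coord w : cx w < 1 -> over_free q w -> value (Xc w) (Yc w) = t w.
Proof.
move=> w1 fw; have [X1 e] := pt_coord w1; rewrite -(value_vertical (cz (pt (Xc w) (Yc w) 0)) fw).
congr t; apply: vec3_eq; rewrite !coordE //; first by rewrite -[in RHS]e /pt !coordE.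
by rewrite -[in RHS]e /pt !coordE.
Qed.

Lemma value_path (X y : R -> R) : continuous X -> continuous y -> (forall s, 0 <= X s) ->
  (forall s, 0 <= s <= 1 -> forall z, ~ knot (X s) (y s) z) ->
  value (X 0) (y 0) = value (X 1) (y 1).
Proof.
move=> cX cy0 X0 f.
have cdiv (g : R -> R) : continuous g -> continuous (fun s => g s / (1 + X s)).
  move=> cg s; apply: (@cont_div R R g (fun s => 1 + X s) s); first exact: cg.
    by apply: contD; [exact: contC|exact: cX].
  by rewrite gt_eqF //; apply: lt_le_trans (_ : 1 <= _); rewrite ?lerDl.
apply: (@locally_constant_path R A _ t (fun s => pt (X s) (y s) 0) tP).
  by move=> s; apply: vec3_cvg; apply: cdiv => //; exact: contC.
by move=> s s01; apply: over_free_pt; [have := X0 s; lra|exact: f].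
Qed.

Lemma affine_continuous (u w : R) : continuous (fun s : R => u + s * (w - u)).
Proof.
apply: contD; first exact: contC.
by apply: contM; [move=> x; exact: cvg_id|exact: contC].
Qed.

Lemma value_vert X y0 y1 : 0 <= X ->
  (forall s, 0 <= s <= 1 -> forall z, ~ knot X (y0 + s * (y1 - y0)) z) ->
  value X y0 = value X y1.
Proof.
move=> X0 f; have := @value_path (fun=> X) _ (@contC _ _ _) (@affine_continuous y0 y1).
rewrite mul0r addr0 mul1r [y0 + _]addrC subrK; apply => //.
Qed.

Lemma value_between X y0 y1 : 0 <= X ->
  (forall y, Num.min y0 y1 <= y <= Num.max y0 y1 -> forall z, ~ knot X y z) ->
  value X y0 = value X y1.
Proof.
move=> X0 f; apply: value_vert => // s /andP[s0 s1]; apply: f.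
by rewrite ge_min le_max; case: (leP y0 y1) => h; apply/andP; split; apply/orP; [left|right|right|left]; nra.
Qed.

Lemma value_horizontal X0 X1 (y : R -> R) : 0 <= X0 -> 0 <= X1 -> continuous y ->
  (forall X, 0 <= X -> Num.min X0 X1 <= X <= Num.max X0 X1 -> forall z, ~ knot X (y X) z) ->
  value X0 (y X0) = value X1 (y X1).
Proof.
move=> h0 h1 yc f; pose X s := Num.max 0 (X0 + s * (X1 - X0)).
have cX : continuous X by apply: cont_max; [exact: contC|exact: affine_continuous].
have XE s : 0 <= s <= 1 -> X s = X0 + s * (X1 - X0).
  by move=> /andP[s0 s1]; rewrite /X max_r //; nra.
have := @value_path X (fun s => y (X s)) cX _ _ _.
rewrite !XE ?lexx ?ler01 // mul0r addr0 mul1r [X0 + _]addrC subrK; apply.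
- by move=> s; apply: continuous_comp; [exact: cX|exact: yc].
- by move=> s; rewrite /X le_max lexx.
move=> s s01; apply: f; rewrite XE //; case/andP: s01 => s0 s1; first nra.
by rewrite ge_min le_max; case: (leP X0 X1) => h; apply/andP; split; apply/orP; [left|right|right|left]; nra.
Qed.

Let one := t (vec3 (-1) 0 0).

Lemma value_half_space a b c d : half_space a b c d `<=` over_free q ->
  forall w w', half_space a b c d w -> half_space a b c d w' -> t w = t w'.
Proof.
move=> h w w'; apply: (convex_connective (@convex_half_space R a b c d)).
exact: locally_constantW tP.
Qed.

(** The knot projects into a triangle with a vertex at the limit point. The outside is a union of
    half-spaces, on each of which [t] is constant, linked by common points such as (-1, 5, 0). *)
Lemma value_outside w : [\/ cx w < 0, 1 < cx w, 2 * (1 - cx w) < cy w | cy w < -3 * (1 - cx w)] ->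
  over_free q w /\ t w = one.
Proof.
have f (P : R -> R -> Prop) : (forall x y, P x y ->
    [\/ x < 0, 1 < x, 2 * (1 - x) < y | y < -3 * (1 - x)]) ->
    [set w : E | P (cx w) (cy w)] `<=` over_free q.
  move=> h w' /h Pw z /knot_set_bounds; rewrite !coordE.
  by case: Pw => ? [? ? ? ?]; lra.
have f1 : half_space (-1) 0 0 0 `<=` over_free q (R := R).
  by move=> u hu; apply: (f (fun x y => x < 0)) => /=; [by constructor 1|move: hu; rewrite /half_space /=; lra].
have f2 : half_space 1 0 0 (-1) `<=` over_free q (R := R).
  by move=> u hu; apply: (f (fun x y => 1 < x)) => /=; [by constructor 2|move: hu; rewrite /half_space /=; lra].
have f3 : half_space 2 1 0 (-2) `<=` over_free q (R := R).
  by move=> u hu; apply: (f (fun x y => 2 * (1 - x) < y)) => /=; [by constructor 3|move: hu; rewrite /half_space /=; lra].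
have f4 : half_space 3 (-1) 0 (-3) `<=` over_free q (R := R).
  by move=> u hu; apply: (f (fun x y => y < -3 * (1 - x))) => /=; [by constructor 4|move: hu; rewrite /half_space /=; lra].
have e1 u : half_space (-1) 0 0 0 u -> t u = one.
  by move=> hu; apply: (value_half_space f1) => //; rewrite /half_space /= !coordE; lra.
have e3 u : half_space 2 1 0 (-2) u -> t u = one.
  move=> hu; rewrite -(e1 (vec3 (-1) 5 0)); last by rewrite /half_space /= !coordE; lra.
  by apply: (value_half_space f3) => //; rewrite /half_space /= !coordE; lra.
have e2 u : half_space 1 0 0 (-1) u -> t u = one.
  move=> hu; rewrite -(e3 (vec3 2 5 0)); last by rewrite /half_space /= !coordE; lra.
  by apply: (value_half_space f2) => //; rewrite /half_space /= !coordE; lra.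
have e4 u : half_space 3 (-1) 0 (-3) u -> t u = one.
  move=> hu; rewrite -(e1 (vec3 (-1) (-7) 0)); last by rewrite /half_space /= !coordE; lra.
  by apply: (value_half_space f4) => //; rewrite /half_space /= !coordE; lra.
have H (P : E -> Prop) a b c d : half_space a b c d `<=` over_free q -> (forall u, half_space a b c d u -> t u = one) ->
   half_space a b c d w -> over_free q w /\ t w = one.
  by move=> h1 h2 h3; split; [exact: h1|exact: h2].
by case=> h; [apply: (H setT) f1 e1 _|apply: (H setT) f2 e2 _|apply: (H setT) f3 e3 _|apply: (H setT) f4 e4 _];
  rewrite /half_space /=; lra.
Qed.

Lemma value_strip X y : 0 <= X -> 2 < y \/ y < -3 -> value X y = one.
Proof.
move=> X0 hy; suff [] : over_free q (pt X y 0 : E) /\ t (pt X y 0) = one by [].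
apply: value_outside.
have X1 : 0 < 1 + X by lra.
have e : 1 - X / (1 + X) = (1 + X)^-1 by field; rewrite gt_eqF.
rewrite /pt !coordE e; case: hy => hy; [constructor 3|constructor 4].
  by rewrite ltr_pM2r ?invr_gt0.
by rewrite ltr_pM2r ?invr_gt0.
Qed.


Lemma value_low X y : 0 <= X -> y < ret X -> value X y = one.
Proof.
move=> X0 yX; rewrite -(@value_strip X (-4) X0); last by right; lra.
have [r1 r2] := ret_bounds X0.
apply: value_between => // y'; case: (leP y (-4)) => ? /andP[? ?] z /knot_bounds[_ h _ _]; lra.
Qed.

Lemma free_gap i s y : ~~ in_run q i -> 0 < s < 1 -> -1 < y -> forall z, ~ knot (i%:R + s) y z.
Proof.
move=> ri /andP[s0 s1] y1 z /knot_over[|h|h|[r _]|[_ _ h]].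
- by rewrite !ltW.
- have [_] : -3 <= ret (i%:R + s) /\ ret (i%:R + s) <= -1 by apply: ret_bounds; rewrite addr_ge0 // ltW.
  lra.
- by have [p _] := @phi_gap R q i s ri; rewrite p in h; lra.
- by rewrite r in ri.
- by case: h; lra.
Qed.

Lemma toward_middle (k s X : R) : 0 <= s <= 1 ->
  Num.min (k + s) (k + 1 / 2) <= X <= Num.max (k + s) (k + 1 / 2) ->
  0 <= X - k <= 1 /\ (X - k = s \/ 0 < X - k < 1).
Proof.
move=> /andP[s0 s1] h; have [->|ne] := eqVneq X (k + s).
  have -> : k + s - k = s by ring.
  by split; [apply/andP|left].
have {}h : 0 < X - k < 1; last by case/andP: h => h1 h2; split; [rewrite !ltW|right; apply/andP].
move: h ne; case: (leP (k + s)) => h /andP[h1 h2] ne.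
  by have h3 : k + s < X; [rewrite lt_neqAle eq_sym ne|apply/andP; split; lra].
by have h3 : X < k + s; [rewrite lt_neqAle ne|apply/andP; split; lra].
Qed.

Lemma value_gap i s y : ~~ in_run q i -> 0 <= s <= 1 -> -1 < y ->
  (forall z, ~ knot (i%:R + s) y z) -> value (i%:R + s) y = one.
Proof.
move=> ri s01 y1 f; have i0 := ler0n R i; have /andP[s0 s1] := s01.
have X0 : 0 <= i%:R + s by rewrite addr_ge0.
have X0' : 0 <= i%:R + 1 / 2 :> R by rewrite addr_ge0 // divr_ge0.
rewrite (@value_horizontal (i%:R + s) (i%:R + 1 / 2) (fun=> y) X0 X0' (@contC _ _ _)).
  rewrite -(@value_strip (i%:R + 1 / 2) 3) //; last by left; rewrite ltr_nat.
  apply: value_between => // y' h; apply: free_gap => //; first by apply/andP; split; lra.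
  by move: h; clear -y1 ri; case: (leP y 3) => ? /andP[? ?]; lra.
move=> X XX /(toward_middle s01)[_ hs].
have eX : X = i%:R + (X - i%:R) by ring.
case: hs => [hs|hs]; first by rewrite eX hs.
by rewrite eX; exact: free_gap.
Qed.

Lemma free_run i s y : in_run q i -> 0 <= s <= 1 -> y <> ret (i%:R + s) -> y <> - phi i s ->
  y <> phi i s -> y <> 2 - phi i s -> forall z, ~ knot (i%:R + s) y z.
Proof. by move=> ri s01 h1 h2 h3 h4 z /(knot_over s01)[|||[]]; tauto || by rewrite ri. Qed.

Lemma run_free i s y : in_run q i -> 0 <= s <= 1 ->
  [\/ - phi i s < y /\ y < phi i s, phi i s < y /\ y < 2 - phi i s | 2 - phi i s < y] ->
  forall z, ~ knot (i%:R + s) y z.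
Proof.
move=> ri s01 hy; have X0 : 0 <= i%:R + s by rewrite addr_ge0 //; case/andP: s01.
have [_ r2] := ret_bounds X0; have [p0 p1] := phi_bd q i s01.
have hr : ret (i%:R + s) < y by clear -hy r2 p0 p1; case: hy => [[]||]; lra.
apply: free_run => //; clear -hy hr p0 p1; first by move=> e; rewrite e ltxx in hr.
- by case: hy => [[]|[]|]; lra.
- by case: hy => [[]|[]|]; lra.
by case: hy => [[]|[]|]; lra.
Qed.

Lemma value_high i s y : in_run q i -> 0 <= s <= 1 -> 2 - phi i s < y -> value (i%:R + s) y = one.
Proof.
move=> ri s01 hy; have X0 : 0 <= i%:R + s by rewrite addr_ge0 //; case/andP: s01.
have [_ p1] := phi_bd q i s01.
rewrite -(@value_strip (i%:R + s) (y + 3)) //; last by left; clear -p1 hy; lra.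
apply: value_between => // yy h; apply: run_free => //; constructor 3.
by move: h; clear -hy; case: (leP y (y + 3)) => ? /andP[? ?]; lra.
Qed.

Lemma phi_gt0 i s r : 0 <= s <= 1 -> 0 < phi i s -> 0 <= r <= 1 -> r = s \/ 0 < r < 1 ->
  0 < phi i r.
Proof.
move=> s01 ps r01 h; have [q0 _] := phi_bd q i r01.
rewrite lt_neqAle q0 andbT; apply/eqP => e.
case: h => [es|/andP[r0 r1]]; first by rewrite es in e; rewrite -e ltxx in ps.
by clear -r0 r1 r01 e; case: (phi_eq0 r01 (esym e)) => [[r' _]|[r' _]]; lra.
Qed.

Lemma value_mid i s y : in_run q i -> 0 <= s <= 1 -> - phi i s < y -> y < phi i s ->
  value (i%:R + s) y = value (i%:R + 1 / 2) 0.
Proof.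
move=> ri s01 y1 y2; have i0 := ler0n R i; have /andP[s0 s1] := s01.
have X0 : 0 <= i%:R + s by rewrite addr_ge0.
have ps : 0 < phi i s by clear -y1 y2; lra.
have -> : value (i%:R + s) y = value (i%:R + s) 0.
  apply: value_between => // yy h; apply: run_free => //; constructor 1.
  by move: h; clear -y1 y2 ps; case: (leP y 0) => ? /andP[? ?]; lra.
have X0' : 0 <= i%:R + 1 / 2 :> R by rewrite addr_ge0 // divr_ge0.
apply: (@value_horizontal (i%:R + s) (i%:R + 1 / 2) (fun=> 0) X0 X0' (@contC _ _ _)).
move=> X XX /(toward_middle s01)[t01 hs].
have -> : X = i%:R + (X - i%:R) by ring.
apply: run_free => //; constructor 1; have p := phi_gt0 s01 ps t01 hs.
by rewrite oppr_lt0.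
Qed.

(** This region narrows to a point at [X = 0]. The path to the reference point at [X = 1] therefore
    keeps [X] positive and follows the curve halfway between [ret] and -1. *)
Lemma value_side i s y : 0 <= s <= 1 -> ret (i%:R + s) < y -> y < - phi i s ->
  value (i%:R + s) y = value 1 ((ret 1 - 1) / 2).
Proof.
move=> s01 y1 y2; have i0 := ler0n R i; have /andP[s0 s1] := s01.
have X0 : 0 <= i%:R + s by lra.
have [p0 p1] := phi_bd q i s01; have [r1 r2] := ret_bounds X0.
have Xp : 0 < i%:R + s.
  rewrite lt_neqAle X0 andbT; apply/eqP => e.
  have s00 : s = 0 by lra.
  have i00 : i = 0%N by apply/eqP; rewrite -(eqr_nat R); apply/eqP; rewrite mulr0n; lra.
  subst; move: y1 y2; rewrite phi0 /= (_ : ret _ = -1); [lra|].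
  by rewrite /ret; field; lra.
have r3 := ret_lt Xp.
have side X yy : 0 <= X -> ret X < yy -> yy < -1 -> forall z, ~ knot X yy z.
  move=> XX h1 h2 z [_ [[e _]|[j [r [r01 eX st]]]]]; first lra.
  by have [? ? _] := strand_bounds r01 st; lra.
have -> : value (i%:R + s) y = value (i%:R + s) ((ret (i%:R + s) - 1) / 2).
  apply: value_between => // yy; case: (leP y ((ret (i%:R + s) - 1) / 2)) => ? /andP[? ?] z;
    by move=> /(knot_over s01)[e|e|[_ [e|e]]|[_ e _]]; clear side s01 i0 s0 s1 X0 Xp r1; lra.
pose mid (X : R) := (ret (Num.max 0 X) - 1) / 2.
have mE X : 0 <= X -> mid X = (ret X - 1) / 2 by move=> XX; rewrite /mid max_r.
rewrite -!mE // ?ler01 //; apply: value_horizontal => //.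
- have mc : continuous (fun X : R => Num.max 0 X) by apply: cont_max; [exact: contC|move=> x; exact: cvg_id].
  apply: contM; last exact: contC.
  apply: contB; last exact: contC.
  rewrite /ret => X; apply: (@cont_div R R (fun X => - (1 + 3 * Num.max 0 X)) (fun X => 1 + Num.max 0 X) X).
  + by apply: contN; apply: contD; [exact: contC|apply: contM; [exact: contC|exact: mc]].
  + by apply: contD; [exact: contC|exact: mc].
  + have : 0 <= Num.max 0 X by rewrite le_max lexx.
    by move=> ?; rewrite gt_eqF //; lra.
move=> X XX hX; have Xpp : 0 < X.
  by move: hX; case: (leP (i%:R + s) 1) => h /andP[h1 h2]; lra.
by have r4 := ret_lt Xpp; rewrite mE //; apply: side => //; lra.
Qed.

Lemma phi_lt1 n j s : (0 < j <= (q n).+1)%N -> 0 <= s <= 1 ->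
  (cstart q n).+1%:R < (cstart q n + j)%:R + s < (cstart q n.+1)%:R ->
  phi (cstart q n + j) s < 1.
Proof.
move=> /andP[j0 j1] s01 /andP[h1 h2]; have /andP[s0 s1] := s01.
have [p0 p1] := phi_bd q (cstart q n + j) s01; rewrite lt_neqAle p1 andbT; apply/eqP => e.
have jc : (j < csize q n)%N by rewrite /csize; lia.
have ri : in_run q (cstart q n + j) by rewrite in_runE.
have [[es nl]|[es nr]] := phi_eq1 qodd ri s01 e.
  rewrite lcrossE // in nl; have ej : j = 1%N by lia.
  by move: h1; rewrite es ej addn1 addr0 ltxx.
rewrite rcrossE // in nr; have ej : j = (q n).+1 by lia.
by move: h2; rewrite es ej cstartS natr1 ltxx.
Qed.

Lemma run_decompose n (X : R) : (cstart q n).+1%:R <= X -> X <= (cstart q n.+1)%:R ->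
  exists j s, [/\ (0 < j <= (q n).+1)%N, 0 <= s <= 1 & X = (cstart q n + j)%:R + s].
Proof.
move=> X1 X2; have X0 : 0 <= X by apply: le_trans X1; rewrite ler0n.
have /andP[h1 h2] := truncn_itv X0; set i := Num.truncn X in h1 h2.
have [e|ne] := eqVneq X (cstart q n.+1)%:R.
  exists (q n).+1, 1; split; [lia|lra|].
  by rewrite e cstartS natr1.
have X3 : X < (cstart q n.+1)%:R by rewrite lt_neqAle ne.
have i1 : (cstart q n < i)%N by rewrite -ltnS -(ltr_nat R); apply: le_lt_trans h2.
have i2 : (i < cstart q n.+1)%N by rewrite -(ltr_nat R); apply: le_lt_trans X3.
exists (i - cstart q n)%N, (X - i%:R); rewrite subnKC; last exact: ltnW.
split; last by ring.
  by move: i2; rewrite cstartS; lia.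
by rewrite -natr1 in h2; apply/andP; split; lra.
Qed.

Lemma kap_range n : ((cstart q n).+1 < kap q n < cstart q n.+1)%N.
Proof. by rewrite /kap cstartS; have := qpos qodd n; lia. Qed.

(** Strictly between the ends of the run [phi] is below 1, so the line [y = 1] stays inside the loop
    and joins all its columns. *)
Lemma value_loop n j s y : (0 < j <= (q n).+1)%N -> 0 <= s <= 1 ->
  phi (cstart q n + j) s < y -> y < 2 - phi (cstart q n + j) s ->
  value ((cstart q n + j)%:R + s) y = value (kap q n)%:R 1.
Proof.
move=> hj s01 y1 y2; have /andP[j0 j1] := hj; have /andP[s0 s1] := s01.
have jc : (j < csize q n)%N by [].
set i := (cstart q n + j)%N in y1 y2 *; have ri : in_run q i by rewrite in_runE.
have i0 := ler0n R i; have X0' : 0 <= i%:R + s by rewrite addr_ge0.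
have -> : value (i%:R + s) y = value (i%:R + s) 1.
  apply: value_between => // yy h; apply: run_free => //; constructor 2.
  by move: h; clear -y1 y2; case: (leP y 1) => ? /andP[? ?]; lra.
have ij : (i%:R : R) = (cstart q n)%:R + j%:R by rewrite natrD.
have c1 : (cstart q n).+1%:R < i%:R + s.
  rewrite -natr1 ij; have [j2|j2] := ltnP 1 j.
    have : 2 <= j%:R :> R by rewrite ler_nat.
    lra.
  have j11 : j = 1%N by apply/eqP; rewrite eqn_leq j2 j0.
  rewrite j11; have : s != 0; last by move=> h; have : 0 < s by [rewrite lt_neqAle eq_sym h]; lra.
  apply/eqP => e; move: y1 y2; rewrite e phi0 lcrossE // j11 /=; lra.
have c2 : i%:R + s < (cstart q n.+1)%:R.
  rewrite cstartS -natr1 natrD ij; have [j2|j2] := ltnP j (q n).+1.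
    have : j.+1%:R <= (q n).+1%:R :> R by rewrite ler_nat.
    rewrite -natr1; lra.
  have j11 : j = (q n).+1 by apply/eqP; rewrite eqn_leq j1.
  rewrite j11; have : s != 1; last by move=> h; have : s < 1 by [rewrite lt_neqAle h]; lra.
  apply/eqP => e; move: y1 y2; rewrite e phi1 rcrossE // j11 ltnn /=; lra.
have [k1 k2] : (cstart q n).+1%:R < (kap q n)%:R :> R /\ (kap q n)%:R < (cstart q n.+1)%:R :> R.
  by rewrite !ltr_nat; apply/andP; exact: kap_range.
apply: (@value_horizontal (i%:R + s) (kap q n)%:R (fun=> 1) X0' (ler0n _ _) (@contC _ _ _)).
move=> X X0 hX.
have [X1 X2] : (cstart q n).+1%:R < X /\ X < (cstart q n.+1)%:R.
  by move: hX; clear -c1 c2 k1 k2 hj; case: (leP (i%:R + s)) => h /andP[h1 h2]; lra.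
have [j' [s' [hj' s01' eX]]] := run_decompose (ltW X1) (ltW X2).
have lt1 : phi (cstart q n + j') s' < 1 by apply: phi_lt1 => //; rewrite -eX X1.
rewrite eX; apply: run_free => //; first by case/andP: hj' => j0' j1'; rewrite in_runE.
by constructor 2; clear -lt1; lra.
Qed.

End Regions.

Section Values.
Variables (R : realType) (q : nat -> nat).
Hypothesis qodd : forall n, odd (q n).
Notation E := 'rV[R]_3.
Notation K := (@knot_set R q).
Notation knot := (@knot R q).
Notation phi := (@phi R q).
Variables (A : Type) (t : E -> A).
Hypothesis tP : locally_constant (over_free q) t.
Notation value := (value t).

Definition side_value : A := value 1 ((ret 1 - 1) / 2).
Definition loop_value (n : nat) : A := value (kap q n)%:R 1.
Definition bigon_value (i : nat) : A := value (i%:R + 1 / 2) 0.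

Lemma run_column i : in_run q i -> exists n j, i = (cstart q n + j)%N /\ (0 < j <= (q n).+1)%N.
Proof.
elim/(@col_ind q): i => n j jc; rewrite in_runE // => j0.
by exists n, j; rewrite j0.
Qed.

(** The diagram has no other regions, as the position of [y] among the strands of its column
    shows. *)
Lemma value_cases (C : A -> Prop) : C (t (vec3 (-1) 0 0)) -> C side_value ->
  (forall n, C (loop_value n)) -> (forall i, in_run q i -> C (bigon_value i)) ->
  forall w, over_free q w -> C (t w).
Proof.
move=> C1 Ca Ch Cd w fw.
have outer : [\/ cx w < 0, 1 < cx w, 2 * (1 - cx w) < cy w | cy w < -3 * (1 - cx w)] -> C (t w).
  by move=> h; have [_ ->] := value_outside qodd tP h.
have [w1|w1|w1] := ltgtP (cx w) 1; last 2 first.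
- by apply: outer; constructor 2.
- have y0 : cy w != 0.
    by apply/eqP => y0; apply: (fw 0); left; apply: vec3_eq; rewrite !coordE.
  apply: outer; have [h|h|h] := ltgtP (cy w) 0; last by rewrite h eqxx in y0.
    by constructor 4; lra.
  by constructor 3; lra.
have [x0|x0] := ltP (cx w) 0; first by apply: outer; constructor 1.
have X0 : 0 <= Xc w by rewrite /Xc divr_ge0 //; lra.
have nk z := @free_knot R q qodd w z w1 fw.
rewrite -(value_coord tP w1 fw); set X := Xc w in X0 nk *; set y := Yc w in nk *.
have /andP[h1 h2] := truncn_itv X0; set i := Num.truncn X in h1 h2.
rewrite -natr1 in h2; pose s := X - i%:R; have s01 : 0 <= s <= 1 by rewrite /s; apply/andP; split; lra.
have eX : X = i%:R + s by rewrite /s; ring.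
have [y1|y1|y1] := ltgtP y (ret X).
- by rewrite (value_low qodd tP).
- rewrite eX; have [y2|y2|y2] := ltgtP y (- phi i s).
  + by rewrite (value_side qodd tP) // -eX.
  + have [ri|ri] := boolP (in_run q i); last first.
      have [p _] := @phi_gap R q i s ri; rewrite p in y2.
      by rewrite (value_gap qodd tP) // => z; rewrite -eX; exact: nk.
    have [y3|y3|y3] := ltgtP y (phi i s).
    * by rewrite (value_mid qodd tP) //; exact: Cd.
    * have [y4|y4|y4] := ltgtP y (2 - phi i s).
      - have [n [j [ei jn]]] := run_column ri.
        by rewrite ei (value_loop qodd tP) -?ei //; exact: Ch.
      - by rewrite (value_high qodd tP).
      by case: (nk 0); split => //; right; exists i, s; split => //; right; split => //; right.
    by case: (nk (theta q i s)); split => //; right; exists i, s; split => //; right; split => //; left.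
  by case: (nk (- theta q i s)); split => //; right; exists i, s; split => //; left.
by case: (nk 0); split => //; left.
Qed.

Lemma pt_near_X (X y z : R) N : -1 < X -> nbhs (pt X y z : E) N ->
  \forall s \near (0 : R), N (pt (X + s) y z).
Proof.
move=> X1; rewrite -{1}(addr0 X); move: N.
have cX : {for 0, continuous (fun s : R => 1 + (X + s))}.
  by apply: contD; [exact: contC|apply: contD; [exact: contC|move=> x; exact: cvg_id]].
have n0 : 1 + (X + 0) != 0 :> R by rewrite addr0 gt_eqF //; lra.
apply: (@vec3_cvg R R (nbhs (0 : R)) _ (fun s => (X + s) / (1 + (X + s)))
  (fun s => y / (1 + (X + s))) (fun s => z / (1 + (X + s)))).
- apply: (@cont_div R R (fun s => X + s) (fun s => 1 + (X + s)) 0) => //.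
  by apply: contD; [exact: contC|move=> x; exact: cvg_id].
- by apply: (@cont_div R R (fun s => y) (fun s => 1 + (X + s)) 0) => //; exact: contC.
- by apply: (@cont_div R R (fun s => z) (fun s => 1 + (X + s)) 0) => //; exact: contC.
Qed.

Lemma pt_near_Y (X y z : R) N : -1 < X -> nbhs (pt X y z : E) N ->
  \forall s \near (0 : R), N (pt X (y + s) z).
Proof.
move=> X1; rewrite -{1}(addr0 y); move: N.
have n0 : 1 + X != 0 :> R by rewrite gt_eqF //; lra.
apply: (@vec3_cvg R R (nbhs (0 : R)) _ (fun=> X / (1 + X))
  (fun s => (y + s) / (1 + X)) (fun=> z / (1 + X))); try exact: cvg_cst.
apply: (@cont_div R R (fun s => y + s) (fun s => 1 + X) 0) => //; last exact: contC.
by apply: contD; [exact: contC|move=> x; exact: cvg_id].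
Qed.

End Values.

Lemma common_lower_bound (R : realFieldType) (e1 e2 : R) : 0 < e1 -> 0 < e2 ->
  exists e, [/\ 0 < e, e < 1 / 2, e < e1 & e < e2].
Proof.
move=> e10 e20; exists (Num.min (1 / 2) (Num.min e1 e2) / 2).
by case: (leP e1 e2) => ?; [case: (leP (1 / 2) e1)|case: (leP (1 / 2) e2)] => ?; split; lra.
Qed.

Lemma convex_germ (R : realType) (G : groupType) (v : 'rV[R]_3 -> 'rV[R]_3 -> G)
  (B Y : set 'rV[R]_3) (u w : 'rV[R]_3 -> G) : convex_set (B `&` Y) ->
  trivialises v B w -> trivialises v Y u ->
  exists g, forall z, B z -> Y z -> (u z = g * w z)%g.
Proof.
move=> cBY wP uP; have [[b [Bb Yb]]|no] := pselect (exists z, (B `&` Y) z); last first.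
  by exists 1%g => z Bz Yz; case: no; exists z.
exists (u b * (w b)^-1)%g => z Bz Yz.
have lc := trivialises_ratio uP wP; rewrite setIC in lc.
by rewrite (convex_connective cBY lc (conj Bb Yb) (conj Bz Yz)) mulgVK.
Qed.

(** * Colouring relations at the crossings *)

Section Crossings.
Variables (R : realType) (q : nat -> nat).
Hypothesis qodd : forall n, odd (q n).
Notation E := 'rV[R]_3.
Notation K := (@knot_set R q).
Notation knot := (@knot R q).
Notation phi := (@phi R q).
Variables (G : groupType) (v : E -> E -> G) (uF uB : E -> G).
Hypothesis vP : local_system (~` K) v.
Hypothesis uFP : trivialises v (above K 1) uF.
Hypothesis uBP : trivialises v (above K (-1)) uB.

Lemma over_free_above (s : R) w : over_free q w -> above K s w.
Proof. by move=> fw k Kk hx hy; case: (fw (cz k)); rewrite -hx -hy vec3K. Qed.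

Definition transition (w : E) : G := (uF w * (uB w)^-1)%g.

Lemma transition_constant : locally_constant (over_free q) transition.
Proof.
apply: locally_constantW (trivialises_ratio uFP uBP) => w fw.
by split; exact: over_free_above.
Qed.

(** The coordinates are projective, so the two sides of a strand are cut out by half-spaces and meet
    balls in convex sets. *)
Lemma front_half_space i (w : E) : cx w < 1 ->
  (0 < front i w) = (0 < - (1 + i%:R) * cx w + 1 * cy w + 0 * cz w + i%:R) /\
  (front i w < 0) = (0 < (1 + i%:R) * cx w + -1 * cy w + 0 * cz w + - i%:R).
Proof.
move=> w1; have d : 0 < 1 - cx w by lra.
have e : front i w * (1 - cx w) = - (1 + i%:R) * cx w + 1 * cy w + 0 * cz w + i%:R.
  by rewrite /front /Xc /Yc; field; rewrite gt_eqF.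
split; first by rewrite -e pmulr_lgt0.
by rewrite -(pmulr_llt0 _ d) e -oppr_gt0; congr (0 < _); ring.
Qed.

Lemma back_half_space i (w : E) : cx w < 1 ->
  (0 < back i w) = (0 < (1 + i%:R) * cx w + 1 * cy w + 0 * cz w + - i%:R) /\
  (back i w < 0) = (0 < - (1 + i%:R) * cx w + -1 * cy w + 0 * cz w + i%:R).
Proof.
move=> w1; have d : 0 < 1 - cx w by lra.
have e : back i w * (1 - cx w) = (1 + i%:R) * cx w + 1 * cy w + 0 * cz w + - i%:R.
  by rewrite /back /Xc /Yc; field; rewrite gt_eqF.
split; first by rewrite -e pmulr_lgt0.
by rewrite -(pmulr_llt0 _ d) e -oppr_gt0; congr (0 < _); ring.
Qed.

(** Within a small ball each side of the front strand is convex and lies in front of the knot, so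
    there [uF] is a constant times the germ at [x]; the same holds for [uB] and the back strand. *)
Lemma crossing_sides i d x : lcross q i -> 0 < d -> d < 1 / 2 -> crossing_nbhd i d x ->
  ~ K x -> exists f b : bool -> G, \forall z \near x,
  (front i z != 0 -> uF z = f (0 < front i z) * v x z)%g /\
  (back i z != 0 -> uB z = b (0 < back i z) * v x z)%g.
Proof.
move=> l d0 d2 xN nK; have [r r0 vr] := ball_trivialises vP nK.
have /nbhs_ballP[r' /= r'0 hr'] := near_crossing_nbhd xN.
pose e := Num.min r r'; have e0 : 0 < e by rewrite lt_min r0.
have sub : ball x e `<=` ball x r `&` crossing_nbhd i d.
  move=> z zB; split; first by apply: le_ball zB; rewrite ge_min lexx.
  by apply: hr'; apply: le_ball zB; rewrite ge_min lexx orbT.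
have vB : trivialises v (ball x e) (v x) by apply: trivialisesW vr => z /sub[].
have H a1 b1 c1 s u : trivialises v (above K s) u ->
   (forall z, ball x e z -> half_space a1 b1 0 c1 z -> above K s z) ->
   exists g, forall z, ball x e z -> half_space a1 b1 0 c1 z -> (u z = g * v x z)%g.
  move=> uP hs; have uP' : trivialises v (ball x e `&` half_space a1 b1 0 c1) u.
    by apply: trivialisesW uP => z [? ?]; exact: hs.
  have cB := convex_setI (@convex_ball R x e) (@convex_half_space R a1 b1 0 c1).
  have [|g hg] := @convex_germ R G v (ball x e) _ u (v x) _ vB uP'.
    by apply: convex_setI => //; exact: convex_ball.
  by exists g => z Bz hz; apply: hg.
have N z : ball x e z -> crossing_nbhd i d z by move=> /sub[].
have w1 z : ball x e z -> cx z < 1 by move=> /N[].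
have n1 : (-1 : R) != 0 by rewrite oppr_eq0 oner_neq0.
have Fa z : ball x e z -> front i z != 0 -> above K 1 z.
  by move=> /N zN fz; apply/(above_front qodd l d0 d2 zN).
have Ba z : ball x e z -> back i z != 0 -> above K (-1) z.
  by move=> /N zN fz; apply/(below_back qodd l d0 d2 zN).
have [||f1 F1] := H (- (1 + i%:R)) 1 i%:R 1 uF => //.
  by move=> z Bz hz; apply: Fa => //; rewrite gt_eqF // (front_half_space i (w1 z Bz)).1.
have [||f2 F2] := H (1 + i%:R) (-1) (- i%:R) 1 uF => //.
  by move=> z Bz hz; apply: Fa => //; rewrite lt_eqF // (front_half_space i (w1 z Bz)).2.
have [||b1 B1] := H (1 + i%:R) 1 (- i%:R) (-1) uB => //.
  by move=> z Bz hz; apply: Ba => //; rewrite gt_eqF // (back_half_space i (w1 z Bz)).1.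
have [||b2 B2] := H (- (1 + i%:R)) (-1) i%:R (-1) uB => //.
  by move=> z Bz hz; apply: Ba => //; rewrite lt_eqF // (back_half_space i (w1 z Bz)).2.
exists (fun s => if s then f1 else f2), (fun s => if s then b1 else b2).
have nB : nbhs x (ball x e) by exact: nbhsx_ballx.
apply: filterS nB => z Bz; have [h1 h2] := front_half_space i (w1 z Bz).
have [h3 h4] := back_half_space i (w1 z Bz); split; rewrite neq_lt => /orP[h|h].
- by rewrite ltNge ltW //=; apply: F2 => //; rewrite /half_space /= -h2.
- by rewrite h; apply: F1 => //; rewrite /half_space /= -h1.
- by rewrite ltNge ltW //=; apply: B2 => //; rewrite /half_space /= -h4.
- by rewrite h; apply: B1 => //; rewrite /half_space /= -h3.
Qed.

Notation value := (value transition).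
Notation side := (side_value transition).
Notation loop := (loop_value q transition).
Notation bigon := (bigon_value transition).

(** Each of the four regions at the crossing has as value a quotient of two of the four constants.
    Eliminating them gives the relation [bigon i = side * (bigon i.-1)^-1 * loop]. *)
Lemma crossing_relation i d x : lcross q i -> 0 < d -> d < 1 / 2 -> crossing_nbhd i d x ->
  ~ K x -> Xc x = i%:R -> Yc x = 0 -> exists f b : bool -> G,
  [/\ \forall z \near x, (front i z != 0 -> uF z = f (0 < front i z) * v x z)%g /\
    (back i z != 0 -> uB z = b (0 < back i z) * v x z)%g,
   (f true * (b true)^-1 = loop (col_blk q i))%g, (f false * (b false)^-1 = side)%g,
   (f true * (b false)^-1 = bigon i.-1)%g & (f false * (b true)^-1 = bigon i)%g].
Proof.
move=> l d0 d2 xN nK eX eY; have [f [b fb]] := crossing_sides l d0 d2 xN nK.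
exists f, b; have tc : locally_constant (over_free q) transition := transition_constant.
have ex : x = pt i%:R 0 (Zc x).
  by case: xN => x1 _ _ _; have [_ {1}<-] := pt_coord x1; rewrite eX eY.
have i0 := ler0n R i.
have key z : crossing_nbhd i d z -> front i z != 0 -> back i z != 0 -> 
    (front i z != 0 -> uF z = f (0 < front i z) * v x z)%g /\
    (back i z != 0 -> uB z = b (0 < back i z) * v x z)%g ->
    over_free q z /\ (transition z = f (0 < front i z) * (b (0 < back i z))^-1)%g.
  move=> zN f0 b0 [/(_ f0) h1 /(_ b0) h2]; split.
    by apply: above_below_free; [apply/(above_front qodd l d0 d2 zN)|apply/(below_back qodd l d0 d2 zN)].
  by rewrite /transition h1 h2 invgM !mulgA mulgK.
pose P z := crossing_nbhd i d z /\
    ((front i z != 0 -> uF z = f (0 < front i z) * v x z)%g /\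
    (back i z != 0 -> uB z = b (0 < back i z) * v x z)%g).
have nP : nbhs (pt i%:R 0 (Zc x) : E) P by rewrite -ex; apply: filterI (near_crossing_nbhd xN) fb.
have i1 : -1 < i%:R :> R by lra.
have quad X y : -1 < X -> P (pt X y (Zc x)) -> y - (X - i%:R) != 0 -> y + (X - i%:R) != 0 ->
    (f (0 < y - (X - i%:R)) * (b (0 < y + (X - i%:R)))^-1 = value X y)%g.
  move=> X1 [zN hz]; have [z1 hX hY _] := @coord_pt R X y (Zc x) X1.
  move: hz; have := key _ zN; rewrite /front /back hX hY => h hz f0 b0.
  have [fz <-] := h f0 b0 hz; rewrite -(value_coord tc z1 fz).
  by rewrite hX hY.
have /nbhs_ballP[e1 /= e10 h1] := pt_near_X i1 nP.
have /nbhs_ballP[e2 /= e20 h2] := pt_near_Y i1 nP.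
have [e [e0 e2' e3 e4]] := common_lower_bound e10 e20.
have ne : (0 < - e) = false by rewrite oppr_gt0 ltNge ltW.
have B1 s : `|s| < e1 -> P (pt (i%:R + s) 0 (Zc x)).
  by move=> hs; apply: h1; rewrite -ball_normE /= sub0r normrN.
have B2 s : `|s| < e2 -> P (pt i%:R s (Zc x)).
  by move=> hs; rewrite -[s]add0r; apply: h2; rewrite -ball_normE /= sub0r normrN.
have [j ij] : exists j, i = j.+1 by case: (i) l => // j _; exists j.
have [ri ri1] : in_run q j /\ in_run q i by rewrite ij; apply: cross_runS; rewrite -ij.
have s01 : 0 <= (0 : R) <= 1 by rewrite lexx ler01.
have p0 : phi i 0 = 0 by rewrite phi0 l.
split; first exact: fb.
- have [n [k [ek kn]]] := run_column ri1.
  have en : col_blk q i = n by rewrite ek col_blkE //; case/andP: kn.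
  have e5 : value (i%:R + 0) e = loop n.
    by rewrite ek; apply: (value_loop qodd tc kn s01); rewrite -ek p0; clear -e0 e2' qodd vP uFP uBP; lra.
  rewrite en -e5 addr0; have h := quad i%:R e i1; rewrite subrr subr0 addr0 e0 in h.
  by apply: h; [apply: B2; rewrite gtr0_norm|rewrite gt_eqF|rewrite gt_eqF].
- have e5 : value (i%:R + 0) (- e) = side.
    by apply: (value_side qodd tc) => //; rewrite ?p0; [have [_ rb] := ret_bounds i0; rewrite addr0; clear -rb e2' qodd vP uFP uBP|clear -e0 qodd vP uFP uBP]; lra.
  rewrite -e5 addr0; have h := quad i%:R (- e) i1.
  rewrite subrr subr0 addr0 ne in h.
  by apply: h; [apply: B2; rewrite normrN gtr0_norm|rewrite lt_eqF // oppr_lt0|rewrite lt_eqF // oppr_lt0].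
- have r : rcross q j by rewrite rcross_lcrossS -ij.
  have u1 : 1 / 2 < 1 - e by clear -e2' qodd vP uFP uBP; lra.
  have u2 : 1 - e <= 1 by clear -e0 qodd vP uFP uBP; lra.
  have [p _] := @phi_rcross R q j (1 - e) r u1 u2.
  have ej : j%:R + (1 - e) = i%:R - e :> R by rewrite ij -natr1; ring.
  have e5 : value (j%:R + (1 - e)) 0 = bigon j.
    by apply: (value_mid qodd tc) => //; rewrite ?p; first (apply/andP; split); clear -e0 e2' qodd vP uFP uBP; lra.
  have -> : i.-1 = j by rewrite ij.
  rewrite -e5 ej; have h := quad (i%:R - e) 0.
  have e6 : i%:R - e - i%:R = - e by ring.
  rewrite e6 sub0r opprK add0r e0 ne in h.
  apply: h; [clear -i0 e0 e2' qodd vP uFP uBP; lra| |by rewrite gt_eqF|by rewrite lt_eqF // oppr_lt0].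
  by apply: B1; rewrite normrN gtr0_norm.
- have [p _] := @phi_lcross R q i e l e2' (ltW e0).
  have e5 : value (i%:R + e) 0 = bigon i.
    by apply: (value_mid qodd tc) => //; rewrite ?p; first (apply/andP; split); clear -e0 e2' qodd vP uFP uBP; lra.
  rewrite -e5; have h := quad (i%:R + e) 0.
  have e6 : i%:R + e - i%:R = e by ring.
  rewrite e6 sub0r add0r e0 ne in h.
  apply: h; [clear -i0 e0 e2' qodd vP uFP uBP; lra| |by rewrite lt_eqF // oppr_lt0|by rewrite gt_eqF].
  by apply: B1; rewrite gtr0_norm.
Qed.

(** The first and the last bigon of a run are open towards the neighbouring gap, through which they
    belong to the outer region. *)
Lemma bigon_ends n : [/\ bigon (cstart q n).+1 = transition (vec3 (-1) 0 0) &
  bigon (cstart q n + (q n).+1)%N = transition (vec3 (-1) 0 0)].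
Proof.
have tc := transition_constant.
have gap k : ~~ in_run q (cstart q k).
  by rewrite -[cstart q k]addn0 in_runE.
have s01 : 0 <= (0 : R) <= 1 by rewrite lexx ler01.
have s11 : 0 <= (1 : R) <= 1 by rewrite lexx ler01.
have free k (s : R) : 0 <= s <= 1 -> forall z, ~ knot ((cstart q k)%:R + s) 0 z.
  move=> t01 z; have X0 : 0 <= (cstart q k)%:R + s by rewrite addr_ge0 ?ler0n //; case/andP: t01.
  have [_ r2] := ret_bounds X0; have [p _] := @phi_gap R q _ s (gap k).
  by move=> /(knot_over t01)[h|h|[h _]|[_ h _]]; [lra|rewrite p in h; lra|rewrite (negPf (gap k)) in h|lra].
have [nr [_ [nl _]]] := run_end q n; split.
- have c1 : in_run q (cstart q n).+1 by rewrite -addn1 in_runE.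
  rewrite /bigon_value -(@value_mid R q qodd G transition tc _ 0 0) //; last 2 first.
  + by rewrite phi0 -addn1 (negPf nl); lra.
  + by rewrite phi0 -addn1 (negPf nl); lra.
  rewrite addr0 -natr1 (value_gap qodd tc) //; exact: free.
have c1 : in_run q (cstart q n + (q n).+1) by rewrite in_runE.
rewrite /bigon_value -(@value_mid R q qodd G transition tc _ 1 0) //; last 2 first.
+ by rewrite phi1 (negPf nr); lra.
+ by rewrite phi1 (negPf nr); lra.
rewrite natr1 -cstartS -[_%:R]addr0 (value_gap qodd tc) //; exact: free.
Qed.

End Crossings.

(** * Automorphisms of all local systems *)

Lemma conj_commute (G : groupType) (e k k' : G) : (e * (k * k'^-1) = k * k'^-1 * e ->
  k'^-1 * e * k' = k^-1 * e * k)%g.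
Proof.
by move=> ce; apply: (mulgI k); rewrite !mulgA -ce mulgV mul1g !mulgA mulgVK.
Qed.

Section Sign.
Local Open Scope group_scope.
Variables (G : groupType) (sgn : G -> bool).
Hypothesis sgnM : forall x y, sgn (x * y) = sgn x (+) sgn y.
Hypothesis sgn_inv : forall x, sgn x -> x * x = 1.

Lemma sgn1 : sgn 1 = false.
Proof. by have := sgnM 1 1; rewrite mulg1; case: (sgn 1). Qed.

Lemma sgnV x : sgn x^-1 = sgn x.
Proof. by have := sgnM x x^-1; rewrite mulgV sgn1; case: (sgn x); case: (sgn _). Qed.

(* The colouring equations of the run, solved from its left end. *)
Lemma run_equations (a h : G) (d : nat -> G) n : odd n ->
  (forall r, ~~ sgn r -> r ^+ n = 1 -> r = 1) ->
  d 0%N = 1 -> d n = 1 -> (forall j, (j < n)%N -> d j.+1 = a * (d j)^-1 * h) ->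
  if sgn a then h = a else ~~ sgn h.
Proof.
move=> on rn d0 dn dS.
have sd j : (j <= n)%N -> sgn (d j) = odd j && (sgn a (+) sgn h).
  elim: j => [|j IH] jn; first by rewrite d0 sgn1.
  rewrite dS // !sgnM sgnV IH ?(ltnW jn) //=.
  by case: (odd j); case: (sgn a); case: (sgn h).
have := sd n (leqnn n); rewrite dn sgn1 on /=; case sa: (sgn a); case sh: (sgn h) => // _.
have ai : a^-1 = a by apply: mulg1_eq; exact: sgn_inv.
have dE j : (j <= n)%N -> d j = (a * h) ^+ j.
  elim: j => [|j IH] jn; first by rewrite d0 expg0.
  by rewrite dS // IH ?(ltnW jn) // dihedral_power //; exact: sgn_inv.
have := dE n (leqnn n); rewrite dn => /esym e.
have : a * h = 1 by apply: rn => //; rewrite sgnM sa sh.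
by move=> /mulg1_eq; rewrite ai.
Qed.

End Sign.

Section UpperBound.
Variables (R : realType) (q : nat -> nat).
Hypothesis qodd : forall n, odd (q n).
Notation E := 'rV[R]_3.
Notation K := (@knot_set R q).

Lemma quarter : 0 < (1 / 4 : R) /\ (1 / 4 : R) < 1 / 2.
Proof. by split; lra. Qed.

Lemma crossing_midpoint i : lcross q i -> let x := pt i%:R 0 0 : E in
  [/\ crossing_nbhd i (1 / 4) x, ~ K x, Xc x = i%:R & Yc x = 0].
Proof.
move=> l; have i0 := ler0n R i; have i1 : -1 < i%:R :> R by lra.
have [w1 eX eY eZ] := @coord_pt R i%:R 0 0 i1; split => //.
  by split; rewrite ?eX ?eY ?eZ ?subrr ?normr0 //; lra.
move=> /(knot_setP qodd w1); rewrite eX eY eZ.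
have X2 : `|i%:R - i%:R : R| < 1 / 2 by rewrite subrr normr0; lra.
have Y2 : `|0 : R| < 1 / 2 by rewrite normr0; lra.
by move=> /(knot_crossing _ l X2 Y2); rewrite subrr normr0; case=> [[_ ?]|[_ ?]]; lra.
Qed.

Lemma above_dense x N : ~ K x -> ~ above K 1 x -> ~ above K (-1) x -> nbhs x N ->
  exists z, N z /\ above K 1 z.
Proof.
move=> nK nF nB Nx; have [w1 eY _ _] := between_crossing qodd nK nF nB.
have [i [c [l eX c0 c2 xN]]] := crossing_nbhd_ex qodd nK nF nB.
have i0 := ler0n R i; have i1 : -1 < i%:R :> R by lra.
have ex : x = pt i%:R 0 (Zc x) by have [_ {1}<-] := pt_coord w1; rewrite eX eY.
have nP : nbhs (pt i%:R 0 (Zc x) : E) (fun z => N z /\ crossing_nbhd i c z).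
  by rewrite -ex; apply: filterI Nx (near_crossing_nbhd xN).
have /nbhs_ballP[r /= rp hr] := pt_near_Y i1 nP.
have [|Nz zN] := hr (r / 2).
  by rewrite -ball_normE /= sub0r normrN gtr0_norm; lra.
exists (pt i%:R (0 + r / 2) (Zc x)); split => //.
apply/(above_front qodd l c0 c2 zN); have [_ hX hY _] := @coord_pt R i%:R (0 + r / 2) (Zc x) i1.
by rewrite /front hX hY subrr subr0 add0r gt_eqF //; lra.
Qed.

Variables (G : groupType) (sgn : G -> bool).
Hypothesis sgnM : forall x y, sgn (x * y)%g = sgn x (+) sgn y.
Hypothesis sgn_inv : forall x, sgn x -> (x * x = 1)%g.
Hypothesis sgnC : forall x y, ~~ sgn x -> ~~ sgn y -> (x * y = y * x)%g.
Hypothesis torsion : forall n r, ~~ sgn r -> (r ^+ q n = 1)%g -> r = 1%g.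
Variable r0 : G.
Hypotheses (r01 : r0 <> 1%g) (sr0 : ~~ sgn r0).

(** A constant that commutes with all transition elements gives an automorphism in front and the
    same one behind. If the side value [a] is a reflection, then every loop value equals [a] and [a]
    commutes with everything; otherwise all values are rotations and [r0] does. *)
Theorem complement_auto (v : E -> E -> G) : local_system (~` K) v -> has_auto v (~` K).
Proof.
move=> vP; have cK : compact K := knot_set_compact qodd.
have n1 : (-1 : R) != 0 by rewrite oppr_eq0 oner_neq0.
have [uF' uFP'] := above_trivialises cK vP (oner_neq0 R).
have [uB uBP] := above_trivialises cK vP n1.
(* Rescaling the front trivialisation by [g] normalises the value of the outer region to 1. *)
pose g := (transition uF' uB (vec3 (-1) 0 0))^-1%g.
pose uF z := (g * uF' z)%g; have uFP : trivialises v (above K 1) uF by exact: trivialises_mull.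
have t1 : transition uF uB (vec3 (-1) 0 0) = 1%g.
  by rewrite /transition /uF /g /transition -mulgA mulVg.
set t := transition uF uB in t1.
have tc : locally_constant (over_free q) t by exact: (transition_constant uFP uBP).
pose a := side_value t; pose h := loop_value q t; pose d := bigon_value t.
have rel i : lcross q i -> (d i = a * (d i.-1)^-1 * h (col_blk q i))%g.
  move=> l; have [xN nK eX eY] := crossing_midpoint l; have [c0 c2] := quarter.
  have [f [b [_ e1 e2 e3 e4]]] := crossing_relation qodd vP uFP uBP l c0 c2 xN nK eX eY.
  rewrite /d /a /h -e1 -e2 -e3 -e4 invgM invgK !mulgA.
  by rewrite mulgVK mulgVK.
have eqs n : if sgn a then h n = a else ~~ sgn (h n).
  have [b1 b2] := bigon_ends qodd uFP uBP n; rewrite -/t t1 in b1 b2.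
  apply: (@run_equations G sgn sgnM sgn_inv a (h n) (fun j => d (cstart q n + j.+1)%N) (q n)) => //.
  - exact: torsion.
  - by rewrite addn1.
  - move=> j jn; have l : lcross q (cstart q n + j.+2) by rewrite lcrossE.
    by rewrite rel // col_blkE // addnS.
pose e := if sgn a then a else r0.
have e1 : e != 1%g.
  by rewrite /e; case: ifP => [sa|_]; apply/eqP => // e1; rewrite e1 sgn1 in sa.
have ea : (e * a = a * e)%g by rewrite /e; case: ifP => // /negbT sa; exact: sgnC.
have eh n : (e * h n = h n * e)%g.
  by have := eqs n; rewrite /e; case: ifP => [_ ->//|_]; exact: sgnC.
have ed i : in_run q i -> (e * d i = d i * e)%g.
  move=> /run_column[n [j [-> /andP[j0 jn]]]].
  elim: j j0 jn => // j IH _ jn; case: j IH jn => [|j] IH jn.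
    have b1 : d (cstart q n).+1 = 1%g by rewrite /d /t (bigon_ends qodd uFP uBP n).1.
    by rewrite addn1 b1 mulg1 mul1g.
  have l : lcross q (cstart q n + j.+2) by rewrite lcrossE.
  have p : ((cstart q n + j.+2).-1 = cstart q n + j.+1)%N by rewrite addnS.
  rewrite rel // col_blkE // p.
  apply: commuteM (eh n); apply: commuteM ea _; apply: commuteV.
  exact: IH isT (ltnW jn).
have et w : over_free q w -> (e * t w = t w * e)%g.
  apply: (@value_cases R q qodd G t tc (fun x => e * x = x * e)%g) => //.
  by rewrite t1 mulg1 mul1g.
pose al z := if `[< above K 1 z >] then ((uF z)^-1 * e * uF z)%g else ((uB z)^-1 * e * uB z)%g.
have alB z : above K (-1) z -> al z = ((uB z)^-1 * e * uB z)%g.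
  rewrite /al; case: asboolP => // zF zB.
  have := et z (above_below_free zF zB); rewrite /t /transition => c.
  exact/esym/conj_commute.
have alF z : above K 1 z -> al z = ((uF z)^-1 * e * uF z)%g by rewrite /al; case: asboolP.
have oF s : open (above K s) by exact: open_above.
have au : nontrivial_auto v (above K 1 `|` above K (-1)) al.
  apply: nontrivial_autoU => //.
    apply: eq_nontrivial_auto (trivialises_auto uFP e1) => z zF; by rewrite alF.
  apply: eq_nontrivial_auto (trivialises_auto uBP e1) => z zB; by rewrite alB.
have [al1 alP] := au.
(* Only the segments between the strands of a crossing are missing, and they are limits of points in
   front. *)
apply: (extend_auto (D := above K 1 `|` above K (-1)) vP _ al1).
- move=> x nK N Nx; have [xD|nD] := pselect ((above K 1 `|` above K (-1)) x).
    by exists x; split => //; exact: nbhs_singleton.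
  have nF : ~ above K 1 x by move=> xF; apply: nD; left.
  have nB : ~ above K (-1) x by move=> xF; apply: nD; right.
  by have [z [Nz zF]] := above_dense nK nF nB Nx; exists z; split => //; left.
move=> x nK; have [xD|nD] := pselect ((above K 1 `|` above K (-1)) x).
  have [k hk] := alP x xD; by exists k.
have nF : ~ above K 1 x by move=> xF; apply: nD; left.
have nB : ~ above K (-1) x by move=> xF; apply: nD; right.
have [w1 eY _ _] := between_crossing qodd nK nF nB.
have [i [c [l eX c0 c2 xN]]] := crossing_nbhd_ex qodd nK nF nB.
have [f [b [fb h1 h2 h3 h4]]] := crossing_relation qodd vP uFP uBP l c0 c2 xN nK eX eY.
(* The conjugates of [e] by the four constants coincide, since [e] commutes with the values of loop,
   left bigon and side; so the automorphism has one value from all sides. *)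
have J1 : ((b true)^-1 * e * b true = (f true)^-1 * e * f true)%g by apply: conj_commute; rewrite h1.
have J2 : ((b false)^-1 * e * b false = (f true)^-1 * e * f true)%g.
  apply: conj_commute; rewrite h3; apply: ed.
  by move: l; case: (i) => // k /cross_runS[].
have J3 : ((b false)^-1 * e * b false = (f false)^-1 * e * f false)%g by apply: conj_commute; rewrite h2.
exists ((f true)^-1 * e * f true)%g.
apply: filterS2 fb (near_crossing_nbhd xN) => z [zF zB] zN [zD|zD].
  have /zF eF : front i z != 0 by apply/(above_front qodd l c0 c2 zN).
  rewrite alF // eF invgM !mulgA mulgV mul1g mulgK.
  by case: (0 < front i z) => //; rewrite -J3 J2.
have /zB eB : back i z != 0 by apply/(below_back qodd l c0 c2 zN).
rewrite alB // eB invgM !mulgA mulgV mul1g mulgK.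
by case: (0 < back i z).
Qed.

End UpperBound.

(** * The family of knots *)

(* [(x, s)] is the map [z |-> x + (-1)^s z] of the integers modulo [m]. *)
Definition dihedral (m : nat) : Type := ('Z_m * bool)%type.
HB.instance Definition _ m := Finite.copy (dihedral m) ('Z_m * bool)%type.

Section Dihedral.
Variable m : nat.
Notation D := (dihedral m).

Definition dihedral_mul (x y : D) : D :=
  (if x.2 then x.1 - y.1 else x.1 + y.1, x.2 (+) y.2).
Definition dihedral_one : D := (0, false).
Definition dihedral_inv (x : D) : D := (if x.2 then x.1 else - x.1, x.2).

Lemma dihedral_mulA : associative dihedral_mul.
Proof.
move=> [x s] [y t] [z u]; rewrite /dihedral_mul /= addbA; congr pair.
by case: s; case: t => /=; ring.
Qed.

Lemma dihedral_mul1 : left_id dihedral_one dihedral_mul.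
Proof. by move=> [x s]; rewrite /dihedral_mul /= add0r. Qed.

Lemma dihedral_mulV : left_inverse dihedral_one dihedral_inv dihedral_mul.
Proof.
move=> [x s]; rewrite /dihedral_mul /dihedral_one /= addbb; congr pair.
by case: s; ring.
Qed.

End Dihedral.

HB.instance Definition _ m := Finite_isGroup.Build (dihedral m)
  (@dihedral_mulA m) (@dihedral_mul1 m) (@dihedral_mulV m).

Section DihedralGroup.
Variable m : nat.
Notation D := (dihedral m).

Definition dihedral_sign (x : D) : bool := x.2.
Definition dihedral_rot (x : 'Z_m) : D := (x, false).
Definition refl0 : D := (0, true).
Definition refl1 : D := (1, true).

Lemma dihedral_mulE (x y : D) :
  (x * y)%g = (if x.2 then x.1 - y.1 else x.1 + y.1, x.2 (+) y.2) :> D.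
Proof. by []. Qed.

Lemma dihedral_signM (x y : D) :
  dihedral_sign (x * y)%g = dihedral_sign x (+) dihedral_sign y.
Proof. by []. Qed.

Lemma dihedral_sign_inv (x : D) : dihedral_sign x -> (x * x)%g = 1%g.
Proof.
by case: x => x s; rewrite /dihedral_sign /= => ->; rewrite dihedral_mulE /= subrr.
Qed.

Lemma dihedral_signC (x y : D) : ~~ dihedral_sign x -> ~~ dihedral_sign y -> (x * y)%g = (y * x)%g.
Proof.
case: x y => [x s] [y t]; rewrite /dihedral_sign /= => /negPf -> /negPf ->.
by rewrite !dihedral_mulE /= addrC.
Qed.

Lemma dihedral_rot_power (x : 'Z_m) k : (dihedral_rot x ^+ k)%g = dihedral_rot (x *+ k).
Proof.
elim: k => [|k IH]; first by rewrite expg0 mulr0n.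
by rewrite expgS IH dihedral_mulE /= mulrS.
Qed.

Hypothesis m1 : (1 < m)%N.

(** Coprimality makes [k] a unit modulo [m], and the power of a translation is a multiple. *)
Lemma dihedral_torsion k (r : D) : coprime m k -> ~~ dihedral_sign r ->
  (r ^+ k)%g = 1%g -> r = 1%g.
Proof.
case: r => x s; rewrite /dihedral_sign /= => ck /negPf ->.
rewrite (dihedral_rot_power x k) => -[xk].
have uk : (k%:R : 'Z_m) \is a GRing.unit by rewrite unitZpE.
suff -> : x = 0 by [].
by apply: (mulIr uk); rewrite mul0r -xk mulr_natr.
Qed.

Lemma dihedral_reflections k : (m %| k)%N ->
  ((refl0 * refl1) ^+ k)%g = 1%g.
Proof.
move=> mk; have -> : (refl0 * refl1)%g = dihedral_rot (-1).
  by congr pair; exact: sub0r.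
rewrite dihedral_rot_power mulNrn; congr pair.
have -> : (1 *+ k : 'Z_m) = 0; last by rewrite oppr0.
by apply: ord_inj; rewrite val_Zp_nat //; apply/eqP.
Qed.

(** Commuting with [refl0] kills twice the translation part, hence the part itself as 2 is a unit.
    This leaves 1 and [refl0], and the latter commutes with [refl1] only if 2 is 0 modulo [m]. *)
Lemma dihedral_centre (e : D) : odd m -> (e * refl0 = refl0 * e)%g ->
  (e * refl1 = refl1 * e)%g -> e = 1%g.
Proof.
move=> om; case: e => x s; rewrite !dihedral_mulE /=.
have u2 : (2 : 'Z_m) \is a GRing.unit by rewrite unitZpE // coprime_sym prime_coprime // dvdn2 om.
have two0 (y : 'Z_m) : y + y = 0 -> y = 0.
  by move=> h; apply: (mulIr u2); rewrite mul0r mulr_natr mulr2n.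
move=> -[e1 _] -[e2 _]; have x0 : x = 0.
  apply: two0; move: e1; case: s {e2}; rewrite ?subr0 ?addr0 sub0r => e1; by rewrite {1}e1 addNr.
rewrite x0 in e2 *; case: s {e1} e2 => //; rewrite sub0r subr0 => e2.
have : (1 : 'Z_m) = 0 by apply: two0; rewrite -{1}e2 addNr.
by move/eqP; rewrite oner_eq0.
Qed.

End DihedralGroup.

Section Primes.

(** Starting at 5 keeps these primes coprime to the 3 crossings of the other runs. *)
Fixpoint large_prime (n : nat) : nat :=
  if n is k.+1 then s2val (prime_above (large_prime k)) else 5.

Lemma large_prime_prime n : prime (large_prime n).
Proof. by case: n => //= k; case: (prime_above _). Qed.

Lemma large_primeS n : (large_prime n < large_prime n.+1)%N.
Proof. by rewrite /=; case: (prime_above _). Qed.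

Lemma large_prime_mono n k : (n < k)%N -> (large_prime n < large_prime k)%N.
Proof.
elim: k => // k IH; rewrite ltnS leq_eqVlt => /orP[/eqP ->|/IH h]; first exact: large_primeS.
exact: ltn_trans h (large_primeS k).
Qed.

Lemma large_prime_gt3 n : (3 < large_prime n)%N.
Proof. by elim: n => // n IH; apply: ltn_trans IH (large_primeS n). Qed.

Lemma large_prime_coprime n k : n != k -> coprime (large_prime n) (large_prime k).
Proof.
move=> nk; rewrite prime_coprime ?large_prime_prime // dvdn_prime2 ?large_prime_prime //.
by move: nk; rewrite neq_ltn => /orP[] /large_prime_mono; rewrite neq_ltn => ->; rewrite ?orbT.
Qed.

Definition crossings (S : nat -> bool) (n : nat) : nat :=
  if odd n && S n./2 then large_prime n./2 else 3.

Lemma crossings_odd S n : odd (crossings S n).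
Proof.
rewrite /crossings; case: ifP => // _; apply: contraT; rewrite -dvdn2.
by rewrite dvdn_prime2 // ?large_prime_prime // => /eqP e; have := large_prime_gt3 n./2; rewrite -e.
Qed.

Lemma crossings_coprime S n k : ~~ S n -> coprime (large_prime n) (crossings S k).
Proof.
move=> nS; rewrite /crossings; case: ifP => [/andP[_ Sk]|_].
  by apply: large_prime_coprime; apply: contraNneq nS => ->.
rewrite prime_coprime ?large_prime_prime // dvdn_prime2 ?large_prime_prime //.
by rewrite neq_ltn large_prime_gt3 orbT.
Qed.

End Primes.

Section Family.
Variable R : realType.
Notation E := 'rV[R]_3.

Definition knots (S : nat -> bool) : S1 R -> E := knot_map (crossings S).
Notation K S := (@knot_set R (crossings S)).

(* The homomorphism of the knot group onto the dihedral group that is nontrivial on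
   the runs in [P] only. *)
Definition run_system (S : nat -> bool) (m : nat) (P : pred nat) : E -> E -> dihedral m :=
  dihedral_system (crossings S) (refl0 m) (fun n => if P n then refl1 m else refl0 m).

Lemma range_knots S : range (knots S) = K S.
Proof. by apply: range_knot_map; exact: crossings_odd. Qed.

Section RunSystem.
Variables (S : nat -> bool) (m : nat) (P : pred nat).
Hypotheses (m1 : (1 < m)%N) (om : odd m).
Hypothesis mP : forall n, P n -> (m %| crossings S n)%N.

Let aa : (refl0 m * refl0 m = 1)%g. Proof. exact: dihedral_sign_inv. Qed.

Let hh n : ((if P n then refl1 m else refl0 m) * (if P n then refl1 m else refl0 m) = 1)%g.
Proof. by apply: dihedral_sign_inv; case: ifP. Qed.

Let ahq n : ((refl0 m * (if P n then refl1 m else refl0 m)) ^+ crossings S n = 1)%g.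
Proof.
case: ifP => [Pn|_]; first exact/(dihedral_reflections m1)/mP.
by rewrite aa expg1n.
Qed.

Lemma run_system_local : local_system (~` K S) (run_system S m P).
Proof. exact: (dihedral_local_system (@crossings_odd S)). Qed.

Lemma run_system_nontrivial n : P n -> ~ has_auto (run_system S m P) (ladder (crossings S) n).
Proof.
move=> Pn h; have [e [e1 ea]] := ladder_no_auto (@crossings_odd S) ahq h.
by rewrite Pn => eh; apply: e1; exact: (dihedral_centre m1 om ea eh).
Qed.

Lemma run_system_trivial n : ~~ P n -> has_auto (run_system S m P) (ladder (crossings S) n).
Proof.
move=> Pn; apply: (ladder_auto R (@crossings_odd S) aa ahq); last by rewrite (negPf Pn).
by move=> [].
Qed.

End RunSystem.

Lemma knots_wild S : wild_at (K S) (limit_pt R).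
Proof.
have m3 n : ~~ odd n -> (3 %| crossings S n)%N by move=> /negPf no; rewrite /crossings no.
move=> tame; have Kp : K S (limit_pt R) by left.
have r0 : (refl0 3 != 1)%g by [].
have [V [Vp hV]] := tame_has_auto r0 Kp tame (@run_system_local S 3 (fun n => ~~ odd n) isT m3).
have [n0 hn] := ladder_small (crossings S) Vp.
apply: (@run_system_nontrivial S 3 (fun n => ~~ odd n) isT isT m3 n0.*2); first by rewrite odd_double.
apply: has_autoW hV => w wl; split; last exact: (ladder_off (@crossings_odd S) wl).
by apply: hn wl; rewrite -addnn leq_addr.
Qed.

Lemma knots_not_attractor S f : homeomorphism f -> ~ attractor f (K S).
Proof.
have m3 j n : n == j.*2 -> (3 %| crossings S n)%N.
  by move=> /eqP ->; rewrite /crossings odd_double.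
apply: (@not_attractor R _ (K S) (fun j => run_system S 3 (fun n => n == j.*2))
  (fun j => ladder (crossings S) j.*2)).
- exact/knot_set_compact/crossings_odd.
- by move=> j; apply: run_system_local => //; exact: m3.
- by move=> j; exact: ladder_closed.
- by move=> j; exact: (ladder_off (@crossings_odd S)).
- by move=> j; apply: run_system_nontrivial => //; exact: m3.
by move=> i j ij; apply: run_system_trivial => //; [exact: m3|apply: contraNN ij => /eqP/double_inj ->].
Qed.

Lemma knots_inequivalent (S S' : nat -> bool) n : S n -> ~~ S' n -> forall h : E -> E,
  homeomorphism h -> h @` K S = K S' -> False.
Proof.
move=> Sn nS' h [hc [g [gc hg gh]]] hK; set m := large_prime n.
have pm : prime m := large_prime_prime n.
have m3 := large_prime_gt3 n; have m1 : (1 < m)%N by exact: prime_gt1.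
have om : odd m by have := crossings_odd S n.*2.+1; rewrite /crossings /= odd_double uphalf_double Sn.
have mP k : k == n.*2.+1 -> (m %| crossings S k)%N.
  by move=> /eqP ->; rewrite /crossings /= odd_double uphalf_double Sn.
pose v := run_system S m (fun k => k == n.*2.+1).
apply: (@run_system_nontrivial S m (fun k => k == n.*2.+1) m1 om mP n.*2.+1 (eqxx _)).
have gK : g @^-1` (~` K S) = ~` K S'.
  rewrite -hK; apply/seteqP; split=> [y nk [x Kx e]|y nk Kg]; first by apply: nk; rewrite -e /= hg.
  by apply: nk; exists (g y) => //; rewrite gh.
(* The inverse [g] carries the system to the complement of the second knot; the automorphism found
   there comes back along [h]. *)
have vP := local_system_comp gc (run_system_local m1 mP); rewrite gK in vP.
have tor k (r : dihedral m) : ~~ dihedral_sign r -> (r ^+ crossings S' k = 1)%g -> r = 1%g.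
  by apply: (dihedral_torsion m1); exact: crossings_coprime.
have r1 : dihedral_rot (1 : 'Z_m) <> 1%g by move=> [].
have := complement_auto (@crossings_odd S') (@dihedral_signM m) (@dihedral_sign_inv m)
  (@dihedral_signC m) tor r1 isT vP.
move=> /(has_auto_comp hc); rewrite -gK.
have -> : h @^-1` (g @^-1` (~` K S)) = ~` K S.
  by apply/funext => x /=; rewrite hg.
under eq_fun do under eq_fun do rewrite !hg.
by apply: has_autoW; exact: (ladder_off (@crossings_odd S)).
Qed.

Lemma homeomorphism_id (T : topologicalType) : homeomorphism (@id T).
Proof. by split=> [x|]; [exact: cvg_id|exists id; split=> // x; exact: cvg_id]. Qed.

Lemma homeomorphism_sym (T U : topologicalType) (h : T -> U) (A : set T) (B : set U) :
  homeomorphism h -> h @` A = B -> exists2 g : U -> T, homeomorphism g & g @` B = A.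
Proof.
move=> [hc [g [gc hg gh]]] <-; exists g; first by split => //; exists h.
apply/seteqP; split=> [_ [_ [x Ax <-] <-]|x Ax]; first by rewrite hg.
by exists (h x) => //; exists x.
Qed.

Lemma knots_equivalent S S' : equivalent (knots S) (knots S') -> S = S'.
Proof.
rewrite /equivalent !range_knots => -[h hh hK]; apply/funext => n.
have [g gg gK] := homeomorphism_sym hh hK.
case Sn: (S n); case Sn': (S' n) => //; exfalso.
  by apply: (@knots_inequivalent S S' n Sn (negbT Sn') h).
by apply: (@knots_inequivalent S' S n Sn' (negbT Sn) g).
Qed.

Lemma knots_inj : injective knots.
Proof.
move=> S S' e; apply: knots_equivalent; rewrite e; exists id; first exact: homeomorphism_id.
by rewrite image_id.
Qed.

Lemma knots_uncountable : ~ countable (range knots).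
Proof.
move=> /countable_injP[f finj].
(* Cantor's diagonal set: the question whether it contains its own index [f (knots S)] leads to a
   contradiction either way. *)
pose S n := `[< exists S, f (knots S) = n /\ ~~ S n >].
have [/asboolP[S' [e nS']]|nS] := boolP (S (f (knots S))).
  have /knots_inj eS : knots S' = knots S.
    by apply: finj e; apply: mem_set; [exists S'|exists S].
  have : S (f (knots S)) by apply/asboolP; exists S'.
  by rewrite -{1}eS (negPf nS').
by move/asboolPn: (nS); apply; exists S.
Qed.

End Family.

Theorem corollary28 (R : realType) :
  exists F : set (S1 R -> 'rV[R]_3),
    [/\ ~ countable F,
        (forall e e' : S1 R -> 'rV[R]_3,
           F e -> F e' -> e <> e' -> ~ equivalent e e') &
        forall e : S1 R -> 'rV[R]_3, F e ->
          [/\ embedding e,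
              (forall f : 'rV[R]_3 -> 'rV[R]_3,
                 homeomorphism f -> ~ attractor f (range e)) &
              exists p : 'rV[R]_3,
                [/\ range e p, wild_at (range e) p &
                  forall q : 'rV[R]_3, range e q -> q <> p ->
                    tame_at (range e) q]]].
Proof.
exists (range (@knots R)); split; first exact: knots_uncountable.
  by move=> _ _ [S _ <-] [S' _ <-] ne /knots_equivalent e; apply: ne; rewrite e.
move=> _ [S _ <-]; have qo := @crossings_odd S; rewrite range_knots; split.
- exact: knot_map_embedding.
- by move=> f; exact: knots_not_attractor.
exists (limit_pt R); split; [by left|exact: knots_wild|].
by move=> w [->//|[s ->] _]; exact: knot_tame.
Qed.
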